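(* Let $n\in\mathbb{N}$, let $\Omega\subset\mathbb{R}^n$ be a bounded domain with Lipschitz boundary, $T>0$ and $s>0$ a non-integer. Let $W_2\subset\Omega_e$ be a nonempty open set. Suppose that the nonlinearities $f_1,f_2\colon\Omega\times\mathbb{R}\to\mathbb{R}$ are admissible (in the sense defined in the context) and that $(u_{0,j},u_{1,j})\in\widetilde H^s(\Omega)\times L^2(\Omega)$ for $j=1,2$. Let $\Lambda_j:=\Lambda^{f_j}_{u_{0,j},u_{1,j}}$ be the Dirichlet-to-Neumann map of $$\begin{cases}\partial_t^2u_j+(-\Delta)^su_j+f_j(x,u_j)=0&\text{in }\Omega_T,\\ u_j=\varphi&\text{in }(\Omega_e)_T,\\ u_j(0)=u_{0,j},\quad\partial_tu_j(0)=u_{1,j}&\text{in }\Omega,\end{cases}$$ for $j=1,2$. If $\Lambda_1(0)\big|_{(W_2)_T}=\Lambda_2(0)\big|_{(W_2)_T}$, then $$u_{0,1}=u_{0,2}\quad\text{and}\quad u_{1,1}=u_{1,2}\quad\text{in }\Omega.$$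
   Context: Notation. $\Omega_e:=\mathbb{R}^n\setminus\overline{\Omega}$; $A_t:=A\times(0,t)$ for $A\subset\mathbb{R}^n$, $t>0$. All functions are real-valued. $(-\Delta)^{s}$ is the Fourier multiplier with symbol $|\xi|^{2s}$. $H^s(\mathbb{R}^n)$ is the $L^2$-based Sobolev space with norm $\|(1+|\xi|^2)^{s/2}\widehat u\|_{L^2}$ (up to a constant), and $\widetilde H^s(\Omega)$ is the closure of $C_c^\infty(\Omega)$ in $H^s(\mathbb{R}^n)$. For a function $u$ on space-time, $u(t)$ denotes $x\mapsto u(x,t)$. Carathéodory function: $f\colon\Omega\times\mathbb{R}\to\mathbb{R}$ with $\tau\mapsto f(x,\tau)$ continuous for a.e. $x\in\Omega$ and $x\mapsto f(x,\tau)$ measurable for all $\tau\in\mathbb{R}$. Admissible nonlinearity: a Carathéodory function $f\colon\Omega\times\mathbb{R}\to\mathbb{R}$ such that (i) $f$ has a partial derivative $\partial_\tau f$ which is a Carathéodory function, and there are exponents $p,r$, a function $a\in L^p(\Omega)$ and a constant $C>0$ with $|\partial_\tau f(x,\tau)|\le C(a(x)+|\tau|^r)$ for all $\tau\in\mathbb{R}$ and a.e. $x\in\Omega$, where $p$ satisfies: $n/s\le p\le\infty$ if $2s<n$; $2<p\le\infty$ if $2s=n$; $2\le p\le\infty$ if $2s>n$; and $r$ satisfies: $0\le r<\infty$ if $2s\ge n$; $0\le r\le\frac{2s}{n-2s}$ if $2s<n$; moreover $f(\cdot,0)\in L^2(\Omega)$; (ii) there is a constant $C_1>0$ with $F(x,\tau):=\int_0^\tau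 f(x,\rho)\,d\rho\ge -C_1$ for all $\tau\in\mathbb{R}$, $x\in\Omega$. Solutions. For $(u_0,u_1)\in\widetilde H^s(\Omega)\times L^2(\Omega)$ and $\varphi\in C_c^\infty((\Omega_e)_T)$ (extended by zero), a solution of $\partial_t^2u+(-\Delta)^su+f(x,u)=0$ in $\Omega_T$, $u=\varphi$ in $(\Omega_e)_T$, $u(0)=u_0$, $\partial_tu(0)=u_1$ in $\Omega$, is a function $u\in C([0,T];H^s(\mathbb{R}^n))$ with $\partial_tu\in C([0,T];L^2(\mathbb{R}^n))$, $u=\varphi$ a.e. in $(\Omega_e)_T$, satisfying the initial conditions in $\Omega$ and $$\tfrac{d}{dt}\langle\partial_tu,v\rangle_{L^2(\Omega)}+\langle(-\Delta)^{s/2}u,(-\Delta)^{s/2}v\rangle_{L^2(\mathbb{R}^n)}+\langle f(\cdot,u),v\rangle_{L^2(\Omega)}=0$$ for all $v\in\widetilde H^s(\Omega)$ in the sense of distributions on $(0,T)$. For admissible $f$ there is exactly one solution. Dirichlet-to-Neumann map: $\Lambda^f_{u_0,u_1}$ is defined by $$\langle\Lambda^f_{u_0,u_1}\varphi,\psi\rangle:=\int_{\mathbb{R}^n_T}(-\Delta)^{s/2}u\,(-\Delta)^{s/2}\psi\,dx\,dt,\qquad \varphi,\psi\in C_c^\infty((\Omega_e)_T),$$ where $u$ is the unique solution with exterior data $\varphi$ and initial data $(u_0,u_1)$. The equality $\Lambda_1(0)|_{(W_2)_T}=\Lambda_2(0)|_{(W_2)_T}$ means $\langle\Lambda_1 0,\psi\rangle=\langle\Lambda_2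 0,\psi\rangle$ for all $\psi\in C_c^\infty((W_2)_T)$. *)

(* Defs.v *)
From HB Require Import structures.
From mathcomp Require Import all_boot all_order all_algebra complex.
From mathcomp Require Import all_classical all_reals all_analysis.

Set Implicit Arguments.
Unset Strict Implicit.
Unset Printing Implicit Defensive.

Import Order.TTheory GRing.Theory Num.Theory.
Import numFieldNormedType.Exports.

Local Open Scope classical_set_scope.
Local Open Scope ring_scope.



Definition rV_display : measure_display -> measure_display.
Proof. exact. Qed.

(* 'rV[R]_n carries the sigma-algebra generated by the coordinate functions,
   i.e. its Borel sigma-algebra. *)
Section measurable_rV.
Context {R : realType} (n : nat).

Let coors (i : 'I_n) (x : 'rV[R]_n) : measurableTypeR R := x ord0 i.

Let rV_set0 : g_sigma_preimage coors set0.
Proof. exact: sigma_algebra0. Qed.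

Let rV_setC A : g_sigma_preimage coors A -> g_sigma_preimage coors (~` A).
Proof. exact: sigma_algebraC. Qed.

Let rV_bigcup (F : _^nat) : (forall i, g_sigma_preimage coors (F i)) ->
  g_sigma_preimage coors (\bigcup_i (F i)).
Proof. exact: sigma_algebra_bigcup. Qed.

HB.instance Definition _ := @isMeasurable.Build (rV_display default_measure_display)
  'rV[R]_n (g_sigma_preimage coors) rV_set0 rV_setC rV_bigcup.

End measurable_rV.

Section lebesgue_rV.
Context {R : realType}.

Definition consrV n (p : R * 'rV[R]_n) : 'rV[R]_n.+1 :=
  \row_i oapp (fun j => p.2 ord0 j) p.1 (unlift ord0 i).

Lemma measurable_coord n (i : 'I_n) :
  measurable_fun [set: 'rV[R]_n] (fun x : 'rV[R]_n => x ord0 i).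
Proof.
move=> _ Y mY; rewrite setTI; apply: sub_sigma_algebra => /=.
rewrite -bigcup_seq/=; exists i => /=; first by rewrite mem_index_enum.
by exists Y => //; rewrite setTI.
Qed.

Lemma measurable_fun_rV d (T : measurableType d) n (f : T -> 'rV[R]_n) :
  (forall i, measurable_fun [set: T] (fun x => f x ord0 i)) ->
  measurable_fun [set: T] f.
Proof.
move=> mf.
suff: @measurable _ 'rV[R]_n `<=` [set A | measurable (f @^-1` A)].
  by move=> + _ A mA => /(_ A mA); rewrite setTI.
apply: smallest_sub.
  split => /=.
  - by rewrite preimage_set0.
  - by move=> A mA; rewrite setTD preimage_setC; exact: measurableC.
  - by move=> F mF; rewrite preimage_bigcup; exact: bigcup_measurable.
move=> A; rewrite -bigcup_seq => -[i _ [B mB <-]] /=.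
by rewrite setTI; have := mf i measurableT _ mB; rewrite setTI.
Qed.

Lemma measurable_consrV n : measurable_fun [set: R * 'rV[R]_n] (@consrV n).
Proof.
apply: measurable_fun_rV => i; case: (unliftP ord0 i) => [j|] ->.
- under [X in measurable_fun _ X]eq_fun do rewrite mxE liftK /=.
  exact: (measurableT_comp (measurable_coord j) measurable_snd).
- under [X in measurable_fun _ X]eq_fun do rewrite mxE unlift_none /=.
  exact: measurable_fst.
Qed.

Definition unconsrV n (x : 'rV[R]_n.+1) : R * 'rV[R]_n :=
  (x ord0 ord0, \row_j x ord0 (lift ord0 j)).

Lemma consrVK n : cancel (@consrV n) (@unconsrV n).
Proof.
move=> [a x]; rewrite /unconsrV /consrV mxE unlift_none /=; congr pair.
by apply/rowP => j; rewrite !mxE liftK.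
Qed.

Lemma measurable_unconsrV n : measurable_fun [set: 'rV[R]_n.+1] (@unconsrV n).
Proof.
apply: measurable_fun_pair => /=; first exact: measurable_coord.
apply: measurable_fun_rV => j.
under [X in measurable_fun _ X]eq_fun do rewrite mxE.
exact: measurable_coord.
Qed.

Section step.
Context n (mu : {sigma_finite_measure set 'rV[R]_n -> \bar R}).

Let prod := [the {measure set _ -> \bar R} of (@lebesgue_measure R \x mu)%E].

Let prod_sigma_finite : sigma_finite setT prod.
Proof.
have /sigma_finiteP[F [TF ndF Foo]] := sigma_finiteT (@lebesgue_measure R).
have /sigma_finiteP[G [TG ndG Goo]] := sigma_finiteT mu.
exists (fun k => F k `*` G k).
  rewrite -setXTT TF TG predeqE => -[x y]; split.
    move=> [/= [k _ Fkx] [l _ Gly]]; exists (maxn k l) => //; split.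
    - by move: x Fkx; exact/subsetPset/ndF/leq_maxl.
    - by move: y Gly; exact/subsetPset/ndG/leq_maxr.
  by move=> [k _ []/= ? ?]; split; exists k.
move=> k; have [? ?] := Foo k; have [? ?] := Goo k.
split; first exact: measurableX.
by rewrite /= product_measure1E// lte_mul_pinfty// ge0_fin_numE.
Qed.

Definition lebesgue_step : set 'rV[R]_n.+1 -> \bar R :=
  pushforward prod (@consrV n).

Let step0 : lebesgue_step set0 = 0%E.
Proof. by rewrite /lebesgue_step /pushforward preimage_set0 measure0. Qed.

Let step_ge0 A : (0 <= lebesgue_step A)%E.
Proof. exact: (measure_ge0 prod). Qed.

Let step_sigma_additive : semi_sigma_additive lebesgue_step.
Proof.
have mp A : measurable A -> measurable (@consrV n @^-1` A).
  by move=> mA; rewrite -[X in measurable X]setTI; exact: measurable_consrV.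
move=> F mF tF mUF; rewrite /lebesgue_step /pushforward preimage_bigcup.
apply: measure_semi_sigma_additive.
- by move=> k; exact: mp.
- apply/trivIsetP => /= i j _ _ ij; rewrite -preimage_setI.
  by move/trivIsetP : tF => /(_ _ _ _ _ ij) ->//; rewrite preimage_set0.
- by rewrite -preimage_bigcup; exact: mp.
Qed.

HB.instance Definition _ := isMeasure.Build _ _ _ lebesgue_step
  step0 step_ge0 step_sigma_additive.

Let step_sigma_finite : sigma_finite setT lebesgue_step.
Proof.
have [F FT Foo] := prod_sigma_finite.
exists (fun k => @unconsrV n @^-1` F k).
  by rewrite -preimage_bigcup -FT preimage_setT.
move=> k; have [mF Fk] := Foo k; split.
  by rewrite -[X in measurable X]setTI; exact: measurable_unconsrV.
rewrite /lebesgue_step /pushforward -comp_preimage.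
by rewrite (_ : _ \o _ = id) ?preimage_id//; apply/funext => p; exact: consrVK.
Qed.

HB.instance Definition _ := Measure_isSigmaFinite.Build _ _ _ lebesgue_step
  step_sigma_finite.

End step.

(* Under (x_0, (x_1, ..., x_n)) |-> (x_0, x_1, ..., x_n), the measure on
   R^(n+1) is the product of the measures on R and on R^n. *)
Fixpoint lebesgue_rV n : {sigma_finite_measure set 'rV[R]_n -> \bar R} :=
  match n with
  | 0 => \d_(0 : 'rV[R]_0)
  | m.+1 => lebesgue_step (lebesgue_rV m)
  end.

End lebesgue_rV.

Local Open Scope complex_scope.

Section euclidean.
Context {R : realType} {n : nat}.
Implicit Types (x y e : 'rV[R]_n) (Om : set 'rV[R]_n).

(* The Euclidean structure; the library norm of 'rV[R]_n is the sup norm. *)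
Definition dotv x y : R := \sum_i x ord0 i * y ord0 i.
Definition enorm x : R := Num.sqrt (dotv x x).

(* The graph of gamma is taken over the hyperplane orthogonal to e. *)
Definition lipschitz_boundary Om :=
  forall x0, (closure Om `\` interior Om) x0 ->
  exists (e : 'rV[R]_n) (gamma : 'rV[R]_n -> R) (rho L : R),
  [/\ enorm e = 1, 0 < rho,
      forall y z, dotv y e = 0 -> dotv z e = 0 ->
        `|gamma y - gamma z| <= L * enorm (y - z) &
      forall x, enorm (x - x0) < rho ->
        (Om x <-> gamma (x - dotv x e *: e) < dotv x e)].

Definition bounded_lipschitz_domain Om :=
  [/\ Om !=set0, open Om, connected Om, bounded_set Om & lipschitz_boundary Om].

Definition exterior Om : set 'rV[R]_n := ~` closure Om.

End euclidean.

Section test_functions.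
Context {R : realType} {V : normedModType R}.

Definition iter_derive (vs : seq V) (f : V -> R) : V -> R :=
  foldr (fun v g x => 'D_v g x) f vs.

Definition smooth (f : V -> R) := forall vs : seq V,
  continuous (iter_derive vs f) /\
  forall x v, derivable (iter_derive vs f) x v.

Definition supp (f : V -> R) : set V := closure [set x | f x != 0].

Definition Cc_infty (U : set V) (f : V -> R) :=
  [/\ smooth f, compact (supp f) & supp f `<=` U].

End test_functions.

Section function_spaces.
Context {R : realType} {n : nat}.
Local Notation Rn := 'rV[R]_n.
Local Notation mu := (@lebesgue_rV R n).
Implicit Types (D Om : set Rn) (u v w : Rn -> R) (s : R).

(* Measurability with respect to the completed sigma-algebra. *)
Definition lmeasurable D u := exists2 g : Rn -> R,
  measurable_fun D g & {ae mu, forall x, D x -> u x = g x}.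

Definition Lp (p : \bar R) D u :=
  lmeasurable D u /\ ('N[mu]_p [EFin \o (u \_ D)] < +oo)%E.

Definition inner D u v : R := \int[mu]_(x in D) (u x * v x).

Definition L2norm u : \bar R := 'N[mu]_2%:E [EFin \o u].

(* \int_{|x| <= k} u(x) e^{- i x . xi} dx *)
Definition fourier_trunc (k : nat) u (xi : Rn) : R[i] :=
  (\int[mu]_(x in [set x | enorm x <= k%:R]) (u x * cos (dotv x xi))) -i*
  (\int[mu]_(x in [set x | enorm x <= k%:R]) (u x * sin (dotv x xi))).

Definition modulus (z : R[i]) : R :=
  Num.sqrt (complex.Re z ^+ 2 + complex.Im z ^+ 2).

(* U is the Plancherel limit in L^2 of the truncated Fourier integrals of u. *)
Definition is_fourier u (U : Rn -> R[i]) :=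
  [/\ Lp 2%:E setT (fun xi => complex.Re (U xi)),
      Lp 2%:E setT (fun xi => complex.Im (U xi)) &
      L2norm (fun xi => modulus (fourier_trunc k u xi - U xi))
        @[k --> \oo] --> 0%E].

Definition fourier u : Rn -> R[i] := xget (fun=> 0) [set U | is_fourier u U].

Definition Hs_norm s u : \bar R :=
  L2norm (fun xi => (1 + enorm xi ^+ 2) `^ (s / 2) * modulus (fourier u xi)).

Definition Hs s u := Lp 2%:E setT u /\ (Hs_norm s u < +oo)%E.

Definition Hs_tilde s Om u := Hs s u /\
  forall eps : R, 0 < eps -> exists2 phi, Cc_infty Om phi &
    (Hs_norm s (u \- phi)%R < eps%:E)%E.

Definition is_frac_laplacian s u w := Lp 2%:E setT w /\
  {ae mu, forall xi, fourier w xi = (enorm xi `^ (2 * s))%:C * fourier u xi}.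

(* (-Delta)^s u, for u in H^{2s}(R^n) *)
Definition frac_laplacian s u : Rn -> R :=
  xget (fun=> 0) [set w | is_frac_laplacian s u w].

End function_spaces.

Section nonlinearity.
Context {R : realType} {n : nat}.
Local Notation Rn := 'rV[R]_n.
Local Notation mu := (@lebesgue_rV R n).
Implicit Types (Om : set Rn) (f : Rn -> R -> R).

Definition caratheodory Om f :=
  {ae mu, forall x, Om x -> continuous (f x)} /\
  forall tau, lmeasurable Om (f ^~ tau).

(* The oriented integral of f x over [0, tau]. *)
Definition primitive f (x : Rn) (tau : R) : R :=
  if 0 <= tau then \int[lebesgue_measure]_(rho in `[0, tau]) f x rho
  else - \int[lebesgue_measure]_(rho in `[tau, 0]) f x rho.

Definition admissible_p (s : R) (p : \bar R) :=
  [/\ 2 * s < n%:R -> ((n%:R / s)%:E <= p)%E,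
      2 * s = n%:R -> (2%:E < p)%E &
      n%:R < 2 * s -> (2%:E <= p)%E].

Definition admissible_r (s r : R) :=
  0 <= r /\ (2 * s < n%:R -> r <= 2 * s / (n%:R - 2 * s)).

Definition admissible (s : R) Om f :=
  [/\ caratheodory Om f,
      forall x, Om x -> forall tau, derivable (f x) tau 1,
      caratheodory Om (fun x => derive1 (f x)),
      exists (p : \bar R) (r C : R) (a : Rn -> R),
        [/\ admissible_p s p, admissible_r s r, Lp p Om a, 0 < C &
            {ae mu, forall x, Om x -> forall tau : R,
              `|derive1 (f x) tau| <= C * (a x + `|tau| `^ r)}] &
      Lp 2%:E Om (f ^~ 0)] /\
  exists2 C1 : R, 0 < C1 &
    forall x, Om x -> forall tau, - C1 <= primitive f x tau.

End nonlinearity.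

Section wave_equation.
Context {R : realType} {n : nat}.
Local Notation Rn := 'rV[R]_n.
Local Notation mu := (@lebesgue_rV R n).
Implicit Types (Om : set Rn) (f : Rn -> R -> R) (u w phi psi : Rn * R -> R).

Definition slice u (t : R) : Rn -> R := fun x => u (x, t).

Definition cylinder (A : set Rn) (T : R) : set (Rn * R) := A `*` `]0, T[.

(* u in C([0, T]; X), where X has carrier E and norm N. *)
Definition continuous_in_time (T : R) (E : set (Rn -> R))
    (N : (Rn -> R) -> \bar R) u :=
  forall t, t \in `[0, T] -> E (slice u t) /\
    N (slice u tau \- slice u t) @[tau --> within `[0, T] (nbhs t)] --> 0%E.

(* g' = h in the sense of distributions on (0, T). *)
Definition distr_deriv (T : R) (g h : R -> R) :=
  forall eta : R -> R, @Cc_infty R R^o (`]0, T[) eta ->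
    \int[lebesgue_measure]_(t in `]0, T[) (g t * derive1 eta t) =
    - \int[lebesgue_measure]_(t in `]0, T[) (h t * eta t).

(* w is the time derivative of u, as L^2(R^n)-valued distributions. *)
Definition is_time_derivative (T : R) u w :=
  forall v : Rn -> R, Lp 2%:E setT v ->
    distr_deriv T (fun t => inner setT (slice u t) v)
                  (fun t => inner setT (slice w t) v).

Definition is_solution (s : R) Om (T : R) f (u0 u1 : Rn -> R) phi u :=
  exists w, [/\
    continuous_in_time T (Hs s) (Hs_norm s) u,
    continuous_in_time T (Lp 2%:E setT) L2norm w,
    is_time_derivative T u w,
    {ae (mu \x lebesgue_measure)%E, forall z,
      cylinder (exterior Om) T z -> u z = phi z} &
    [/\ {ae mu, forall x, Om x -> u (x, 0) = u0 x},
      {ae mu, forall x, Om x -> w (x, 0) = u1 x} &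
      forall v, Hs_tilde s Om v ->
        distr_deriv T (fun t => inner Om (slice w t) v)
          (fun t => - (inner setT (frac_laplacian (s / 2) (slice u t))
                                  (frac_laplacian (s / 2) v)
                       + inner Om (fun x => f x (u (x, t))) v))]].

Definition DN_pairing (s T : R) u psi : R :=
  \int[lebesgue_measure]_(t in `]0, T[)
    inner setT (frac_laplacian (s / 2) (slice u t))
               (frac_laplacian (s / 2) (slice psi t)).

(* Lambda phi psi stands for < Lambda phi, psi >. *)
Definition is_DN_map (s : R) Om (T : R) f (u0 u1 : Rn -> R)
    (Lambda : (Rn * R -> R) -> (Rn * R -> R) -> R) :=
  forall phi, Cc_infty (cylinder (exterior Om) T) phi ->
  exists2 u, is_solution s Om T f u0 u1 phi u &
    forall psi, Cc_infty (cylinder (exterior Om) T) psi ->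
      Lambda phi psi = DN_pairing s T u psi.

End wave_equation.

(* Main.v *)
(** Only the pairings of [(-Delta)^(s/2) u_j(t)] with [(-Delta)^(s/2) chi], [chi] supported
in [W2], enter the two maps at exterior data 0. Testing with products [chi(x) eta(t)] shows
that they agree at every time of [(0, T)]. At almost every such time [w = u_1(t) - u_2(t)]
vanishes outside [Omega], so [w = 0] by unique continuation for [(-Delta)^s]. Letting
[t -> 0] gives [u_{0,1} = u_{0,2}]; testing [d_t u_1] and [d_t u_2] against the same function
and letting [t -> 0] gives [u_{1,1} = u_{1,2}].

Unique continuation. Let [w] have bounded support and [chi] be a test function supported away
from it. Replacing [chi] by [(-Delta)^k chi], the integral of [|xi|^(2s+2k) w^ chi^] vanishes
for all [k], while that of [|xi|^(2j) w^ chi^] vanishes because the supports are disjoint.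
Hence the Mellin transform of the heat pairing [<e^(t Delta) w, chi>] at the exponent
[-(s+k)] is zero, which says that the double integral of [w(x) chi(y) |x-y|^(-n-2s-2k)]
vanishes for all [k]. Summing an exponential series and taking a Mellin transform once more
turns these negative powers into the positive ones [|x-y|^(2j)]. So the polynomials
[y |-> int w(x) |x-y|^(2j) dx] vanish on an open set, therefore everywhere; the exponential
series yields [e^(t Delta) w = 0], and [w = 0].

As all functions are real, the Fourier transform is replaced by the Hartley transform
[int f(x) (cos(x.xi) + sin(x.xi)) dx], whose even and odd parts are the real part and the
opposite of the imaginary part of the Fourier transform. *)

Require Import Defs.
From HB Require Import structures.
From mathcomp Require Import all_boot all_order all_algebra complex.
From mathcomp Require Import all_classical all_reals all_analysis.
From mathcomp Require Import measurable_realfun ring lra.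
Set Implicit Arguments.
Unset Strict Implicit.
Unset Printing Implicit Defensive.
Set SsrOldRewriteGoalsOrder.
Import Order.TTheory GRing.Theory Num.Theory.
Import numFieldNormedType.Exports.
Local Open Scope classical_set_scope.
Local Open Scope ring_scope.

(** * Integrable and square integrable functions *)

(** Everything turns on one scalar function of [t], the heat pairing, which has a form in frequency
    and a form in space. In frequency, [e^(-t |xi|^2)] does not decay at [t = 0], whereas the weight
    [t^(-q-1)] with [q = s + k] is singular there. Its Taylor polynomial is therefore subtracted, at
    no cost because the moments of integer order vanish. The remainder of matching order is
    integrable against this weight when [q] lies strictly between two consecutive integers: here the
    non-integrality of [s] enters. In space, the positive distance between the supports makes the
    pairing small near [t = 0]. The constants that appear are values of the Gamma function up to
    sign and elementary factors, but only their positivity is used. The other constraint comes from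
    the definitions: [Lp] admits functions that are measurable up to a null set, and [fourier] and
    [frac_laplacian] are choices among almost everywhere equal functions. Hence each computation
    goes through a Borel representative and its Hartley transform, whose Plancherel theorem rests on
    Gaussian integrals and on the continuity of translations in L^2. *)

Notation L1 mu f := (mu.-integrable [set: _] (EFin \o f)).

Section ae_integral.
Context d (T : measurableType d) (R : realType) (mu : {measure set T -> \bar R}).
Local Open Scope ereal_scope.
Import HBNNSimple.

(** A simple function below [f], set to 0 on the exceptional null set, lies below [g] and keeps its
    integral. No measurability of [f] and [g] is assumed, so that the result applies to functions
    that are measurable only for the completed sigma-algebra. *)
Lemma ge0_ae_le_integralT (f g : T -> \bar R) :
  (forall x, 0 <= f x) -> (forall x, 0 <= g x) ->
  {ae mu, forall x, f x = g x} -> \int[mu]_x f x <= \int[mu]_x g x.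
Proof.
move=> f0 g0 [N [mN N0 subN]].
rewrite !ge0_integralTE//; apply: ge_ereal_sup => _ [h /= hf <-].
have mC : measurable (~` N) by exact: measurableC.
have -> : sintegral mu h = \int[mu]_(x in ~` N) (h x)%:E.
  rewrite -integralT_nnsfun -(setTD N) [LHS](ge0_negligible_integral mN)//.
    by apply/measurable_EFinP; exact: measurable_funP.
  by move=> x _; rewrite lee_fin.
rewrite integral_nnsfun// (mrestrict h mC); apply: ereal_sup_ubound.
exists (proj_nnsfun h mC) => // x; rewrite -(mrestrict h mC) patchE; case: ifPn => [|_]; last by rewrite g0.
rewrite inE => Nx; rewrite (le_trans (hf x))//.
by rewrite (contrapT (contra_not (subN x) Nx)).
Qed.

Lemma ge0_ae_eq_integralT (f g : T -> \bar R) :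
  (forall x, 0 <= f x) -> (forall x, 0 <= g x) ->
  {ae mu, forall x, f x = g x} -> \int[mu]_x f x = \int[mu]_x g x.
Proof.
move=> f0 g0 fg; apply/eqP; rewrite eq_le !ge0_ae_le_integralT//.
by apply: filterS fg => x ->.
Qed.

Lemma ae_eq_integralT (f g : T -> \bar R) :
  {ae mu, forall x, f x = g x} -> \int[mu]_x f x = \int[mu]_x g x.
Proof.
move=> fg; rewrite integralE [RHS]integralE; congr (_ - _);
  by apply: ge0_ae_eq_integralT => //; apply: filterS fg => x fgx;
     rewrite ?funeposE ?funenegE fgx.
Qed.

End ae_integral.

Section integrable_real.
Context d (T : measurableType d) (R : realType) (mu : {measure set T -> \bar R}).
Implicit Types f g h : T -> R.
Let mT : measurable [set: T] := measurableT.

Lemma ae_eq_RintegralT f g : {ae mu, forall x, f x = g x} ->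
  \int[mu]_x f x = \int[mu]_x g x.
Proof.
by move=> fg; congr fine; apply: ae_eq_integralT; apply: filterS fg => x ->.
Qed.

Lemma L1_measurable f : L1 mu f -> measurable_fun setT f.
Proof. by move=> /measurable_int /measurable_EFinP. Qed.

Lemma L1P f : L1 mu f <->
  measurable_fun setT f /\ (\int[mu]_x `|(f x)%:E| < +oo)%E.
Proof.
split => [/integrableP[/measurable_EFinP ? ?]|[/measurable_EFinP ? ?]];
  [by split|exact/integrableP].
Qed.

Lemma L1_le f g : measurable_fun setT f -> L1 mu g ->
  (forall x, `|f x| <= g x) -> L1 mu f.
Proof.
move=> mf ig fg; apply: le_integrable ig => //; first exact/measurable_EFinP.
by move=> x _ /=; rewrite lee_fin (le_trans (fg x))// ler_norm.
Qed.

Lemma L1_ge0 f : measurable_fun setT f -> (forall x, 0 <= f x) ->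
  (\int[mu]_x (f x)%:E < +oo)%E -> L1 mu f.
Proof.
move=> mf f0 foo; apply/L1P; split => //.
by under eq_integral do rewrite gee0_abs ?lee_fin//.
Qed.

Lemma L1D f g : L1 mu f -> L1 mu g -> L1 mu (fun x => f x + g x).
Proof. by move=> i j; exact: (@integrableD _ _ _ mu setT mT _ _ i j). Qed.

Lemma L1B f g : L1 mu f -> L1 mu g -> L1 mu (fun x => f x - g x).
Proof. by move=> i j; exact: (@integrableB _ _ _ mu setT mT _ _ i j). Qed.

Lemma L1N f : L1 mu f -> L1 mu (fun x => - f x).
Proof. by move=> i; exact: (@integrableN _ _ _ mu setT _ i). Qed.

Lemma L1Z k f : L1 mu f -> L1 mu (fun x => k * f x).
Proof. by move=> i; exact: (@integrableZl _ _ _ mu setT mT k _ i). Qed.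

Lemma L1_norm f : L1 mu f -> L1 mu (fun x => `|f x|).
Proof. exact: integrable_norm. Qed.

Lemma L1_0 : L1 mu (fun=> 0). Proof. exact: integrable0. Qed.

Lemma L1_boundedM f g k : L1 mu f -> measurable_fun setT g ->
  (forall x, `|g x| <= k) -> L1 mu (fun x => f x * g x).
Proof.
move=> if_ mg gk; apply: (@L1_le _ (fun x => k * `|f x|)).
- by apply: measurable_funM => //; exact: L1_measurable.
- by apply: L1Z; exact: L1_norm.
- by move=> x; rewrite normrM mulrC ler_wpM2r.
Qed.

Lemma L1_ae_eq f g : measurable_fun setT g -> L1 mu f ->
  {ae mu, forall x, f x = g x} -> L1 mu g.
Proof.
move=> mg /L1P[mf foo] fg; apply/L1P; split => //.
suff -> : (\int[mu]_x `|(g x)%:E| = \int[mu]_x `|(f x)%:E|)%E by [].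
by apply: ae_eq_integralT; apply: filterS fg => x ->.
Qed.

Lemma Rintegral_EFin f : L1 mu f ->
  ((\int[mu]_x f x)%R%:E = \int[mu]_x (f x)%:E)%E.
Proof. by move=> if_; rewrite /Rintegral fineK//; exact: integrable_fin_num. Qed.

Lemma RintegralTD f g : L1 mu f -> L1 mu g ->
  \int[mu]_x (f x + g x) = \int[mu]_x f x + \int[mu]_x g x.
Proof. exact: RintegralD. Qed.

Lemma RintegralTB f g : L1 mu f -> L1 mu g ->
  \int[mu]_x (f x - g x) = \int[mu]_x f x - \int[mu]_x g x.
Proof. exact: RintegralB. Qed.

Lemma RintegralTZ k f : L1 mu f -> \int[mu]_x (k * f x) = k * \int[mu]_x f x.
Proof. exact: RintegralZl. Qed.

Lemma RintegralTN f : L1 mu f -> \int[mu]_x (- f x) = - \int[mu]_x f x.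
Proof.
move=> if_; rewrite -mulN1r -RintegralTZ//.
by apply: eq_Rintegral => x _; rewrite mulN1r.
Qed.

Lemma Rintegral0 : \int[mu]_x (0 : R) = 0.
Proof. by rewrite Rintegral_cst// mul0r. Qed.

Lemma le_RintegralT f g : L1 mu f -> L1 mu g -> (forall x, f x <= g x) ->
  \int[mu]_x f x <= \int[mu]_x g x.
Proof. by move=> ? ? fg; exact: le_Rintegral. Qed.

Lemma ge0_ae0 f : L1 mu f -> (forall x, 0 <= f x) -> \int[mu]_x f x = 0 ->
  {ae mu, forall x, f x = 0}.
Proof.
move=> if_ f0 int0; have mf := L1_measurable if_.
have : (\int[mu]_x `|(EFin \o f) x| = 0)%E.
  under eq_integral do rewrite /= ger0_norm ?f0//.
  by rewrite -Rintegral_EFin// int0.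
move/((ae_eq_integral_abs mu mT ((measurable_EFinP _ _).2 mf)).1).
by apply: filterS => x /(_ Logic.I) /= [].
Qed.

Lemma Rdominated_convergence (f_ : nat -> T -> R) f g :
  (forall n, measurable_fun setT (f_ n)) -> measurable_fun setT f ->
  {ae mu, forall x, f_ n x @[n --> \oo] --> f x} -> L1 mu g ->
  (forall n x, `|f_ n x| <= g x) ->
  L1 mu f /\ \int[mu]_x f_ n x @[n --> \oo] --> \int[mu]_x f x.
Proof.
move=> mf_ mf cf ig fg.
have [|||||ifl _ +] := @dominated_convergence _ _ _ mu setT mT
  (fun n x => (f_ n x)%:E) (EFin \o f) (EFin \o g).
- by move=> n; exact/measurable_EFinP.
- exact/measurable_EFinP.
- by apply: filterS cf => x cfx _; apply: cvg_EFin => //; exact: nearW.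
- exact: ig.
- by apply: aeW => x n _; rewrite lee_fin.
move=> cI; split => //; apply/fine_cvg; rewrite Rintegral_EFin//.
Qed.

End integrable_real.

(** * Fubini's theorem for real-valued integrals *)

Section Rfubini.
Context d1 d2 (T1 : measurableType d1) (T2 : measurableType d2) (R : realType).
Variables (m1 : {sigma_finite_measure set T1 -> \bar R}).
Variables (m2 : {sigma_finite_measure set T2 -> \bar R}).
Variable f : T1 * T2 -> R.
Local Notation mm := (m1 \x m2)%E.
Hypothesis if_ : mm.-integrable setT (EFin \o f).

Lemma Rfubini1 : L1 m1 (fun x => \int[m2]_y f (x, y)) /\
  \int[m1]_x \int[m2]_y f (x, y) = \int[mm]_z f z.
Proof.
have E := integral12_prod_meas1 if_.
have iF := integrable_fubini_F if_.
(* The two sides agree where the section of [f] is integrable; elsewhere [fine] may turn an infinite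
   value into 0. *)
have ae : {ae m1, forall x, fubini_F m2 (EFin \o f) x =
    (\int[m2]_y f (x, y))%R%:E}.
  by apply: filterS (ae_integrable1 if_) => x ix; rewrite Rintegral_EFin.
have iG : L1 m1 (fun x => \int[m2]_y f (x, y)).
  apply/integrableP; split.
    by apply/measurable_EFinP; apply: measurableT_comp => //; case/integrableP: iF.
  case/integrableP : iF => _; rewrite (_ : integral _ _ _ = \int[m1]_x
      `|(\int[m2]_y f (x, y))%R%:E|)%E//.
  by apply: ae_eq_integralT; apply: filterS ae => x ->.
split => //; rewrite /Rintegral -E; congr fine.
by apply/esym/ae_eq_integralT; exact: ae.
Qed.

Lemma Rfubini2 : L1 m2 (fun y => \int[m1]_x f (x, y)) /\
  \int[m2]_y \int[m1]_x f (x, y) = \int[mm]_z f z.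
Proof.
have E := integral21_prod_meas1 if_.
have iF : m2.-integrable setT (fubini_G m1 (EFin \o f)).
  have mf := measurable_int _ if_.
  apply/integrableP; split; first exact: measurable_fubini_G if_.
  have foo := (integrable21ltyP m1 m2 mf).1 if_.
  apply: (@le_lt_trans _ _ _ _ _ _ foo); apply: ge0_le_integral => //.
  - by apply: measurableT_comp => //; exact: measurable_fubini_G if_.
  - apply: (measurable_fun_fubini_tonelli_G (abse \o (EFin \o f))) => //=.
    exact: measurableT_comp.
  - move=> y _; apply: le_abse_integral => //.
    exact: measurable_fun_pair1.
have ae : {ae m2, forall x, fubini_G m1 (EFin \o f) x =
    (\int[m1]_y f (y, x))%R%:E}.
  by apply: filterS (ae_integrable2 if_) => x ix; rewrite Rintegral_EFin.
have iG : L1 m2 (fun x => \int[m1]_y f (y, x)).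
  apply/integrableP; split.
    by apply/measurable_EFinP; apply: measurableT_comp => //; case/integrableP: iF.
  case/integrableP : iF => _; rewrite (_ : integral _ _ _ = \int[m2]_x
      `|(\int[m1]_y f (y, x))%R%:E|)%E//.
  by apply: ae_eq_integralT; apply: filterS ae => x ->.
split => //; rewrite /Rintegral -E; congr fine.
by apply/esym/ae_eq_integralT; exact: ae.
Qed.

Lemma Rfubini : \int[m1]_x \int[m2]_y f (x, y) = \int[m2]_y \int[m1]_x f (x, y).
Proof. by rewrite Rfubini1.2 Rfubini2.2. Qed.

End Rfubini.

Section L1_prod.
Context d1 d2 (T1 : measurableType d1) (T2 : measurableType d2) (R : realType).
Variables (m1 : {sigma_finite_measure set T1 -> \bar R}).
Variables (m2 : {sigma_finite_measure set T2 -> \bar R}).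
Local Notation mm := (m1 \x m2)%E.

Lemma L1_prod (f : T1 -> R) (g : T2 -> R) : L1 m1 f -> L1 m2 g ->
  L1 mm (fun z => f z.1 * g z.2).
Proof.
move=> if_ ig; have mf := L1_measurable if_; have mg := L1_measurable ig.
apply/integrable12ltyP.
  apply/measurable_EFinP; apply: measurable_funM.
    by apply: (measurableT_comp mf); exact: measurable_fst.
  by apply: (measurableT_comp mg); exact: measurable_snd.
under eq_integral => x _.
  under eq_integral do rewrite /= normrM EFinM.
  rewrite ge0_integralZl//=; last first.
    by apply/measurable_EFinP; exact: measurableT_comp.
  over.
have /L1P[_ goo] := ig; have /L1P[_ foo] := if_.
rewrite ge0_integralZr//=.
- by rewrite lte_mul_pinfty// ?integral_ge0// ge0_fin_numE// integral_ge0.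
- by apply/measurable_EFinP; exact: measurableT_comp.
- exact: integral_ge0.
Qed.

End L1_prod.

Lemma ge_cvgn (R : realType) (u : nat -> R) l a :
  u n @[n --> \oo] --> l -> (forall n, a <= u n) -> a <= l.
Proof.
move=> ul au; rewrite -(cvg_lim _ ul)//; apply: limr_ge; last exact: nearW.
by apply/cvg_ex; exists l.
Qed.

(** * The Hilbert space L^2 *)

Section L2.
Context d (T : measurableType d) (R : realType) (mu : {measure set T -> \bar R}).
Implicit Types f g h : T -> R.

(** Real-valued counterpart of [Lp 2%:E setT], with measurability required of the function itself
    and not only of one almost everywhere equal to it. *)
Definition L2 f := measurable_fun setT f /\ L1 mu (fun x => f x ^+ 2).

Definition ip f g : R := \int[mu]_x (f x * g x).

Definition sqn f : R := \int[mu]_x (f x ^+ 2).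

Lemma L2_measurable f : L2 f -> measurable_fun setT f. Proof. by case. Qed.

Lemma L2_L1M f g : L2 f -> L2 g -> L1 mu (fun x => f x * g x).
Proof.
move=> [mf if_] [mg ig]; apply: (@L1_le _ _ _ _ _ (fun x => f x ^+ 2 + g x ^+ 2)).
- exact: measurable_funM.
- exact: L1D.
- move=> x; rewrite ler_norml; apply/andP; split; nra.
Qed.

Lemma L2D f g : L2 f -> L2 g -> L2 (fun x => f x + g x).
Proof.
move=> Lf Lg; split; first by apply: measurable_funD; exact: L2_measurable.
apply: (@L1_le _ _ _ _ _ (fun x => 2 * f x ^+ 2 + 2 * g x ^+ 2)).
- by apply: measurable_funX; apply: measurable_funD; exact: L2_measurable.
- by apply: L1D; apply: L1Z; [case: Lf|case: Lg].
- by move=> x; rewrite ger0_norm ?sqr_ge0//; have := sqr_ge0 (f x - g x); nra.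
Qed.

Lemma L2Z k f : L2 f -> L2 (fun x => k * f x).
Proof.
move=> [mf if_]; split; first exact: measurable_funM.
under [X in L1 mu X]eq_fun do rewrite exprMn.
exact: L1Z.
Qed.

Lemma L2N f : L2 f -> L2 (fun x => - f x).
Proof.
by move=> /(L2Z (-1)); under [X in L2 X]eq_fun do rewrite mulN1r.
Qed.

Lemma L2B f g : L2 f -> L2 g -> L2 (fun x => f x - g x).
Proof. by move=> ? /L2N; exact: L2D. Qed.

Lemma L2_0 : L2 (fun=> 0).
Proof. by split=> //; under [X in L1 mu X]eq_fun do rewrite expr0n/=; exact: L1_0. Qed.

Lemma L2_le f g : measurable_fun setT f -> L2 g ->
  (forall x, `|f x| <= `|g x|) -> L2 f.
Proof.
move=> mf [mg ig] fg; split => //.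
apply: (L1_le _ ig); first exact: measurable_funX.
move=> x; rewrite normrX -[leRHS]ger0_norm ?sqr_ge0// [leRHS]normrX.
by rewrite ler_sqr ?nnegrE.
Qed.

Lemma L2_ae_eq f g : measurable_fun setT g -> L2 f ->
  {ae mu, forall x, f x = g x} -> L2 g.
Proof.
move=> mg [mf if_] fg; split => //; apply: (L1_ae_eq _ if_).
  exact: measurable_funX.
by apply: filterS fg => x ->.
Qed.

Lemma sqn_ge0 f : 0 <= sqn f.
Proof. by apply: Rintegral_ge0 => x _; exact: sqr_ge0. Qed.

Lemma sqnE f : sqn f = ip f f.
Proof. by []. Qed.

Lemma ipC f g : ip f g = ip g f.
Proof. by apply: eq_Rintegral => x _; rewrite mulrC. Qed.

Lemma ipDl f g h : L2 f -> L2 g -> L2 h ->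
  ip (fun x => f x + g x) h = ip f h + ip g h.
Proof.
move=> Lf Lg Lh; rewrite /ip -RintegralTD; [|exact: L2_L1M..].
by apply: eq_Rintegral => x _; rewrite mulrDl.
Qed.

Lemma ipZl k f g : L2 f -> L2 g -> ip (fun x => k * f x) g = k * ip f g.
Proof.
move=> Lf Lg; rewrite /ip -RintegralTZ; last exact: L2_L1M.
by apply: eq_Rintegral => x _; rewrite mulrA.
Qed.

Lemma ipNl f g : L2 f -> L2 g -> ip (fun x => - f x) g = - ip f g.
Proof.
move=> Lf Lg; rewrite -mulN1r -ipZl//.
by apply: eq_Rintegral => x _; rewrite mulN1r.
Qed.

Lemma ipBl f g h : L2 f -> L2 g -> L2 h ->
  ip (fun x => f x - g x) h = ip f h - ip g h.
Proof. by move=> Lf Lg Lh; rewrite ipDl ?ipNl//; exact: L2N. Qed.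

Lemma sqnZ k f : L2 f -> sqn (fun x => k * f x) = k ^+ 2 * sqn f.
Proof.
move=> [mf if_]; rewrite /sqn -RintegralTZ//.
by apply: eq_Rintegral => x _; rewrite exprMn.
Qed.

Lemma sqnN f : sqn (fun x => - f x) = sqn f.
Proof. by apply: eq_Rintegral => x _; rewrite sqrrN. Qed.

Lemma sqnD f g : L2 f -> L2 g ->
  sqn (fun x => f x + g x) = sqn f + 2 * ip f g + sqn g.
Proof.
move=> Lf Lg; rewrite !sqnE.
have LD := L2D Lf Lg.
by rewrite ipDl// ![ip _ (fun x => f x + g x)]ipC !ipDl// [ip g f]ipC; lra.
Qed.

Lemma sqnB f g : L2 f -> L2 g ->
  sqn (fun x => f x - g x) = sqn f - 2 * ip f g + sqn g.
Proof.
move=> Lf Lg; rewrite sqnD//; last exact: L2N.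
by rewrite [ip f _]ipC ipNl// sqnN [ip g f]ipC; lra.
Qed.

Lemma sqnBC f g : sqn (fun x => f x - g x) = sqn (fun x => g x - f x).
Proof. by apply: eq_Rintegral => x _; rewrite -sqrrN opprB. Qed.

Lemma sqn_leD f g : L2 f -> L2 g ->
  sqn (fun x => f x + g x) <= 2 * sqn f + 2 * sqn g.
Proof.
move=> Lf Lg; have := sqn_ge0 (fun x => f x - g x).
by rewrite sqnB// sqnD//; lra.
Qed.

Lemma sqn_tri f g h : L2 f -> L2 g -> L2 h ->
  sqn (fun x => f x - h x) <=
  2 * sqn (fun x => f x - g x) + 2 * sqn (fun x => g x - h x).
Proof.
move=> Lf Lg Lh; apply: le_trans (sqn_leD (L2B Lf Lg) (L2B Lg Lh)).
by rewrite le_eqVlt; apply/orP; left; apply/eqP/eq_Rintegral => x _; rewrite addrA subrK.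
Qed.

(** Cauchy-Schwarz, from the nonnegativity of [|f + t g|^2] for all real [t]. For [|g| = 0] this is
    affine in [t] and would take the value -1 unless [ip f g = 0]; otherwise [t] is the
    minimiser. *)
Lemma ip_sqr_le f g : L2 f -> L2 g -> ip f g ^+ 2 <= sqn f * sqn g.
Proof.
move=> Lf Lg.
have H t : 0 <= sqn f + 2 * t * ip f g + t ^+ 2 * sqn g.
  have := sqn_ge0 (fun x => f x + t * g x).
  by rewrite sqnD ?sqnZ//; [rewrite [ip f _]ipC ipZl// [ip g f]ipC mulrA|exact: L2Z].
have := sqn_ge0 f; have := sqn_ge0 g.
rewrite le_eqVlt => /orP[/eqP g0|g0] f0.
  have /eqP : ip f g = 0.
    apply/eqP; apply/negPn/negP => fg0.
    have := H (- (sqn f + 1) / (2 * ip f g)).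
    have -> : 2 * (- (sqn f + 1) / (2 * ip f g)) * ip f g = - (sqn f + 1) by field.
    by rewrite -g0; lra.
  by move/eqP ->; rewrite -g0 expr0n mulr0.
have := H (- ip f g / sqn g).
have -> : sqn f + 2 * (- ip f g / sqn g) * ip f g + (- ip f g / sqn g) ^+ 2 * sqn g
  = (sqn f * sqn g - ip f g ^+ 2) / sqn g by field; rewrite gt_eqF.
by rewrite pmulr_lge0 ?invr_gt0// subr_ge0.
Qed.

Lemma sqn_ae f g : {ae mu, forall x, f x = g x} -> sqn f = sqn g.
Proof. by move=> fg; apply: ae_eq_RintegralT; apply: filterS fg => x ->. Qed.

Lemma sqn_eq0 f : L2 f -> sqn f = 0 -> {ae mu, forall x, f x = 0}.
Proof.
move=> [mf if_] /(ge0_ae0 if_ (fun x => sqr_ge0 (f x))).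
by apply: filterS => x /eqP; rewrite sqrf_eq0 => /eqP.
Qed.

Lemma sqnB_eq0 f g : L2 f -> L2 g -> sqn (fun x => f x - g x) = 0 ->
  {ae mu, forall x, f x = g x}.
Proof.
move=> Lf Lg /(sqn_eq0 (L2B Lf Lg)).
by apply: filterS => x /eqP; rewrite subr_eq0 => /eqP.
Qed.

Definition cvgL2 (f_ : nat -> T -> R) f :=
  sqn (fun x => f_ n x - f x) @[n --> \oo] --> (0 : R).

Lemma cvgL2_unique (f_ : nat -> T -> R) f g : (forall n, L2 (f_ n)) -> L2 f -> L2 g ->
  cvgL2 f_ f -> cvgL2 f_ g -> {ae mu, forall x, f x = g x}.
Proof.
move=> Lf_ Lf Lg cf cg; apply: sqnB_eq0 => //; apply/eqP.
rewrite eq_le sqn_ge0 andbT.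
have : 2 * sqn (fun x => f_ n x - f x) + 2 * sqn (fun x => f_ n x - g x) @[n --> \oo]
    --> (2 * 0 + 2 * 0 : R).
  by apply: cvgD; apply: cvgM => //; exact: cvg_cst.
rewrite mulr0 addr0 => c0; apply: (ge_cvgn c0) => n.
by rewrite [X in 2 * X + _]sqnBC; exact: sqn_tri.
Qed.

Lemma cvgL2_ip (f_ : nat -> T -> R) f g : (forall n, L2 (f_ n)) -> L2 f -> L2 g ->
  cvgL2 f_ f -> ip (f_ n) g @[n --> \oo] --> ip f g.
Proof.
move=> Lf_ Lf Lg cf; apply/cvgrPdist_le => e e0.
have e1 : 0 < e ^+ 2 / (sqn g + 1).
  by rewrite divr_gt0 ?exprn_gt0//; have := sqn_ge0 g; lra.
move/cvgrPdist_lt : cf => /(_ _ e1); apply: filterS => n.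
rewrite sub0r normrN ger0_norm ?sqn_ge0// => fn.
rewrite -ipBl// -[leRHS]ger0_norm ?(ltW e0)// -ler_sqr ?nnegrE// !real_normK ?num_real//.
apply: (le_trans (ip_sqr_le _ _)) => //; first exact: L2B.
rewrite sqnBC; have g1 : 0 < sqn g + 1 by have := sqn_ge0 g; lra.
move: fn; rewrite ltr_pdivlMr// => fn; have := sqn_ge0 g.
have := sqn_ge0 (fun x => f_ n x - f x); nra.
Qed.

(** From [|f_n|^2 = |f_n - f|^2 + 2 <f_n, f> - |f|^2] and the weak convergence [cvgL2_ip]. *)
Lemma cvgL2_sqn (f_ : nat -> T -> R) f : (forall n, L2 (f_ n)) -> L2 f ->
  cvgL2 f_ f -> sqn (f_ n) @[n --> \oo] --> sqn f.
Proof.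
move=> Lf_ Lf cf.
have : sqn (fun x => f_ n x - f x) + 2 * ip (f_ n) f - sqn f @[n --> \oo] -->
    0 + 2 * ip f f - sqn f.
  apply: cvgB; last exact: cvg_cst; apply: cvgD => //.
  by apply: cvgM; [exact: cvg_cst|exact: cvgL2_ip].
rewrite add0r -sqnE mulr_natl mulr2n addrK.
have E n : sqn (fun x => f_ n x - f x) + (1 + 1) * ip (f_ n) f - sqn f =
    sqn (f_ n) by rewrite sqnB//; lra.
by under eq_fun do rewrite E.
Qed.

End L2.

Section L2_complete.
Context d (T : measurableType d) (R : realType) (mu : {measure set T -> \bar R}).

Lemma L1_fatou (g_ : nat -> T -> R) (g : T -> R) e K :
  (forall n, measurable_fun setT (g_ n)) -> measurable_fun setT g ->
  (forall n x, 0 <= g_ n x) -> (forall x, g_ n x @[n --> \oo] --> g x) ->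
  (forall n, (K <= n)%N -> (\int[mu]_x (g_ n x)%:E <= e%:E)%E) ->
  L1 mu g /\ \int[mu]_x g x <= e.
Proof.
move=> mg_ mg g_0 cg ge.
have g0 x : 0 <= g x by apply: (ge_cvgn (cg x)) => n.
(* The bound holds only from index [K] on, so Fatou's lemma is applied to the shifted sequence. *)
have := @fatou _ _ _ mu setT measurableT (fun n x => (g_ (n + K)%N x)%:E).
have -> : (\int[mu]_x limn_einf (fun n => (g_ (n + K)%N x)%:E) = \int[mu]_x (g x)%:E)%E.
  apply: eq_integral => x _.
  have c : (g_ (n + K)%N x)%:E @[n --> \oo] --> (g x)%:E.
    by apply: cvg_EFin; [exact: nearW|rewrite (cvg_shiftn K (g_ ^~ x))].
  by rewrite (cvg_limn_einf_sup c).
move=> H; have {}H : (\int[mu]_x (g x)%:E <= e%:E)%E.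
  apply: le_trans (H _ _) _.
  - by move=> n; exact/measurable_EFinP.
  - by move=> n x _; rewrite lee_fin.
  rewrite limn_einf_lim; apply: lime_le; first exact: is_cvg_einfs.
  apply: nearW => n; apply: ereal_inf_le => /=.
  by eexists; [exists n => //=; reflexivity|exact/ge/leq_addl].
have ig : L1 mu g by apply: L1_ge0 => //; rewrite (le_lt_trans H)// ltry.
by split => //; rewrite -lee_fin Rintegral_EFin.
Qed.

(** As [M <= (M + 1)^2], the increments are at most [(M + 1) 2^(-n)] and form an absolutely
    convergent series. *)
Lemma cauchy_increments (u : nat -> R) M :
  (forall n, (u n.+1 - u n) ^+ 2 * 4 ^+ n <= M) -> cvgn u.
Proof.
move=> uM.
have M0 : 0 <= M by apply: le_trans (uM 0%N); rewrite mulr_ge0 ?sqr_ge0.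
have -> : u = cst (u 0%N) + series (fun n => u n.+1 - u n).
  apply/funext => n; rewrite /series /= fctE/=.
  by rewrite telescope_sumr// addrC subrK.
apply: is_cvgD; first exact: is_cvg_cst.
apply: normed_cvg; apply: (@series_le_cvg _ _ (geometric (M + 1) 2^-1)).
- by move=> n; exact: normr_ge0.
- by move=> n /=; rewrite mulr_ge0 ?exprn_ge0//; lra.
- move=> n /=; rewrite -[leRHS]ger0_norm; last by rewrite mulr_ge0 ?exprn_ge0//; lra.
  rewrite -ler_sqr ?nnegrE// !real_normK ?num_real//.
  rewrite exprMn exprAC [(2^-1) ^+ 2]expr2 -invfM -natrM exprVn.
  rewrite ler_pdivlMr ?exprn_gt0//; apply: le_trans (uM n) _; nra.
- by apply: is_cvg_geometric_series; rewrite ger0_norm; lra.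
Qed.

Lemma sum_half n : \sum_(k < n) (2^-1 : R) ^+ k <= 2.
Proof.
suff -> : \sum_(k < n) (2^-1 : R) ^+ k = 2 - 2 * 2^-1 ^+ n.
  by have : 0 <= (2^-1 : R) ^+ n; [exact: exprn_ge0|lra].
elim: n => [|n IH]; first by rewrite big_ord0 expr0; lra.
by rewrite big_ord_recr /= IH exprS; lra.
Qed.

(** Riesz-Fischer. Along a subsequence the increments [D j] satisfy [|D j|^2 <= 8^(-j)], so [G], the
    sum of the [4^j (D j)^2], has integral at most 2 and is finite almost everywhere; where it is
    finite, [cauchy_increments] yields pointwise convergence. *)
Lemma L2_complete (f_ : nat -> T -> R) : (forall n, L2 mu (f_ n)) ->
  (forall e : R, 0 < e -> exists K, forall k l, (K <= k)%N -> (K <= l)%N ->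
    sqn mu (fun x => f_ k x - f_ l x) <= e) ->
  exists2 h, L2 mu h & cvgL2 mu f_ h.
Proof.
move=> Lf cauchy.
have /choice[K_ KP] : forall j : nat, exists K, forall k l, (K <= k)%N -> (K <= l)%N ->
    sqn mu (fun x => f_ k x - f_ l x) <= 8^-1 ^+ j.
  by move=> j; apply: cauchy; rewrite exprn_gt0.
(* This choice makes [m] nondecreasing, with [K_ j <= m j] and [j <= m j]. *)
pose m j := (\sum_(i < j.+1) (K_ i).+1)%N.
have mK j : (K_ j <= m j)%N.
  by rewrite /m big_ord_recr /= (leq_trans (leqnSn _))// leq_addl.
have mS j : (m j <= m j.+1)%N by rewrite [leqRHS]/m big_ord_recr /= leq_addr.
have mge i j : (i <= j)%N -> (K_ i <= m j)%N.
  move=> ij; apply: (leq_trans (mK i)).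
  by elim: j ij => [|j IH]; [case: i|rewrite leq_eqVlt => /predU1P[->//|/IH/leq_trans]; apply].
have mid j : (j <= m j)%N.
  elim: j => // j IH; rewrite /m big_ord_recr /=.
  by rewrite addnS ltnS (leq_trans IH)// leq_addr.
pose D j x := f_ (m j.+1) x - f_ (m j) x.
have LD j : L2 mu (D j) by exact: L2B.
pose G x := (\sum_(j <oo) (D j x ^+ 2 * 4 ^+ j)%:E)%E.
have mD j : measurable_fun setT (fun x => (D j x ^+ 2 * 4 ^+ j)%:E).
  apply/measurable_EFinP; apply: measurable_funM => //.
  by apply: measurable_funX; exact: L2_measurable.
have D0 j x : (0 <= (D j x ^+ 2 * 4 ^+ j)%:E)%E.
  by rewrite lee_fin mulr_ge0 ?sqr_ge0 ?exprn_ge0.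
have mG : measurable_fun setT G by apply: ge0_emeasurable_sum => // j x _ _.
have G0 x : (0 <= G x)%E by apply: nneseries_ge0.
have intG : (\int[mu]_x G x <= 2%:E)%E.
  rewrite /G integral_nneseries//; apply: lime_le.
    by apply: is_cvg_nneseries => n _ _; exact: integral_ge0.
  apply: nearW => n; apply: (@le_trans _ _ ((\sum_(k < n) (2^-1 : R) ^+ k)%:E)); last first.
    by rewrite lee_fin sum_half.
  rewrite -sumEFin big_mkord; apply: lee_sum => k _.
  have -> : (\int[mu]_x (D k x ^+ 2 * 4 ^+ k)%:E = (sqn mu (D k) * 4 ^+ k)%:E)%E.
    rewrite mulrC /sqn -RintegralTZ; last by case: (LD k).
    rewrite Rintegral_EFin; last by apply: L1Z; case: (LD k).
    by apply: eq_integral => x _; rewrite mulrC.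
  rewrite lee_fin; apply: (@le_trans _ _ (8^-1 ^+ k * 4 ^+ k)).
    apply: ler_wpM2r; first exact: exprn_ge0.
    by apply: KP; [apply: mge|exact: mK].
  by rewrite -exprMn (_ : 8^-1 * 4 = 2^-1)//; lra.
pose E := [set x | (G x < +oo)%E].
have mE : measurable E.
  rewrite -[E]setTI; exact: emeasurable_fun_infty_o.
(* Killing the sequence where [G] is infinite makes it converge at every point, so that the limit
   [h] is measurable. *)
pose b j x := f_ (m j) x * \1_E x.
have mb j : measurable_fun setT (b j).
  by apply: measurable_funM => //; exact: L2_measurable.
have cb x : cvgn (b ^~ x).
  rewrite /b indicE; case: (boolP (x \in E)) => xE /=; last first.
    by under eq_fun do rewrite mulr0; exact: is_cvg_cst.
  under eq_fun do rewrite mulr1.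
  move: xE; rewrite inE /E /= => Gx.
  apply: (@cauchy_increments _ (fine (G x))) => n.
  rewrite -lee_fin fineK ?ge0_fin_numE//.
  apply: le_trans (nneseries_lim_ge n.+1 _); last by move=> *; exact: D0.
  by rewrite big_mkord big_ord_recr /= leeDr// sume_ge0.
pose h x := limn (b ^~ x).
have mh : measurable_fun setT h by apply: (measurable_fun_cvg mb) => x _; exact: cb.
have aeE : {ae mu, forall x, \1_E x = 1 :> R}.
  have iG : mu.-integrable setT G.
    apply/integrableP; split => //; under eq_integral do rewrite gee0_abs//.
    by rewrite (le_lt_trans intG) ?ltry.
  apply: filterS (integrable_ae measurableT iG) => x /(_ Logic.I) Gx.
  by rewrite indicE mem_set// /E /= -ge0_fin_numE.
(* Fatou's lemma in the second index: what bounds all [f_ k - f_ l] beyond [K] also bounds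
   [f_ k - h]. It gives both [h] in L^2 and the convergence. *)
have key e K : (forall k l, (K <= k)%N -> (K <= l)%N ->
    sqn mu (fun x => f_ k x - f_ l x) <= e) -> forall k, (K <= k)%N ->
    L2 mu (fun x => f_ k x - h x) /\ sqn mu (fun x => f_ k x - h x) <= e.
  move=> Ke k Kk.
  have mk := L2_measurable (Lf k).
  have mkh : measurable_fun setT (fun x => f_ k x - h x) by exact: measurable_funB.
  have [||||j Kj|iL le] := @L1_fatou (fun j x => (f_ k x - b j x) ^+ 2)
      (fun x => (f_ k x - h x) ^+ 2) e K.
  - by move=> j; apply: measurable_funX; exact: measurable_funB.
  - exact: measurable_funX.
  - by move=> j x; exact: sqr_ge0.
  - move=> x; have c : f_ k x - b j x @[j --> \oo] --> f_ k x - h x.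
      by apply: cvgB; [exact: cvg_cst|exact: cb].
    exact: (cvgM c c).
  - have -> : (\int[mu]_x ((f_ k x - b j x) ^+ 2)%:E =
        (sqn mu (fun x => f_ k x - f_ (m j) x))%:E)%E.
      rewrite /sqn Rintegral_EFin; last by case: (L2B (Lf k) (Lf (m j))).
      apply: ae_eq_integralT; apply: filterS aeE => x xE.
      by rewrite /b xE mulr1.
    by rewrite lee_fin; apply: Ke => //; exact: leq_trans (mid j).
  - by split.
have Lh : L2 mu h.
  have [K KK] := cauchy 1 ltr01.
  have [+ _] := key 1 K KK K (leqnn K).
  move=> /(L2B (Lf K)); under [X in L2 _ X]eq_fun do rewrite subKr.
  exact.
exists h => //; apply/cvgrPdist_le => e e0.
have [K KK] := cauchy e e0; exists K => // k /= Kk.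
by rewrite sub0r normrN ger0_norm ?sqn_ge0//; exact: (key e K KK k Kk).2.
Qed.
End L2_complete.

(** * Lebesgue measure on R^n *)

Section lebesgue_affine.
Context {R : realType}.
Local Notation mu := (@lebesgue_measure R).
Local Open Scope ereal_scope.

Definition affineR (c v : R) : measurableTypeR R -> measurableTypeR R :=
  fun a => (c * a + v)%R.

Lemma measurable_affineR c v : measurable_fun setT (affineR c v).
Proof. by apply: measurable_funD => //; exact: measurable_funM. Qed.

Definition pushR c v : {measure set (measurableTypeR R) -> \bar R} :=
  measure_function_pushforward__canonical__measure_function_Measure mu
    (measurable_affineR c v).

(** The rescaled pushforward agrees with Lebesgue measure on half-open intervals, hence
    everywhere. *)
Lemma lebesgue_measure_affine_pos (c v : R) A : (0 < c)%R -> measurable A ->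
  mu A = c%:E * mu (affineR c v @^-1` A).
Proof.
move=> c0 mA.
pose cn : {nonneg R} := NngNum (ltW c0).
rewrite (@lebesgue_measure_unique _ (mscale cn (pushR c v)))// => _ [[a b] _ <-]/=.
rewrite /mscale /= /pushforward.
have -> : affineR c v @^-1` `]a, b]%classic = `]((a - v) / c)%R, ((b - v) / c)%R]%classic.
  apply/seteqP; split => x /=; rewrite /affineR !in_itv/= => /andP[h1 h2];
  by move: h1 h2; rewrite ?ltr_pdivrMr ?ler_pdivlMr// => h1 h2; apply/andP; split; lra.
rewrite !lebesgue_measure_itv/= !lte_fin ltr_pM2r ?invr_gt0// ltrBlDr subrK.
case: ifPn => ab; last by rewrite mule0.
by rewrite -!EFinD -EFinM; congr EFin; field; rewrite gt_eqF.
Qed.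

Lemma ge0_integral_affineR (c v : R) (f : R -> \bar R) : c != 0%R ->
  measurable_fun setT f -> (forall x, 0 <= f x) ->
  \int[mu]_x f x = `|c|%:E * \int[mu]_x f (c * x + v)%R.
Proof.
move=> cN0 mf f0.
have neg (g : R -> \bar R) : measurable_fun setT g -> (forall x, 0 <= g x) ->
    \int[mu]_x g x = \int[mu]_x g (- x)%R.
  move=> mg g0; rewrite -[RHS](@ge0_integral_pushforward _ _ _ _ _
    (-%R : measurableTypeR R -> measurableTypeR R) _ mu setT)//.
  by apply: eq_measure_integral => //= A mA AS; exact/esym/lebesgue_measureN.
have pos (d : R) (g : R -> \bar R) : (0 < d)%R -> measurable_fun setT g ->
    (forall x, 0 <= g x) ->
    \int[mu]_x g x = d%:E * \int[mu]_x g (d * x + v)%R.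
  move=> d0 mg g0; have maf := measurable_affineR d v.
  rewrite -[X in _ * X](@ge0_integral_pushforward _ _ _ _ _ (affineR d v) maf mu setT g)//.
  pose dn : {nonneg R} := NngNum (ltW d0).
  rewrite -[RHS](@ge0_integral_mscale _ _ _ (pushR d v) setT measurableT dn g mg (fun x _ => g0 x)).
  apply: eq_measure_integral => // A mA _.
  exact: lebesgue_measure_affine_pos.
have [c0|c0] := ltP 0%R c; first by rewrite gtr0_norm//; exact: pos.
have {cN0}c0 : (c < 0)%R by rewrite lt_neqAle cN0.
rewrite ltr0_norm// (pos (- c)%R)// ?oppr_gt0//; congr (_ * _).
rewrite neg//; last first.
  by apply: measurableT_comp => //; exact: (measurable_affineR (- c) v).
by apply: eq_integral => x _; rewrite mulrNN.
Qed.

End lebesgue_affine.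

Section rV_measurable.
Context {R : realType} (n : nat).
Local Notation Rn := 'rV[R]_n.

Lemma measurable_ball_rV (c : Rn) (r : R) : measurable (ball c r).
Proof.
have [r0|r0] := ltP 0 r; last first.
  rewrite (_ : ball c r = set0)// -subset0 => x [+ _].
  by rewrite ltNge r0.
rewrite (_ : ball c r = \bigcap_(i in [set: 'I_n]) (fun x : Rn => x ord0 i) @^-1` ball (c ord0 i) r).
  apply: fin_bigcap_measurable => // i _.
  have := @measurable_coord R n i measurableT _ (measurable_ball (c ord0 i) r).
  by rewrite setTI.
apply/seteqP; split => x.
  by move=> [_ H] i _ /=; exact: H.
by move=> H; split=> // i j; rewrite ord1; exact: H.
Qed.

(** The sigma-algebra is generated by the coordinates. Balls of the sup norm are finite
    intersections of coordinate conditions, and an open set is the countable union of the balls with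
    rational centre and radius that it contains. *)
Lemma open_measurable_rV (A : set Rn) : open A -> measurable A.
Proof.
move=> oA.
pose q (v : 'rV[rat]_n) : Rn := map_mx ratr v.
pose I := [set p : 'rV[rat]_n * rat | ball (q p.1) (ratr p.2 : R) `<=` A].
rewrite (_ : A = \bigcup_(p in I) ball (q p.1) (ratr p.2 : R)).
  rewrite bigcup_mkcond; apply: countable_bigcupT_measurable => // p.
  by case: ifP => _; [exact: measurable_ball_rV|exact: measurable0].
apply/seteqP; split => [x Ax|x [p] Ip]; last exact: Ip.
have /nbhs_ballP[e /= e0 xeA] : nbhs x A by exact: open_nbhs_nbhs.
have [d /andP[d0 de]] : exists d : rat, 0 < (ratr d : R) < e / 2.
  by have [|d] := @rat_in_itvoo R 0 (e / 2); [rewrite divr_gt0|rewrite in_itv /= => dd; exists d].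
have /choice[v vP] : forall i, exists z : rat, `|x ord0 i - ratr z| < ratr d.
  move=> i; have [|z] := @rat_in_itvoo R (x ord0 i - ratr d) (x ord0 i + ratr d).
    by lra.
  by rewrite in_itv/= => zd; exists z; rewrite distrC ltr_distl.
exists (\row_i v i, d) => /=.
  move=> y [_ H]; apply: xeA; split => // i j; rewrite ord1.
  have := H ord0 j; rewrite /ball /= !mxE => H1; have := vP j.
  have -> : x ord0 j - y ord0 j = (x ord0 j - ratr (v j)) + (ratr (v j) - y ord0 j) by lra.
  by move=> H2; rewrite (le_lt_trans (ler_normD _ _))//; lra.
split => // i j; rewrite ord1 /ball /= !mxE distrC; exact: vP.
Qed.

Lemma continuous_measurable_rV (f : Rn -> R) : continuous f -> measurable_fun setT f.
Proof.
move=> /continuousP cf; apply: (measurability _ (RGenOpens.measurableE R)).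
move=> _ [_ [a [b ->] <-]]; rewrite setTI; apply: open_measurable_rV.
exact/cf/interval_open.
Qed.

Lemma closed_measurable_rV (A : set Rn) : closed A -> measurable A.
Proof. by move/closed_openC/open_measurable_rV/measurableC; rewrite setCK. Qed.

End rV_measurable.

Section rV_integral.
Context {R : realType}.
Local Notation leb n := (@lebesgue_rV R n).
Local Open Scope ereal_scope.

Lemma ge0_integral_rV0 (f : 'rV[R]_0 -> \bar R) :
  measurable_fun setT f -> \int[leb 0]_x f x = f 0%R.
Proof. by move=> mf; rewrite /= integral_dirac// diracT mul1e. Qed.

Lemma ge0_integral_rVS n (f : 'rV[R]_n.+1 -> \bar R) :
  measurable_fun setT f -> (forall x, 0 <= f x) ->
  \int[leb n.+1]_x f x =
  \int[lebesgue_measure]_a \int[leb n]_x f (consrV (a, x)).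
Proof.
move=> mf f0; have mc := @measurable_consrV R n.
pose cR : measurableTypeR R * 'rV[R]_n -> 'rV[R]_n.+1 := @consrV R n.
rewrite -(@fubini_tonelli1 _ _ _ _ _ lebesgue_measure (leb n) (f \o cR))//=.
- rewrite -[RHS](@ge0_integral_pushforward _ _ _ _ _ cR mc
    (@lebesgue_measure R \x leb n)%E setT f measurableT mf (fun x _ => f0 x)).
  exact: eq_measure_integral.
- exact: (measurableT_comp mf mc).
Qed.

Lemma consrVD n (a b : R) (x y : 'rV[R]_n) :
  (consrV (a, x) + consrV (b, y) = consrV (a + b, x + y))%R.
Proof.
by apply/rowP => i; rewrite !mxE; case: unlift => [j|]//=; rewrite mxE.
Qed.

Lemma consrVZ n (c a : R) (x : 'rV[R]_n) :
  (c *: consrV (a, x) = consrV (c * a, c *: x))%R.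
Proof.
by apply/rowP => i; rewrite !mxE; case: unlift => [j|]//=; rewrite mxE.
Qed.

Lemma unconsrVK n : cancel (@unconsrV R n) (@consrV R n).
Proof.
move=> x; apply/rowP => i; rewrite !mxE.
by case: unliftP => [j|] -> /=; rewrite ?mxE.
Qed.

Lemma consrV0E n (p : R * 'rV[R]_n) : consrV p ord0 ord0 = p.1.
Proof. by rewrite mxE unlift_none. Qed.

Lemma consrVSE n (p : R * 'rV[R]_n) j : consrV p ord0 (lift ord0 j) = p.2 ord0 j.
Proof. by rewrite mxE liftK. Qed.

Lemma measurable_affine_rV n (c : R) (v : 'rV[R]_n) :
  measurable_fun setT (fun x : 'rV[R]_n => c *: x + v)%R.
Proof.
apply: measurable_fun_rV => i; under eq_fun do rewrite !mxE.
apply: measurable_funD => //; apply: measurable_funM => //.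
exact: measurable_coord.
Qed.

(** Induction on the dimension by Tonelli: each coordinate contributes one factor [|c|]. *)
Lemma ge0_integral_affine n (c : R) (v : 'rV[R]_n) (f : 'rV[R]_n -> \bar R) :
  c != 0%R -> measurable_fun setT f -> (forall x, 0 <= f x) ->
  \int[leb n]_x f x = (`|c| ^+ n)%:E * \int[leb n]_x f (c *: x + v)%R.
Proof.
move=> cN0; elim: n v f => [|n IH] v f mf f0.
  rewrite expr0 mul1e !ge0_integral_rV0//; last first.
    by apply: measurableT_comp => //; exact: measurable_affine_rV.
  by congr f; apply/rowP => -[].
have mfc : measurable_fun setT (fun p : R * 'rV[R]_n => f (consrV p)).
  by apply: measurableT_comp => //; exact: measurable_consrV.
rewrite !ge0_integral_rVS//; last first.
  by apply: measurableT_comp => //; exact: measurable_affine_rV.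
have mF : measurable_fun [set: measurableTypeR R]
    (fun a => \int[leb n]_x f (consrV (a, x))).
  exact: (@measurable_fun_fubini_tonelli_F _ _ (measurableTypeR R) _ _ (leb n)
    (f \o @consrV R n) mfc (fun z => f0 _)).
have F0 a : 0 <= \int[leb n]_x f (consrV (a, x)) by exact: integral_ge0.
rewrite (ge0_integral_affineR (v ord0 ord0) cN0 mF F0).
rewrite exprS EFinM -muleA; congr (_ * _)%E.
rewrite -ge0_integralZl//; last 2 first.
- pose g x := f (c *: x + v)%R.
  apply: (@measurable_fun_fubini_tonelli_F _ _ (measurableTypeR R) _ _ (leb n)
    (g \o @consrV R n)) => //; last by move=> x; exact: f0.
  apply: measurableT_comp; last exact: measurable_consrV.
  by apply: measurableT_comp => //; exact: measurable_affine_rV.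
- by move=> x _; exact: integral_ge0.
apply: eq_integral => a _.
rewrite (IH (\row_j v ord0 (lift ord0 j)))//; last first.
  exact: (@measurable_fun_pair2 _ _ _ (measurableTypeR R) 'rV[R]_n _ (f \o @consrV R n) (c * a + v ord0 ord0)%R mfc).
congr (_ * _); apply: eq_integral => x _; congr f.
by rewrite consrVZ -[in RHS](unconsrVK v) consrVD.
Qed.

(** Balls of the sup norm are cubes of side [2 r]. *)
Lemma lebesgue_rV_ball n (c : 'rV[R]_n) (r : R) : (0 < r)%R ->
  leb n (ball c r) = ((2 * r) ^+ n)%:E.
Proof.
move=> r0; elim: n c => [|n IH] c /=.
  by rewrite expr0 diracE mem_set//; split=> // i [].
rewrite /lebesgue_step /pushforward.
have -> : @consrV R n @^-1` ball c r =
    ball (c ord0 ord0) r `*` ball (\row_j c ord0 (lift ord0 j) : 'rV[R]_n) r.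
  apply/seteqP; split => -[a x].
    move=> [_ H]; split.
      by have := H ord0 ord0; rewrite consrV0E.
    split=> // i j; have -> : i = ord0 by exact: ord1.
    rewrite mxE; move: (H ord0 (lift ord0 j)).
    by rewrite consrVSE.
  move=> [/= H0 [_ H1]]; split=> // i j; rewrite ord1.
  case: (unliftP ord0 j) => [k|] ->; last by rewrite consrV0E.
  by rewrite consrVSE; have := H1 ord0 k; rewrite mxE.
transitivity ((@lebesgue_measure R \x leb n)%E (ball (c ord0 ord0) r `*`
  ball (\row_j c ord0 (lift ord0 j) : 'rV[R]_n) r)); first by [].
rewrite product_measure1E//.
- rewrite exprS EFinM; congr (_ * _)%E; last exact: IH.
  by rewrite mulr_natl; exact: lebesgue_measure_ball (ltW r0).
- exact: measurable_ball.
- exact: measurable_ball_rV.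
Qed.

End rV_integral.

Section rV_Rintegral.
Context {R : realType} (n : nat).
Local Notation Rn := 'rV[R]_n.
Local Notation leb := (@lebesgue_rV R n).

Lemma L1_affine (c : R) (v : Rn) (f : Rn -> R) : c != 0 -> L1 leb f ->
  L1 leb (fun x => f (c *: x + v)) /\
  \int[leb]_x f x = `|c| ^+ n * \int[leb]_x f (c *: x + v).
Proof.
move=> c0 if_; have [mf foo] := (L1P _ _).1 if_.
have c1 : 0 < `|c| ^+ n by rewrite exprn_gt0// normr_gt0.
have ma := measurable_affine_rV c v.
have mfa : measurable_fun setT (fun x : Rn => f (c *: x + v)) by exact: measurableT_comp ma.
have ia : L1 leb (fun x => f (c *: x + v)).
  apply/L1P; split => //.
  rewrite (ge0_integral_affine v c0) in foo => //; last first.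
    by apply: measurableT_comp => //; exact/measurable_EFinP.
  rewrite ltey; apply: contraTN foo => /eqP ->.
  by rewrite gt0_muley ?lte_fin// ltxx.
split => //; rewrite /Rintegral -[in RHS]/(fine (`|c| ^+ n)%:E) -fineM//; last first.
  exact: integrable_fin_num.
congr fine; rewrite integralE [X in (_ * X)%E]integralE muleBr//; last first.
  by apply: fin_num_adde_defl; rewrite fin_numN; exact: (integrable_neg_fin_num measurableT ia).
have mef : measurable_fun setT (EFin \o f) by exact/measurable_EFinP.
have E1 := @ge0_integral_affine R n c v _ c0 (measurable_funepos mef) (funepos_ge0 _).
have E2 := @ge0_integral_affine R n c v _ c0 (measurable_funeneg mef) (funeneg_ge0 _).
rewrite [X in (X - _)%E]E1 [X in (_ - X)%E]E2.
by congr (_ * _ - _ * _)%E; apply: eq_integral => x _; rewrite ?funeposE ?funenegE.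
Qed.

Lemma L1_shift (v : Rn) (f : Rn -> R) : L1 leb f -> L1 leb (fun x => f (x + v)).
Proof.
move=> /(L1_affine v (oner_neq0 _))[+ _].
by under [X in L1 _ X -> _]eq_fun do rewrite scale1r.
Qed.

Lemma Rintegral_shift (v : Rn) (f : Rn -> R) : L1 leb f ->
  \int[leb]_x f (x + v) = \int[leb]_x f x.
Proof.
move=> /(L1_affine v (oner_neq0 _))[_ ->]; rewrite normr1 expr1n mul1r.
by apply: eq_Rintegral => x _; rewrite scale1r.
Qed.

Lemma L1_reflect (f : Rn -> R) : L1 leb f -> L1 leb (fun x => f (- x)).
Proof.
have N1 : (-1 : R) != 0 by rewrite oppr_eq0 oner_neq0.
move=> /(L1_affine 0 N1)[+ _].
by under [X in L1 _ X -> _]eq_fun do rewrite scaleN1r addr0.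
Qed.

Lemma Rintegral_reflect (f : Rn -> R) : L1 leb f ->
  \int[leb]_x f (- x) = \int[leb]_x f x.
Proof.
have N1 : (-1 : R) != 0 by rewrite oppr_eq0 oner_neq0.
move=> /(L1_affine 0 N1)[_ ->]; rewrite normrN normr1 expr1n mul1r.
by apply: eq_Rintegral => x _; rewrite scaleN1r addr0.
Qed.

Lemma measurable_oppV : measurable_fun setT (fun x : Rn => - x).
Proof.
have := measurable_affine_rV (-1) (0 : Rn).
by under [X in measurable_fun _ X -> _]eq_fun do rewrite scaleN1r addr0.
Qed.

End rV_Rintegral.

Section dotv_lemmas.
Context {R : realType} (n : nat).
Implicit Types x y z : 'rV[R]_n.

Lemma dotvC x y : dotv x y = dotv y x.
Proof. by apply: eq_bigr => i _; rewrite mulrC. Qed.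

Lemma dotvDl x y z : dotv (x + y) z = dotv x z + dotv y z.
Proof. by rewrite -big_split /=; apply: eq_bigr => i _; rewrite mxE mulrDl. Qed.

Lemma dotvZl c x y : dotv (c *: x) y = c * dotv x y.
Proof. by rewrite mulr_sumr; apply: eq_bigr => i _; rewrite mxE mulrA. Qed.

Lemma dotvZr c x y : dotv x (c *: y) = c * dotv x y.
Proof. by rewrite dotvC dotvZl dotvC. Qed.

Lemma dotvNl x y : dotv (- x) y = - dotv x y.
Proof. by rewrite -scaleN1r dotvZl mulN1r. Qed.

Lemma dotvNr x y : dotv x (- y) = - dotv x y.
Proof. by rewrite dotvC dotvNl dotvC. Qed.

Lemma dotvBl x y z : dotv (x - y) z = dotv x z - dotv y z.
Proof. by rewrite dotvDl dotvNl. Qed.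

Lemma dotv_ge0 x : 0 <= dotv x x.
Proof. by apply: sumr_ge0 => i _; rewrite -expr2 sqr_ge0. Qed.

Lemma enorm_ge0 x : 0 <= enorm x. Proof. exact: sqrtr_ge0. Qed.

Lemma enorm_sqr x : enorm x ^+ 2 = dotv x x.
Proof. by rewrite sqr_sqrtr// dotv_ge0. Qed.

Lemma enormN x : enorm (- x) = enorm x.
Proof. by rewrite /enorm dotvNl dotvNr opprK. Qed.

Lemma coord_le_norm x i : `|x ord0 i| <= `|x|.
Proof.
rewrite [leRHS]/Num.norm /= mx_normrE.
by apply: (le_bigmax _ (fun ij : 'I_1 * 'I_n => `|x ij.1 ij.2|) (ord0, i)).
Qed.

Lemma norm_le_coord x c : 0 <= c -> (forall i, `|x ord0 i| <= c) -> `|x| <= c.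
Proof.
move=> c0 xc; rewrite [leLHS]/Num.norm /= mx_normrE.
by apply/bigmax_leP; split=> // -[i j] _ /=; rewrite ord1.
Qed.

Lemma norm_le_enorm x : `|x| <= enorm x.
Proof.
apply: norm_le_coord => [|i]; first exact: enorm_ge0.
rewrite -sqrtr_sqr ler_wsqrtr// /dotv (bigD1 i)//= expr2 lerDl.
by apply: sumr_ge0 => j _; rewrite -expr2 sqr_ge0.
Qed.

Lemma dotv_le_norm x y : `|dotv x y| <= n%:R * (`|x| * `|y|).
Proof.
apply: le_trans (ler_norm_sum _ _ _) _.
apply: (@le_trans _ _ (\sum_(i < n) `|x| * `|y|)).
  by apply: ler_sum => i _; rewrite normrM ler_pM// coord_le_norm.
by rewrite sumr_const card_ord mulr_natl.
Qed.

Lemma continuous_coord i : continuous (fun x : 'rV[R]_n => x ord0 i).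
Proof. exact: coord_continuous. Qed.

Lemma continuous_dotv d (f g : 'rV[R]_n -> 'rV[R]_d) :
  continuous f -> continuous g -> continuous (fun x => dotv (f x) (g x)).
Proof.
move=> cf cg x; rewrite /dotv.
have Fx : Filter (nbhs x) by exact: nbhs_filter.
apply: (@cvg_big R 'I_d +%R 0 xpredT) => [|i _]; first exact: add_continuous.
by apply: cvgM; [exact: (continuous_comp (cf x) (@coord_continuous R 1 d ord0 i (f x)))
                |exact: (continuous_comp (cg x) (@coord_continuous R 1 d ord0 i (g x)))].
Qed.

Lemma measurable_dotv d (T : measurableType d) (f g : T -> 'rV[R]_n) :
  measurable_fun setT f -> measurable_fun setT g ->
  measurable_fun setT (fun z : T => dotv (f z) (g z)).
Proof.
move=> mf mg; apply: measurable_sum => i.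
by apply: measurable_funM; apply: (measurableT_comp (measurable_coord i)).
Qed.

Lemma measurable_enorm : measurable_fun setT (@enorm R n).
Proof.
apply: measurableT_comp; last by apply: measurable_dotv; exact: measurable_id.
apply: (@continuous_measurable_fun R (@Num.sqrt R)); exact: sqrt_continuous.
Qed.

End dotv_lemmas.

Section rV_fubini.
Context {R : realType} (n : nat).
Local Notation mm := ((@lebesgue_measure R) \x (@lebesgue_rV R n))%E.

Lemma ge0_integral_rVS_prod (f : 'rV[R]_n.+1 -> \bar R) :
  measurable_fun setT f -> (forall x, 0 <= f x)%E ->
  (\int[@lebesgue_rV R n.+1]_x f x = \int[mm]_z f (consrV z))%E.
Proof.
move=> mf f0; have mc := @measurable_consrV R n.
pose cR : measurableTypeR R * 'rV[R]_n -> 'rV[R]_n.+1 := @consrV R n.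
rewrite -[RHS](@ge0_integral_pushforward _ _ _ _ _ cR mc mm setT f measurableT mf (fun x _ => f0 x)).
exact: eq_measure_integral.
Qed.

Lemma L1_rVS (f : 'rV[R]_n.+1 -> R) : measurable_fun setT f ->
  L1 mm (fun z => f (consrV z)) ->
  L1 (@lebesgue_rV R n.+1) f /\
  \int[@lebesgue_rV R n.+1]_x f x = \int[mm]_z f (consrV z).
Proof.
move=> mf /L1P[mfc foo].
have mef : measurable_fun setT (EFin \o f) by exact/measurable_EFinP.
split.
  apply/L1P; split => //; rewrite ge0_integral_rVS_prod//.
  exact: measurableT_comp.
rewrite /Rintegral; congr fine; rewrite integralE [RHS]integralE.
congr (_ - _)%E; rewrite ge0_integral_rVS_prod//.
- by apply: eq_integral => x _; rewrite !funeposE.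
- exact: measurable_funepos.
- by apply: eq_integral => x _; rewrite !funenegE.
- exact: measurable_funeneg.
Qed.

End rV_fubini.

Lemma is_derive_under_integral d (T : measurableType d) (R : realType)
    (mu : {measure set T -> \bar R}) (f df : R -> T -> R) (G : T -> R) (a : R) :
  (forall x, L1 mu (f x)) ->
  (forall (x : R) y, is_derive x 1 (f ^~ y) (df x y)) -> L1 mu G ->
  (forall x y, `|x - a| < 1 -> `|df x y| <= G y) ->
  is_derive a 1 (fun x => \int[mu]_y f x y) (\int[mu]_y df a y).
Proof.
move=> if_ fdf iG dfG.
have aI : (`]a - 1, a + 1[%classic : set R) a by rewrite /= in_itv/=; apply/andP; split; lra.
have inI x : (`]a - 1, a + 1[%classic : set R) x -> `|x - a| < 1.
  by rewrite /= in_itv/= => /andP[? ?]; rewrite ltr_norml; apply/andP; split; lra.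
have E x y : partial1of2 f x y = df x y.
  by rewrite partial1of2E; apply: derive_val.
have G0 y : 0 <= G y by apply: le_trans (dfG a y _); rewrite ?subrr ?normr0.
have D := @derivable_under_integral _ _ _ mu f setT measurableT a (a - 1) (a + 1)
  aI (fun x _ => if_ x) (fun x y _ _ => @ex_derive _ _ _ _ _ _ _ (fdf x y)) G G0 iG.
have V := @differentiation_under_integral _ _ _ mu f setT measurableT a (a - 1) (a + 1)
  aI (fun x _ => if_ x) (fun x y _ _ => @ex_derive _ _ _ _ _ _ _ (fdf x y)) G G0 iG.
have B x y : (`]a - 1, a + 1[%classic : set R) x -> setT y -> `|partial1of2 f x y| <= G y.
  by move=> /inI xa _; rewrite E dfG.
apply: DeriveDef; first exact: D.
by rewrite -derive1E V//; apply: eq_Rintegral => y _; rewrite E.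
Qed.

(** * Gaussian integrals *)

Section gauss1.
Context {R : realType}.
Local Notation mu := (@lebesgue_measure R).

Lemma L1_affineR (c v : R) (f : R -> R) : c != 0 -> L1 mu f ->
  L1 mu (fun x : measurableTypeR R => f (c * x + v)) /\
  \int[mu]_x f x = `|c| * \int[mu]_x f (c * x + v).
Proof.
move=> c0 if_; have [mf foo] := (L1P _ _).1 if_.
have c1 : 0 < `|c| by rewrite normr_gt0.
have ma := measurable_affineR c v.
have mfa : measurable_fun setT (fun x : measurableTypeR R => f (c * x + v)).
  exact: (measurableT_comp mf ma).
have ia : L1 mu (fun x : measurableTypeR R => f (c * x + v)).
  apply/L1P; split => //.
  rewrite (ge0_integral_affineR v c0) in foo => //; last first.
    by apply: measurableT_comp => //; exact/measurable_EFinP.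
  rewrite ltey; apply: contraTN foo => /eqP ->.
  by rewrite gt0_muley ?lte_fin// ltxx.
split => //; rewrite /Rintegral -[in RHS]/(fine (`|c|)%:E) -fineM//; last first.
  exact: integrable_fin_num.
congr fine; rewrite integralE [X in (_ * X)%E]integralE muleBr//; last first.
  by apply: fin_num_adde_defl; rewrite fin_numN; exact: (integrable_neg_fin_num measurableT ia).
have mef : measurable_fun setT (EFin \o f) by exact/measurable_EFinP.
have E1 := @ge0_integral_affineR R c v _ c0 (measurable_funepos mef) (funepos_ge0 _).
have E2 := @ge0_integral_affineR R c v _ c0 (measurable_funeneg mef) (funeneg_ge0 _).
rewrite [X in (X - _)%E]E1 [X in (_ - X)%E]E2.
by congr (_ * _ - _ * _)%E; apply: eq_integral => x _; rewrite ?funeposE ?funenegE.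
Qed.

Lemma L1_gauss (a : R) : 0 < a -> L1 mu (fun x => expR (- (a * x ^+ 2))).
Proof.
move=> a0; have s0 : 0 < Num.sqrt a by rewrite sqrtr_gt0.
have [+ _] := @L1_affineR (Num.sqrt a) 0 _ (lt0r_neq0 s0) integrableT_gauss.
apply: eq_integrable => // x _ /=.
by rewrite /gauss_fun addr0 exprMn sqr_sqrtr// ltW.
Qed.

Lemma measurable_gauss_trig (p g : R -> R) (a : R) : continuous p -> continuous g ->
  measurable_fun [set: R] (fun x => p x * expR (- (a * x ^+ 2)) * g x).
Proof.
move=> cp cg; apply: continuous_measurable_fun => x.
apply: cvgM; last exact: cg.
apply: cvgM; first exact: cp.
apply: continuous_comp; last exact: continuous_expR.
apply: cvgN; apply: cvgM; first exact: cvg_cst.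
exact: exprn_continuous.
Qed.

(** Because [|x| <= 1 + x^2 / 2 <= e^(x^2 / 2)]. It absorbs a factor [x] into half of the Gaussian
    and so supplies dominating functions. *)
Lemma absx_gauss_le (x : R) : `|x| * expR (- x ^+ 2) <= expR (- (2^-1 * x ^+ 2)).
Proof.
have -> : - x ^+ 2 = - (2^-1 * x ^+ 2) - 2^-1 * x ^+ 2 by field.
rewrite expRD mulrCA -[leRHS]mulr1 ler_pM2l ?expR_gt0// expRN ler_pdivrMr ?expR_gt0// mul1r.
apply: le_trans (expR_ge1Dx _).
have : 0 <= (`|x| - 1) ^+ 2 by exact: sqr_ge0.
by have := real_normK (num_real x); nra.
Qed.

Lemma is_derive_gauss_cos (x z : R) :
  is_derive z 1 (fun z => expR (- x ^+ 2) * cos (z * x)) (- (x * expR (- x ^+ 2) * sin (z * x))).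
Proof.
apply: is_derive_eq.
by rewrite /GRing.scale /=; ring.
Qed.

Lemma is_derive_gauss_sin (x z : R) :
  is_derive x 1 (fun x => expR (- x ^+ 2) * sin (z * x))
    (- (2 * x * expR (- x ^+ 2) * sin (z * x)) + z * (expR (- x ^+ 2) * cos (z * x))).
Proof.
apply: is_derive_eq.
by rewrite /GRing.scale /=; ring.
Qed.

Lemma L1_gauss_trig (g : R -> R) : continuous g -> (forall x, `|g x| <= 1) ->
  L1 mu (fun x => expR (- x ^+ 2) * g x).
Proof.
move=> cg g1; apply: (L1_boundedM (k := 1)) => //.
  exact: integrableT_gauss.
exact: continuous_measurable_fun.
Qed.

Definition gcos (z : R) := \int[mu]_x (expR (- x ^+ 2) * cos (z * x)).

Lemma continuous_trigZ (z : R) : continuous (fun x : R => cos (z * x)) /\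
  continuous (fun x : R => sin (z * x)).
Proof.
split => x; apply: continuous_comp; try exact: mulrl_continuous.
exact: continuous_cos.
exact: continuous_sin.
Qed.

Lemma is_derive_gcos (z : R) : is_derive z 1 gcos
  (\int[mu]_x (- (x * expR (- x ^+ 2) * sin (z * x)))).
Proof.
apply: (@is_derive_under_integral _ _ _ mu
  (fun z x => expR (- x ^+ 2) * cos (z * x))
  (fun z x => - (x * expR (- x ^+ 2) * sin (z * x)))
  (fun x => expR (- (2^-1 * x ^+ 2)))).
- by move=> w; apply: L1_gauss_trig => [|x]; [exact: (continuous_trigZ w).1|exact: cos_max].
- by move=> w x; exact: is_derive_gauss_cos.
- by apply: L1_gauss; lra.
- move=> w x _; rewrite normrN 2!normrM (ger0_norm (expR_ge0 _)).
  apply: le_trans (absx_gauss_le x); rewrite -[leRHS]mulr1.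
  by apply: ler_wpM2l; rewrite ?mulr_ge0 ?expR_ge0// sin_max.
Qed.

(** The integrand is the derivative of [F]. Boundary terms are avoided by translation invariance:
    the integral of [F (x + h)] is constant in [h], and its derivative at [h = 0] is the integral of
    [F']. *)
Lemma gauss_sin_parts (z : R) :
  \int[mu]_x (- (2 * x * expR (- x ^+ 2) * sin (z * x)) +
    z * (expR (- x ^+ 2) * cos (z * x))) = 0.
Proof.
pose F x := expR (- x ^+ 2) * sin (z * x).
pose F' x := - (2 * x * expR (- x ^+ 2) * sin (z * x)) + z * (expR (- x ^+ 2) * cos (z * x)).
have iF : L1 mu F.
  by apply: L1_gauss_trig => [|x]; [exact: (continuous_trigZ z).2|exact: sin_max].
have iFh h : L1 mu (fun x => F (x + h)) /\ \int[mu]_x F (x + h) = \int[mu]_x F x.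
  have [iS ->] := @L1_affineR 1 h F (oner_neq0 _) iF.
  rewrite normr1 mul1r; split.
    by move: iS; apply: eq_integrable => // x _ /=; rewrite mul1r.
  by apply: eq_Rintegral => x _; rewrite mul1r.
have D : is_derive (0 : R) 1 (fun h => \int[mu]_x F (x + h)) (\int[mu]_x F' (x + 0)).
  (* With [y = x + h], the derivative is at most [(2 + |z|) e^(-y^2 / 2)], and
     [y^2 / 2 >= x^2 / 4 - h^2 / 2] with [|h| < 1]. *)
  apply: (@is_derive_under_integral _ _ _ mu (fun h x => F (x + h)) (fun h x => F' (x + h))
    (fun x => (2 + `|z|) * expR 1 * expR (- (4^-1 * x ^+ 2)))).
  - by move=> h; exact: (iFh h).1.
  - move=> h x.
    have := @is_derive1_comp R F (fun h => x + h) h (F' (x + h)) 1 _ _.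
    rewrite mulr1; apply; first exact: is_derive_gauss_sin.
    rewrite (_ : [eta +%R x] = shift x); first exact: is_derive_shift.
    by apply/funext => y /=; rewrite addrC.
  - by apply: L1Z; apply: L1_gauss; lra.
  - move=> h x; rewrite subr0 => h1; set y := x + h.
    apply: (@le_trans _ _ ((2 + `|z|) * expR (- (2^-1 * y ^+ 2)))).
      apply: le_trans (ler_normD _ _) _; rewrite normrN [leRHS]mulrDl; apply: lerD.
        rewrite -!mulrA 2!normrM (ger0_norm (ler0n _ _)); apply: ler_wpM2l => //.
        apply: le_trans (absx_gauss_le y).
        rewrite normrM (ger0_norm (expR_ge0 _)); apply: ler_wpM2l => //.
        by rewrite -[leRHS]mulr1; apply: ler_wpM2l; rewrite ?expR_ge0// sin_max.
      rewrite normrM; apply: ler_wpM2l => //.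
      rewrite normrM (ger0_norm (expR_ge0 _)).
      apply: (@le_trans _ _ (expR (- y ^+ 2) * 1)).
        by apply: ler_wpM2l; rewrite ?expR_ge0// cos_max.
      by rewrite mulr1 ler_expR lerN2; have := sqr_ge0 y; lra.
    rewrite -mulrA; apply: ler_wpM2l; first by rewrite addr_ge0.
    rewrite -expRD ler_expR /y.
    have h2 : h ^+ 2 <= 1 by move: h1; rewrite ltr_norml => /andP[? ?]; nra.
    have : 0 <= (x + 2 * h) ^+ 2 by exact: sqr_ge0.
    by nra.
have D0 : is_derive (0 : R) 1 (fun h => \int[mu]_x F (x + h)) 0.
  rewrite (_ : (fun h => _) = cst (\int[mu]_x F x)); first exact: is_derive_cst.
  by apply/funext => h; rewrite (iFh h).2.
have := @derive_val _ _ _ _ _ _ _ D; rewrite (@derive_val _ _ _ _ _ _ _ D0) => /esym.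
by under eq_Rintegral do rewrite addr0.
Qed.

(* The left-hand side solves [g' = - (z / 2) g]. *)
Lemma gcosE (z : R) : gcos z = Num.sqrt pi * expR (- (z ^+ 2 / 4)).
Proof.
pose h (z : R) := gcos z * expR (z ^+ 2 / 4).
have ode w : \int[mu]_x (- (x * expR (- x ^+ 2) * sin (w * x))) = - (w / 2) * gcos w.
  have c1 : continuous (fun x : R => sin (w * x)) by exact: (continuous_trigZ w).2.
  have i2 : L1 mu (fun x => expR (- x ^+ 2) * cos (w * x)).
    by apply: L1_gauss_trig => [|x]; [exact: (continuous_trigZ w).1|exact: cos_max].
  have i1 : L1 mu (fun x => - (x * expR (- x ^+ 2) * sin (w * x))).
    apply: L1N; apply: (@L1_le _ (measurableTypeR R) R mu _ (fun x => expR (- (2^-1 * x ^+ 2)))).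
    - have := @measurable_gauss_trig id (fun x => sin (w * x)) 1 (fun x => @cvg_id _ (nbhs x)) c1.
      by under [X in measurable_fun _ X -> _]eq_fun do rewrite mul1r.
    - by apply: L1_gauss; lra.
    - move=> x; rewrite 2!normrM (ger0_norm (expR_ge0 _)).
      apply: le_trans (absx_gauss_le x); rewrite -[leRHS]mulr1.
      by apply: ler_wpM2l; rewrite ?mulr_ge0 ?expR_ge0// sin_max.
  have := gauss_sin_parts w.
  have -> : (fun x => - (2 * x * expR (- x ^+ 2) * sin (w * x)) +
    w * (expR (- x ^+ 2) * cos (w * x))) =
    (fun x => 2 * - (x * expR (- x ^+ 2) * sin (w * x)) + w * (expR (- x ^+ 2) * cos (w * x))).
    by apply/funext => x; ring.
  rewrite RintegralTD ?RintegralTZ//; [|exact: L1Z..].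
  by rewrite -/(gcos w) => ?; lra.
have dh (w : R) : is_derive w 1 h 0.
  have Dg := is_derive_gcos w; rewrite ode in Dg.
  by apply: is_derive_eq; rewrite /GRing.scale /=; field.
have := is_derive_0_is_cst z 0 dh.
rewrite /h expr0n mul0r expR0 mulr1 => H.
have g0 : gcos 0 = Num.sqrt pi.
  rewrite /gcos; under eq_Rintegral do rewrite mul0r cos0 mulr1.
  by rewrite /Rintegral integralT_gauss.
by rewrite expRN -g0 -H mulfK// gt_eqF ?expR_gt0.
Qed.

(* The phase [b] makes the formula stable under iterated integration. *)
Lemma gauss_cos_phase (t a b : R) : 0 < t ->
  L1 mu (fun x => expR (- (t * x ^+ 2)) * cos (a * x + b)) /\
  \int[mu]_x (expR (- (t * x ^+ 2)) * cos (a * x + b)) =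
  Num.sqrt (pi / t) * expR (- (a ^+ 2 / (4 * t))) * cos b.
Proof.
move=> t0; set q := Num.sqrt t.
have q0 : 0 < q by rewrite sqrtr_gt0.
have qq : q ^+ 2 = t by rewrite sqr_sqrtr// ltW.
have i0 : L1 mu (fun x => expR (- x ^+ 2) * cos (a / q * x)).
  by apply: L1_gauss_trig => [|x]; [exact: (continuous_trigZ _).1|exact: cos_max].
have i0s : L1 mu (fun x => expR (- x ^+ 2) * sin (a / q * x)).
  by apply: L1_gauss_trig => [|x]; [exact: (continuous_trigZ _).2|exact: sin_max].
have ss : \int[mu]_x (expR (- x ^+ 2) * sin (a / q * x)) = 0.
  have [_] := @L1_affineR (-1) 0 _ (ltr0_neq0 (ltrN10 R)) i0s.
  rewrite normrN normr1 mul1r => E; have : \int[mu]_x (expR (- x ^+ 2) * sin (a / q * x)) =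
    - \int[mu]_x (expR (- x ^+ 2) * sin (a / q * x)).
    rewrite {1}E -RintegralTN//; apply: eq_Rintegral => x _.
    by rewrite addr0 mulN1r sqrrN mulrN sinN mulrN.
  by move=> ?; lra.
pose f x := expR (- x ^+ 2) * cos (a / q * x + b).
have fE : f = fun x => cos b * (expR (- x ^+ 2) * cos (a / q * x)) -
    sin b * (expR (- x ^+ 2) * sin (a / q * x)).
  by apply/funext => x; rewrite /f cosD; ring.
have iff : L1 mu f by rewrite fE; apply: L1B; exact: L1Z.
have intf : \int[mu]_x f x = Num.sqrt pi * expR (- (a ^+ 2 / (4 * t))) * cos b.
  rewrite fE RintegralTB; [|exact: L1Z..].
  rewrite !RintegralTZ// ss mulr0 subr0 -/(gcos _) gcosE mulrC; congr (_ * expR (- _) * _).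
  by rewrite expr_div_n qq; field; rewrite gt_eqF.
have [+ ] := @L1_affineR q 0 f (lt0r_neq0 q0) iff.
have E x : f (q * x + 0) = expR (- (t * x ^+ 2)) * cos (a * x + b).
  by rewrite /f addr0 exprMn qq; congr (_ * cos (_ + _)); field; rewrite gt_eqF.
rewrite (_ : (fun x => f (q * x + 0)) = (fun x => expR (- (t * x ^+ 2)) * cos (a * x + b))); last first.
  by apply/funext => x; rewrite E.
move=> iS; rewrite gtr0_norm// intf => H; split => //.
have -> : Num.sqrt (pi / t) = Num.sqrt pi / q by rewrite sqrtrM ?pi_ge0// sqrtrV ?ltW.
apply: (@mulfI _ q); first by rewrite gt_eqF.
by rewrite -H; field; rewrite gt_eqF.
Qed.

End gauss1.

Section gaussn.
Context {R : realType}.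
Local Notation leb n := (@lebesgue_rV R n).

Lemma dotv_consrV n (a b : R) (x y : 'rV[R]_n) :
  dotv (consrV (a, x)) (consrV (b, y)) = a * b + dotv x y.
Proof.
rewrite /dotv big_ord_recl !consrV0E; congr (_ + _).
by apply: eq_bigr => i _; rewrite !consrVSE.
Qed.

(** This is [(2 pi)^n] times the usual heat kernel [(4 pi t)^(-n/2) e^(-|z|^2 / (4 t))]; with this
    factor it is the cosine transform of [e^(-t |x|^2)]. *)
Definition heat_kernel n (t : R) (z : 'rV[R]_n) : R :=
  Num.sqrt (pi / t) ^+ n * expR (- (dotv z z / (4 * t))).

Lemma measurable_gaussV n (t : R) (z : 'rV[R]_n) (b : R) :
  measurable_fun setT (fun x : 'rV[R]_n =>
    expR (- (t * dotv x x)) * cos (dotv z x + b)).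
Proof.
apply: measurable_funM.
  apply: measurableT_comp; first exact: measurable_expR.
  apply: measurable_funN; apply: measurable_funM => //.
  by apply: measurable_dotv; exact: measurable_id.
apply: measurableT_comp; first exact: (continuous_measurable_fun (@continuous_cos R)).
apply: measurable_funD => //; apply: measurable_dotv => //; exact: measurable_id.
Qed.

Lemma L1_gaussV n (t : R) : 0 < t ->
  L1 (leb n) (fun x => expR (- (t * dotv x x))).
Proof.
move=> t0.
have mG m : measurable_fun setT (fun x : 'rV[R]_m => expR (- (t * dotv x x))).
  have := @measurable_gaussV m t 0 0.
  under [X in measurable_fun _ X -> _]eq_fun => x.
    rewrite (_ : dotv 0 x = 0) ?addr0 ?cos0 ?mulr1; first over.
    by rewrite /dotv big1// => i _; rewrite mxE mul0r.
  exact.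
elim: n => [|n IH].
  apply/L1P; split; first exact: mG.
  rewrite ge0_integral_rV0 ?ltry//.
  by do 2 apply: measurableT_comp => //; exact: mG.
apply: (L1_rVS _ _).1 => //.
have := L1_prod (L1_gauss t0) IH.
apply: eq_integrable => // -[a x] _ /=.
by rewrite dotv_consrV -expRD -opprD -mulrDr -expr2.
Qed.

(** Induction on the dimension: once the first coordinate is fixed at [a], its contribution [z0 a]
    to the scalar product joins the phase of the integral over the others. *)
Lemma gauss_cos_phaseV n (t : R) (z : 'rV[R]_n) (b : R) : 0 < t ->
  L1 (leb n) (fun x => expR (- (t * dotv x x)) * cos (dotv z x + b)) /\
  \int[leb n]_x (expR (- (t * dotv x x)) * cos (dotv z x + b)) =
    heat_kernel t z * cos b.
Proof.
move=> t0.
have iL m (z' : 'rV[R]_m) c : L1 (leb m) (fun x => expR (- (t * dotv x x)) * cos (dotv z' x + c)).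
  apply: (L1_le (measurable_gaussV _ _ _) (L1_gaussV m t0)) => x.
  rewrite normrM (ger0_norm (expR_ge0 _)) -[leRHS]mulr1.
  by apply: ler_wpM2l; rewrite ?expR_ge0 ?cos_max.
split => //; elim: n z b => [|n IH] z b.
  have d0 (x y : 'rV[R]_0) : dotv x y = 0 by rewrite /dotv big_ord0.
  rewrite /Rintegral ge0_integral_rV0; last first.
    by apply/measurable_EFinP; exact: measurable_gaussV.
  by rewrite /heat_kernel !d0 mulr0 mul0r add0r oppr0 expR0 expr0 !mul1r.
set z0 := z ord0 ord0; set z' : 'rV[R]_n := \row_j z ord0 (lift ord0 j).
have zE : z = consrV (z0, z') by rewrite -[LHS]unconsrVK.
have E a (x : 'rV[R]_n) : expR (- (t * dotv (consrV (a, x)) (consrV (a, x)))) *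
    cos (dotv z (consrV (a, x)) + b) = expR (- (t * a ^+ 2)) *
    (expR (- (t * dotv x x)) * cos (dotv z' x + (z0 * a + b))).
  rewrite zE !dotv_consrV mulrDr opprD expRD -expr2 -mulrA; congr (_ * (_ * cos _)).
  by rewrite addrAC addrC addrA.
have ip : ((@lebesgue_measure R) \x (leb n))%E.-integrable setT
    (EFin \o (fun y : measurableTypeR R * 'rV[R]_n =>
    expR (- (t * dotv (consrV y) (consrV y))) * cos (dotv z (consrV y) + b))).
  apply: (L1_le _ (L1_prod (L1_gauss t0) (L1_gaussV n t0))).
    exact: (measurableT_comp (measurable_gaussV t z b) (@measurable_consrV R n)).
  move=> [a x] /=; rewrite E !normrM !(ger0_norm (expR_ge0 _)) mulrA.
  by rewrite -[leRHS]mulr1; apply: ler_wpM2l; rewrite ?mulr_ge0 ?expR_ge0 ?cos_max.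
have [_ ->] := L1_rVS (measurable_gaussV t z b) ip.
rewrite -(Rfubini1 ip).2.
transitivity (\int[@lebesgue_measure R]_a (heat_kernel t z' *
    (expR (- (t * a ^+ 2)) * cos (z0 * a + b)))).
  apply: eq_Rintegral => a _; under eq_Rintegral do rewrite E.
  by rewrite RintegralTZ ?IH//; ring.
have [i1 e1] := @gauss_cos_phase R t z0 b t0.
rewrite RintegralTZ// e1 /heat_kernel zE dotv_consrV -expr2 [_ ^+ n.+1]exprS.
rewrite (_ : - ((z0 ^+ 2 + dotv z' z') / (4 * t)) =
  - (dotv z' z' / (4 * t)) + - (z0 ^+ 2 / (4 * t))) ?expRD; first by ring.
by rewrite mulrDl; lra.
Qed.

Lemma heat_kernel_ge0 n t (z : 'rV[R]_n) : 0 <= heat_kernel t z.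
Proof. by rewrite mulr_ge0 ?expR_ge0// exprn_ge0// sqrtr_ge0. Qed.

(* The heat kernel is a Gaussian with parameter [1 / (4 t)], so its mass comes
   from its own cosine transform at frequency 0. *)
Lemma heat_kernel_mass n (t : R) : 0 < t -> L1 (leb n) (heat_kernel t) /\
  \int[leb n]_z heat_kernel t z = (2 * pi) ^+ n.
Proof.
move=> t0; have u0 : 0 < (4 * t)^-1 by rewrite invr_gt0; lra.
have E : heat_kernel t = fun z : 'rV[R]_n => Num.sqrt (pi / t) ^+ n * expR (- ((4 * t)^-1 * dotv z z)).
  by apply/funext => z; rewrite /heat_kernel [dotv z z / _]mulrC.
have iG := L1_gaussV n u0.
rewrite E; split; first exact: L1Z.
rewrite RintegralTZ//.
have [_] := @gauss_cos_phaseV n _ 0 0 u0.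
have d0 (x : 'rV[R]_n) : dotv 0 x = 0.
  by rewrite /dotv big1// => i _; rewrite mxE mul0r.
under eq_Rintegral do rewrite d0 addr0 cos0 mulr1.
move=> ->; rewrite /heat_kernel d0 mul0r oppr0 expR0 cos0 !mulr1 -exprMn.
rewrite -sqrtrM ?divr_ge0 ?pi_ge0 ?ltW//.
rewrite (_ : pi / t * (pi / (4 * t)^-1) = (2 * pi) ^+ 2); last by field; rewrite gt_eqF.
by rewrite sqrtr_sqr ger0_norm// mulr_ge0 ?pi_ge0.
Qed.

End gaussn.

(** * Continuity of translations in L^2 *)

Section translation_continuity.
Context {R : realType} (n : nat).
Local Notation Rn := 'rV[R]_n.
Local Notation mu := (@lebesgue_rV R n).
Local Notation L2m := (L2 mu).
Local Notation sqnm := (sqn mu).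
Local Notation ipm := (ip mu).
Implicit Types f g : Rn -> R.

Lemma measurable_shift f (u : Rn) : measurable_fun setT f ->
  measurable_fun setT (fun x : Rn => f (x + u)).
Proof.
move=> mf; have ma := measurable_affine_rV 1 u.
have := measurableT_comp mf ma.
by under [X in measurable_fun _ X -> _]eq_fun do rewrite /= scale1r.
Qed.

Lemma L2_shift f u : L2m f -> L2m (fun x => f (x + u)).
Proof.
by move=> [mf if_]; split; [exact: measurable_shift|exact: (L1_shift u if_)].
Qed.

Lemma sqn_shift f u : L2m f -> sqnm (fun x => f (x + u)) = sqnm f.
Proof. by move=> [mf if_]; exact: (Rintegral_shift u if_). Qed.

Definition tcont f := forall u : nat -> Rn, u k @[k --> \oo] --> (0 : Rn) ->
  sqnm (fun x => f (x + u k) - f x) @[k --> \oo] --> (0 : R).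

Lemma tcontD f g : L2m f -> L2m g -> tcont f -> tcont g -> tcont (fun x => f x + g x).
Proof.
move=> Lf Lg cf cg u u0.
apply: (@squeeze_cvgr _ _ _ _ (cst 0)); last first.
- have : 2 * sqnm (fun x => f (x + u k) - f x) + 2 * sqnm (fun x => g (x + u k) - g x)
      @[k --> \oo] --> (2 * 0 + 2 * 0 : R).
    by apply: cvgD; apply: cvgM; [exact: cvg_cst|exact: cf|exact: cvg_cst|exact: cg].
  by rewrite mulr0 addr0; exact.
- exact: cvg_cst.
apply: nearW => k; rewrite sqn_ge0 /=.
have := sqn_leD (L2B (L2_shift (u k) Lf) Lf) (L2B (L2_shift (u k) Lg) Lg).
apply: le_trans; rewrite le_eqVlt; apply/orP; left; apply/eqP/eq_Rintegral => x _.
by congr (_ ^+ 2); ring.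
Qed.

Lemma tcontZ c f : L2m f -> tcont f -> tcont (fun x => c * f x).
Proof.
move=> Lf cf u u0.
have -> : (fun k => sqnm (fun x => c * f (x + u k) - c * f x)) =
    (fun k => c ^+ 2 * sqnm (fun x => f (x + u k) - f x)).
  apply/funext => k; rewrite -sqnZ; last exact: (L2B (L2_shift (u k) Lf) Lf).
  by apply: eq_Rintegral => x _; rewrite mulrBr.
by rewrite -[X in _ --> X](mulr0 (c ^+ 2)); apply: cvgM; [exact: cvg_cst|exact: cf].
Qed.

(** With [g = f - f_N], the increment of [f] costs at most [2 (4 |g|^2)] plus twice the increment of
    [f_N]; the thresholds [e / 16] and [e / 4] make the total at most [e]. *)
Lemma tcont_closed (f_ : nat -> Rn -> R) f : (forall k, L2m (f_ k)) -> L2m f ->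
  (forall k, tcont (f_ k)) -> cvgL2 mu f_ f -> tcont f.
Proof.
move=> Lf_ Lf cf_ cf u u0; apply/cvgrPdist_le => e e0.
have [N _ /(_ N (leqnn N)) /=] : \forall N \near \oo, sqnm (fun x => f_ N x - f x) < e / 16.
  by move/cvgrPdist_lt : cf => /(_ (e / 16)); rewrite divr_gt0// => /(_ isT);
    apply: filterS => k; rewrite sub0r normrN ger0_norm ?sqn_ge0.
move=> fN.
have := cf_ N u u0 => /cvgrPdist_lt /(_ (e / 4)); rewrite divr_gt0// => /(_ isT).
apply: filterS => k; rewrite !sub0r !normrN !ger0_norm ?sqn_ge0// => fk.
pose g x := f x - f_ N x.
have Lg : L2m g by exact: L2B.
have E1 : sqnm (fun x => f (x + u k) - f x) <=
    2 * sqnm (fun x => g (x + u k) - g x) + 2 * sqnm (fun x => f_ N (x + u k) - f_ N x).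
  apply: le_trans (sqn_leD (L2B (L2_shift (u k) Lg) Lg)
    (L2B (L2_shift (u k) (Lf_ N)) (Lf_ N))).
  rewrite le_eqVlt; apply/orP; left; apply/eqP/eq_Rintegral => x _.
  by rewrite /g; congr (_ ^+ 2); ring.
have E2 : sqnm (fun x => g (x + u k) - g x) <= 4 * sqnm g.
  have := sqn_leD (L2_shift (u k) Lg) (L2N Lg).
  by rewrite sqnN sqn_shift//; lra.
have E3 : sqnm g < e / 16 by rewrite /g sqnBC.
lra.
Qed.

Lemma L2_indic (A : set Rn) : measurable A -> (mu A < +oo)%E -> L2m \1_A.
Proof.
move=> mA Aoo; split; first exact: measurable_indic.
have -> : (fun x => (\1_A x : R) ^+ 2) = \1_A.
  by apply/funext => x; rewrite indicE; case: (_ \in _); rewrite ?expr1n ?expr0n.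
by apply: L1_ge0 => //; rewrite integral_indic ?setIT.
Qed.

Lemma L1_indic (A : set Rn) : measurable A -> (mu A < +oo)%E -> L1 mu \1_A.
Proof.
by move=> mA Aoo; apply: L1_ge0 => //; rewrite integral_indic ?setIT.
Qed.

Lemma ball_lty (c : Rn) r : (mu (ball c r) < +oo)%E.
Proof.
have [r0|r0] := ltP 0 r; first by rewrite lebesgue_rV_ball// ltry.
by rewrite (_ : ball c r = set0) ?measure0// -subset0 => x [+ _]; rewrite ltNge r0.
Qed.

(** Expanding the square leaves [2 |1_U|^2 - 2 <1_U(. + u_k), 1_U>]. As [U] is open, a point of [U]
    stays in [U] after a small translation, so the product converges pointwise and dominated
    convergence applies. *)
Lemma tcont_open (U : set Rn) : open U -> (mu U < +oo)%E -> tcont \1_U.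
Proof.
move=> oU Uoo u u0.
have mU := open_measurable_rV oU.
have LU := L2_indic mU Uoo.
have c1 : \int[mu]_x (\1_U (x + u k) * \1_U x) @[k --> \oo] --> \int[mu]_x (\1_U x : R).
  apply: (@Rdominated_convergence _ _ _ mu (fun k x => \1_U (x + u k) * \1_U x) _ \1_U _ _ _ _ _).2.
  - move=> k; apply: measurable_funM; last exact: measurable_indic.
    by apply: measurable_shift; exact: measurable_indic.
  - exact: measurable_indic.
  - apply: aeW => x; rewrite !indicE; have [xU|xU] := boolP (x \in U); last first.
      by under eq_fun do rewrite mulr0; exact: cvg_cst.
    under eq_fun do rewrite mulr1.
    have xu : x + u k @[k --> \oo] --> x.
      by rewrite -[X in _ --> X]addr0; apply: cvgD => //; exact: cvg_cst.
    rewrite inE in xU; apply: cvg_near_cst.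
    have : nbhs x U by exact: open_nbhs_nbhs.
    move=> /xu[N _ H]; exists N => // k /= Nk.
    by rewrite indicE mem_set//; exact: H.
  - exact: L1_indic.
  - move=> k x; rewrite !indicE; do 2 case: (_ \in _) => /=; rewrite ?mulr0 ?mul0r ?mulr1 ?normr0 ?normr1//.
have E k : sqnm (fun x => \1_U (x + u k) - \1_U x) =
    2 * sqnm \1_U - 2 * \int[mu]_x (\1_U (x + u k) * \1_U x).
  by rewrite sqnB//; [rewrite sqn_shift// /ip; lra|exact: L2_shift].
under eq_fun do rewrite E.
have -> : (0 : R) = 2 * sqnm \1_U - 2 * \int[mu]_x (\1_U x : R).
  rewrite (_ : sqnm \1_U = \int[mu]_x (\1_U x : R)) ?subrr//.
  by apply: eq_Rintegral => x _; rewrite indicE; case: (_ \in _); rewrite ?expr1n ?expr0n.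
by apply: cvgB; [exact: cvg_cst|apply: cvgM => //; exact: cvg_cst].
Qed.

(** Dynkin's theorem: the sets whose trace on the ball has the property contain the open sets, which
    are stable under intersection, and are closed under complements and disjoint countable unions.
    Intersecting with a ball keeps all measures finite. *)
Lemma tcont_measurable (c : Rn) r (A : set Rn) : measurable A ->
  tcont \1_(A `&` ball c r).
Proof.
set B := ball c r => mA; have mB : measurable B by exact: measurable_ball_rV.
have Boo : (mu B < +oo)%E by exact: ball_lty.
have oB : open B by exact: ball_open.
clearbody B.
have finI (D : set Rn) : measurable D -> (mu (D `&` B) < +oo)%E.
  move=> mD; apply: le_lt_trans Boo; apply: le_measure; rewrite ?inE//.
  exact: measurableI.
have L2I (D : set Rn) : measurable D -> L2m \1_(D `&` B).
  by move=> mD; apply: L2_indic; [exact: measurableI|exact: finI].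
pose G := [set D : set Rn | measurable D /\ tcont \1_(D `&` B)].
suff /(_ A mA) : @measurable _ Rn `<=` G by case.
have openG : @open Rn `<=` G.
  move=> U oU; split; first exact: open_measurable_rV.
  apply: tcont_open; last by apply: finI; exact: open_measurable_rV.
  exact: openI.
have dynG : dynkin G.
  split.
  - by apply: openG; exact: openT.
  - move=> D [mD tD]; split; first exact: measurableC.
    have -> : \1_(~` D `&` B) = (fun x => \1_(setT `&` B) x + (-1) * \1_(D `&` B) x) :> (Rn -> R).
      apply/funext => x; rewrite !indicE !in_setI in_setC in_setT.
      by do 2 case: (_ \in _); rewrite /= ?mulr1n ?mulr0n; lra.
    apply: tcontD; [exact: L2I|by apply: L2Z; exact: L2I| |].
      by have [_] := openG setT openT.
    by apply: tcontZ => //; exact: L2I.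
  - move=> F tF GF.
    have mF k : measurable (F k) by case: (GF k).
    split; first exact: bigcup_measurable.
    pose s m : Rn -> R := fun x => \sum_(k < m) \1_(F k `&` B) x.
    have Ls m : L2m (s m).
      rewrite /s; elim: m => [|m IH].
        by under [X in L2m X]eq_fun do rewrite big_ord0; exact: L2_0.
      by under [X in L2m X]eq_fun do rewrite big_ord_recr /=; apply: L2D => //; exact: L2I.
    have ts m : tcont (s m).
      elim: m => [|m IH].
        rewrite /s; under eq_fun do rewrite big_ord0.
        move=> u _; apply: cvg_near_cst; apply: nearW => k; rewrite /sqn.
        by under eq_Rintegral do rewrite subrr expr0n /=; exact: Rintegral0.
      have -> : s m.+1 = (fun x => s m x + \1_(F m `&` B) x).
        by apply/funext => x; rewrite /s big_ord_recr.
      exact: tcontD (Ls m) (L2I _ (mF m)) IH (GF m).2.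
    have mUF : measurable (\bigcup_k F k) by exact: bigcup_measurable.
    apply: (@tcont_closed s) => //; first exact: L2I.
    have sE m x : s m x = if `[< exists2 j, (j < m)%N & F j x >] then \1_B x else 0.
      rewrite /s; case: asboolP => [[j jm Fj]|nF]; last first.
        rewrite big1// => k _; rewrite indicE in_setI (_ : (x \in F k) = false)//.
        by apply/negP; rewrite inE => Fk; apply: nF; exists k.
      rewrite (bigD1 (Ordinal jm))//= big1 ?addr0 => [|k kj].
        by rewrite !indicE in_setI mem_set.
      rewrite indicE in_setI (_ : (x \in F k) = false)//.
      apply/negP; rewrite inE => Fk; move/eqP : kj; apply; apply/val_inj => /=.
      by apply: contrapT => /eqP kj; move/trivIsetP : tF => /(_ k j Logic.I Logic.I kj) /seteqP[/(_ x) + _]; exact.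
    have UE x : \1_(\bigcup_k F k `&` B) x = if `[< exists j, F j x >] then \1_B x else 0 :> R.
      rewrite !indicE in_setI; case: asboolP => [[j Fj]|nF].
        by rewrite (_ : (x \in \bigcup_k F k) = true)//; apply/mem_set; exists j.
      by rewrite (_ : (x \in \bigcup_k F k) = false)//; apply/negP; rewrite inE => -[j _ Fj]; apply: nF; exists j.
    rewrite /cvgL2 /sqn.
    have [|||||_ +] := @Rdominated_convergence _ _ _ mu
      (fun m x => (s m x - \1_(\bigcup_k F k `&` B) x) ^+ 2) (fun=> 0) \1_B.
    - move=> m; apply: measurable_funX; apply: measurable_funB.
        exact: L2_measurable (Ls m).
      by apply: measurable_indic; exact: measurableI.
    - exact: measurable_cst.
    - apply: aeW => x; apply: cvg_near_cst.
      have [[j Fj]|nF] := pselect (exists j, F j x); last first.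
        apply: nearW => m; rewrite sE UE !asboolF ?subrr ?expr0n//.
        by move=> [j _ Fj]; apply: nF; exists j.
      exists j.+1 => // m /= jm; rewrite sE UE.
      case: asboolP => [_|[]]; last by exists j.
      by case: asboolP => [_|[]]; [rewrite subrr expr0n|exists j].
    - exact: L1_indic.
    - move=> m x; rewrite sE UE indicE; do 2 case: ifP => _; case: (_ \in _) => /=;
      by rewrite ?mulr1n ?mulr0n ?subr0 ?sub0r ?subrr ?sqrrN ?expr1n ?expr0n /= ?normr1 ?normr0.
    - by rewrite Rintegral0; apply.
have gen : <<s @open Rn >> `<=` G.
  rewrite -setI_closed_g_dynkin_g_sigma_algebra.
    exact: smallest_sub.
  by move=> X Y; exact: openI.
(* The coordinates generating the sigma-algebra of ['rV] are continuous, so it is contained in the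
   one generated by the open sets. *)
apply: (subset_trans _ gen).
pose gT := g_sigma_algebraType (@open Rn).
have mc (i : 'I_n) : measurable_fun [set: gT] (fun x : gT => (x : Rn) ord0 i).
  apply: (measurability _ (RGenOpens.measurableE R)).
  move=> _ [_ [a [b ->] <-]]; rewrite setTI; apply: sub_sigma_algebra.
  have /continuousP H := @coord_continuous R 1 n ord0 i.
  by apply: H; exact: interval_open.
apply: smallest_sub; first exact: smallest_sigma_algebra.
move=> X; rewrite -bigcup_seq => -[i _ [Y mY <-]] /=; rewrite setTI.
by have := mc i measurableT Y mY; rewrite setTI.
Qed.

End translation_continuity.

Section cvgL2_dominated.
Context d (T : measurableType d) (R : realType) (mu : {measure set T -> \bar R}).

Lemma cvgL2_dominated (f_ : nat -> T -> R) (f g : T -> R) :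
  (forall k, measurable_fun setT (f_ k)) -> measurable_fun setT f -> L2 mu g ->
  (forall k x, `|f_ k x| <= `|g x|) -> (forall x, f_ k x @[k --> \oo] --> f x) ->
  cvgL2 mu f_ f.
Proof.
move=> mf_ mf [mg ig] fg cf.
have fgx x : `|f x| <= `|g x|.
  have c : `|g x| - `|f_ k x| @[k --> \oo] --> `|g x| - `|f x|.
    by apply: cvgB; [exact: cvg_cst|exact: cvg_norm].
  by rewrite -subr_ge0; apply: (ge_cvgn c) => k; rewrite subr_ge0.
have [|||||_ +] := @Rdominated_convergence _ _ _ mu
  (fun k x => (f_ k x - f x) ^+ 2) (fun=> 0) (fun x => 4 * g x ^+ 2).
- by move=> k; apply: measurable_funX; exact: measurable_funB.
- exact: measurable_cst.
- apply: aeW => x; have c : f_ k x - f x @[k --> \oo] --> f x - f x.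
    by apply: cvgB; [exact: cf|exact: cvg_cst].
  rewrite subrr in c; rewrite -(mulr0 0); exact: (cvgM c c).
- exact: L1Z.
- move=> k x; rewrite ger0_norm ?sqr_ge0// -(real_normK (num_real (_ - _))).
  rewrite -(real_normK (num_real (g x))).
  have := ler_normB (f_ k x) (f x); have := fg k x; have := fgx x.
  by have := normr_ge0 (f_ k x - f x); nra.
- by rewrite Rintegral0; apply.
Qed.

End cvgL2_dominated.

Section tcont_L2.
Context {R : realType} (n : nat).
Local Notation Rn := 'rV[R]_n.
Local Notation mu := (@lebesgue_rV R n).
Import HBNNSimple.

Lemma tcont0 : @tcont R n (fun=> 0).
Proof.
move=> u _; apply: cvg_near_cst; apply: nearW => k; rewrite /sqn.
by under eq_Rintegral do rewrite subrr expr0n /=; exact: Rintegral0.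
Qed.

Lemma tcont_sum (I : Type) (s : seq I) (F : I -> Rn -> R) :
  (forall i, L2 mu (F i)) -> (forall i, tcont (F i)) ->
  L2 mu (fun x => \sum_(i <- s) F i x) /\ tcont (fun x => \sum_(i <- s) F i x).
Proof.
move=> LF tF; elim: s => [|i s [L t]].
  rewrite (_ : (fun x => _) = fun=> 0); first by split; [exact: L2_0|exact: tcont0].
  by apply/funext => x; rewrite big_nil.
rewrite (_ : (fun x => _) = fun x => F i x + \sum_(j <- s) F j x); last first.
  by apply/funext => x; rewrite big_cons.
by split; [exact: L2D|exact: tcontD].
Qed.

Lemma tcont_nnsfun (h : {nnsfun Rn >-> R}) c r :
  L2 mu (fun x => h x * \1_(ball c r) x) /\ tcont (fun x => h x * \1_(ball c r) x).
Proof.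
have mh y : measurable (h @^-1` [set y]) by exact: measurable_sfunP.
rewrite (_ : (fun x => _) = fun x => \sum_(y <- finmap.enum_fset (fset_set (range h)))
    y * \1_(h @^-1` [set y] `&` ball c r) x); last first.
  apply/funext => x; rewrite [h x]fimfunE fsbig_finite//= mulr_suml.
  by apply: eq_bigr => y _; rewrite -mulrA !indicE in_setI -natrM mulnb.
have L y : L2 mu \1_(h @^-1` [set y] `&` ball c r).
  apply: L2_indic; first by apply: measurableI => //; exact: measurable_ball_rV.
  apply: (le_lt_trans _ (ball_lty c r)); apply: le_measure; rewrite ?inE//.
    by apply: measurableI => //; exact: measurable_ball_rV.
  exact: measurable_ball_rV.
by apply: tcont_sum => y; [exact: L2Z|apply: tcontZ => //; exact: tcont_measurable].
Qed.

Lemma cvg_indic_ball (x : Rn) : \1_(ball 0 k%:R) x @[k --> \oo] --> (1 : R).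
Proof.
apply: cvg_near_cst; exists (Num.truncn `|x|).+1 => // k /= xk.
rewrite indicE mem_set// mx_norm_ball /ball_ /= sub0r normrN.
by rewrite (lt_le_trans (truncnS_gt _))// ler_nat.
Qed.

(** A nonnegative function is the L^2 limit of simple functions cut off to balls; the general case
    follows by positive and negative parts. *)
Lemma tcont_L2 (f : Rn -> R) : L2 mu f -> tcont f.
Proof.
have nonneg (g : Rn -> R) : L2 mu g -> (forall x, 0 <= g x) -> tcont g.
  move=> Lg g0; have mg := L2_measurable Lg.
  have meg : measurable_fun setT (EFin \o g) by exact/measurable_EFinP.
  pose g_ := nnsfun_approx measurableT meg.
  have cg x : g_ k x @[k --> \oo] --> g x.
    have /fine_cvg := @cvg_nnsfun_approx _ _ _ _ measurableT _ meg
      (fun y _ => g0 y) x Logic.I.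
    exact.
  have gle k x : g_ k x <= g x.
    have nd : nondecreasing_seq (g_ ^~ x).
      by move=> a b ab; exact/lefP/nd_nnsfun_approx.
    by rewrite -(cvg_lim _ (cg x))//; apply: nondecreasing_cvgn_le => //; apply/cvg_ex; exists (g x).
  apply: (@tcont_closed _ _ (fun k x => g_ k x * \1_(ball 0 k%:R) x)) => //.
  - by move=> k; exact: (tcont_nnsfun _ _ _).1.
  - by move=> k; exact: (tcont_nnsfun _ _ _).2.
  apply: (@cvgL2_dominated _ _ _ mu _ _ g) => //.
  - by move=> k; apply: L2_measurable; exact: (tcont_nnsfun _ _ _).1.
  - move=> k x; rewrite normrM !ger0_norm// indicE.
    by case: (_ \in _); rewrite ?mulr1 ?mulr0.
  - move=> x; rewrite -[X in _ --> X]mulr1; apply: cvgM => //; exact: cvg_indic_ball.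
move=> Lf; have mf := L2_measurable Lf.
have Lp : L2 mu (f ^\+).
  apply: (L2_le _ Lf); first exact: measurable_funrpos.
  by move=> x; rewrite /funrpos ger0_norm ?le_max ?lexx ?orbT// ge_max normr_ge0 ler_norm.
have Ln : L2 mu (f ^\-).
  apply: (L2_le _ Lf); first exact: measurable_funrneg.
  move=> x; rewrite /funrneg ger0_norm ?le_max ?lexx ?orbT// ge_max normr_ge0 andbT.
  by rewrite -normrN ler_norm.
rewrite (_ : f = fun x => f^\+ x + (-1) * f^\- x); last first.
  by apply/funext => x; rewrite mulN1r -[in LHS](funrposBneg f).
apply: tcontD => //; first exact: L2Z.
- by apply: nonneg => // x; rewrite le_max lexx orbT.
- by apply: tcontZ => //; apply: nonneg => // x; rewrite le_max lexx orbT.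
Qed.

End tcont_L2.

(** * The Hartley transform *)

Section hartley.
Context {R : realType} (n : nat).
Local Notation Rn := 'rV[R]_n.
Local Notation mu := (@lebesgue_rV R n).
Implicit Types f g h : Rn -> R.

Definition cas (a : R) : R := cos a + sin a.

Lemma cas_le2 a : `|cas a| <= 2.
Proof.
rewrite (le_trans (ler_normD _ _))//.
by have := cos_max a; have := sin_max a; lra.
Qed.

(** The second term is [sin (a + b)], written as a cosine with a phase: the form integrated by
    [gauss_cos_phaseV]. *)
Lemma casM a b : cas a * cas b = cos (a - b) + cos (a + b - pi / 2).
Proof. by rewrite /cas cosB [cos (_ - pi / 2)]cosB cos_pihalf sin_pihalf sinD; ring. Qed.

Lemma continuous_cas : continuous cas.
Proof. by move=> x; apply: cvgD; [exact: continuous_cos|exact: continuous_sin]. Qed.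

Lemma measurable_cas d (T : measurableType d) (F : T -> R) :
  measurable_fun setT F -> measurable_fun setT (fun x => cas (F x)).
Proof.
apply: measurableT_comp; exact: (continuous_measurable_fun continuous_cas).
Qed.

Lemma measurable_cas_dotv (xi : Rn) :
  measurable_fun setT (fun x : Rn => cas (dotv x xi)).
Proof. by apply: measurable_cas; apply: measurable_dotv. Qed.

Definition hartley f (xi : Rn) : R := \int[mu]_x (f x * cas (dotv x xi)).

Lemma L1_cas f xi : L1 mu f -> L1 mu (fun x => f x * cas (dotv x xi)).
Proof.
by move=> if_; apply: (L1_boundedM (k := 2)) => //;
  [exact: measurable_cas_dotv|move=> x; exact: cas_le2].
Qed.

Lemma hartleyD f g xi : L1 mu f -> L1 mu g ->
  hartley (fun x => f x + g x) xi = hartley f xi + hartley g xi.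
Proof.
move=> if_ ig; rewrite /hartley -RintegralTD; [|exact: L1_cas..].
by apply: eq_Rintegral => x _; rewrite mulrDl.
Qed.

Lemma hartleyZ c f xi : L1 mu f -> hartley (fun x => c * f x) xi = c * hartley f xi.
Proof.
move=> if_; rewrite /hartley -RintegralTZ; last exact: L1_cas.
by apply: eq_Rintegral => x _; rewrite mulrA.
Qed.

Lemma hartleyB f g xi : L1 mu f -> L1 mu g ->
  hartley (fun x => f x - g x) xi = hartley f xi - hartley g xi.
Proof.
move=> if_ ig; rewrite -[in RHS]mulN1r -hartleyZ// -hartleyD//; last exact: L1Z.
by apply: eq_Rintegral => x _; rewrite mulN1r.
Qed.

Lemma hartley_bound f xi : L1 mu f -> `|hartley f xi| <= 2 * \int[mu]_x `|f x|.
Proof.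
move=> if_; have ic := L1_cas xi if_.
rewrite -RintegralTZ; last exact: L1_norm.
apply: le_trans (le_normr_Rintegral measurableT ic) _.
apply: le_RintegralT; [exact: L1_norm|by apply: L1Z; exact: L1_norm|].
by move=> x; rewrite normrM mulrC ler_wpM2r// cas_le2.
Qed.

Lemma Rfubini_kernel f g (k : Rn * Rn -> R) c : L1 mu f -> L1 mu g ->
  measurable_fun setT k -> (forall z, `|k z| <= c) ->
  [/\ L1 mu (fun x => f x * \int[mu]_y (g y * k (x, y))),
      L1 mu (fun y => g y * \int[mu]_x (f x * k (x, y))) &
  \int[mu]_x (f x * \int[mu]_y (g y * k (x, y))) =
  \int[mu]_y (g y * \int[mu]_x (f x * k (x, y)))].
Proof.
move=> if_ ig mk kc.
have ip : (mu \x mu)%E.-integrable setT (EFin \o (fun z => f z.1 * g z.2 * k z)).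
  exact: (L1_boundedM (L1_prod if_ ig) mk kc).
have ex x : \int[mu]_y (f x * g y * k (x, y)) = f x * \int[mu]_y (g y * k (x, y)).
  rewrite -RintegralTZ; last first.
    by apply: (L1_boundedM (k := c)) => //; exact: measurable_fun_pair2.
  by apply: eq_Rintegral => y _; rewrite mulrA.
have ey y : \int[mu]_x (f x * g y * k (x, y)) = g y * \int[mu]_x (f x * k (x, y)).
  rewrite -RintegralTZ; last first.
    by apply: (L1_boundedM (k := c)) => //; exact: measurable_fun_pair1.
  by apply: eq_Rintegral => x _; rewrite mulrCA mulrA.
have [i1 e1] := Rfubini1 ip; have [i2 e2] := Rfubini2 ip.
split.
- by move: i1; apply: eq_integrable => // x _ /=; rewrite ex.
- by move: i2; apply: eq_integrable => // y _ /=; rewrite ey.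
- transitivity (\int[mu]_x \int[mu]_y (f x * g y * k (x, y))).
    by apply: eq_Rintegral => x _; rewrite ex.
  by rewrite e1 -e2; apply: eq_Rintegral => y _; rewrite ey.
Qed.

Lemma measurable_cas2 : measurable_fun setT (fun z : Rn * Rn => cas (dotv z.1 z.2)).
Proof. by apply: measurable_cas; apply: measurable_dotv. Qed.

Lemma hartley_adj f g : L1 mu f -> L1 mu g ->
  [/\ L1 mu (fun x => f x * hartley g x), L1 mu (fun x => g x * hartley f x) &
  ip mu f (hartley g) = ip mu g (hartley f)].
Proof.
move=> if_ ig.
have [i1 i2 e] := Rfubini_kernel if_ ig measurable_cas2 (fun z => cas_le2 _).
have E x : \int[mu]_y (g y * cas (dotv x y)) = hartley g x.
  by apply: eq_Rintegral => y _; rewrite dotvC.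
split.
- by under eq_fun do rewrite -E.
- exact: i2.
- by rewrite /ip -e; apply: eq_Rintegral => x _; rewrite E.
Qed.

(** Fubini's theorem makes the product of [hartley f] with a Gaussian integrable, hence measurable;
    dividing by the Gaussian gives the claim. *)
Lemma measurable_hartley f : L1 mu f -> measurable_fun setT (hartley f).
Proof.
move=> if_; have iG := @L1_gaussV R n 1 ltr01.
have [_ /L1_measurable m _] := hartley_adj if_ iG.
have -> : hartley f = fun x => expR (1 * dotv x x) * (expR (- (1 * dotv x x)) * hartley f x).
  by apply/funext => x; rewrite mulrA -expRD addrN expR0 mul1r.
apply: measurable_funM => //; apply: measurableT_comp; first exact: measurable_expR.
by apply: measurable_funM => //; apply: measurable_dotv.
Qed.

(** By [casM] the two kernels give a cosine in [x - y], which integrates to the heat kernel, and one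
    in [x + y] with phase [- pi / 2], which integrates to 0 because [cos (- pi / 2) = 0]. *)
Lemma gauss_cas (t : R) (x y : Rn) : 0 < t ->
  L1 mu (fun xi => expR (- (t * dotv xi xi)) * cas (dotv x xi)) /\
  \int[mu]_xi (expR (- (t * dotv xi xi)) * cas (dotv x xi) * cas (dotv xi y)) =
    heat_kernel t (x - y).
Proof.
move=> t0; split.
  apply: (L1_boundedM (k := 2)); [exact: L1_gaussV| |by move=> z; exact: cas_le2].
  by apply: measurable_cas; apply: measurable_dotv.
have [i1 e1] := @gauss_cos_phaseV R n t (x - y) 0 t0.
have [i2 e2] := @gauss_cos_phaseV R n t (x + y) (- (pi / 2)) t0.
transitivity (\int[mu]_xi (expR (- (t * dotv xi xi)) * cos (dotv (x - y) xi + 0) +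
   expR (- (t * dotv xi xi)) * cos (dotv (x + y) xi + - (pi / 2)))).
  apply: eq_Rintegral => z _.
  by rewrite -mulrA casM [dotv z y]dotvC [dotv (x - y) z]dotvBl [dotv (x + y) z]dotvDl -mulrDr addr0.
by rewrite RintegralTD// e1 e2 cosN cos_pihalf cos0 mulr0 addr0 mulr1.
Qed.

Lemma measurable_heat_kernel t : measurable_fun setT (@heat_kernel R n t).
Proof.
apply: measurable_funM => //; apply: measurableT_comp; first exact: measurable_expR.
apply: measurable_funN; apply: measurable_funM => //.
by apply: measurable_dotv.
Qed.

Lemma heat_kernel_le t (z : Rn) : 0 < t -> `|heat_kernel t z| <= Num.sqrt (pi / t) ^+ n.
Proof.
move=> t0; rewrite ger0_norm ?heat_kernel_ge0// -[leRHS]mulr1.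
apply: ler_wpM2l; first by rewrite exprn_ge0// sqrtr_ge0.
by rewrite -expR0 ler_expR oppr_le0 divr_ge0 ?dotv_ge0// mulr_ge0// ltW.
Qed.

(** The frequency and space forms of the heat pairing of [f] and [g]. Moving one transform across
    with [hartley_adj] leaves the transform of a Gaussian times [cas], which is a translated heat
    kernel. *)
Lemma hartley_gauss (t : R) f g : 0 < t -> L1 mu f -> L1 mu g ->
  L1 mu (fun xi => expR (- (t * dotv xi xi)) * (hartley f xi * hartley g xi)) /\
  \int[mu]_xi (expR (- (t * dotv xi xi)) * (hartley f xi * hartley g xi)) =
  \int[mu]_x (f x * \int[mu]_y (g y * heat_kernel t (x - y))).
Proof.
move=> t0 if_ ig.
have iHg : L1 mu (fun xi => expR (- (t * dotv xi xi)) * hartley g xi).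
  apply: (L1_boundedM (k := 2 * \int[mu]_x `|g x|)).
  - exact: L1_gaussV.
  - exact: measurable_hartley.
  - by move=> x; exact: hartley_bound.
have [_ i2 e2] := hartley_adj if_ iHg.
split; first by move: i2; apply: eq_integrable => // x _ /=; rewrite -mulrA [hartley g x * _]mulrC.
transitivity (ip mu (fun xi => expR (- (t * dotv xi xi)) * hartley g xi) (hartley f)).
  by apply: eq_Rintegral => x _; rewrite -mulrA [hartley g x * _]mulrC.
rewrite -e2; apply: eq_Rintegral => x _; congr (_ * _).
have [iG _] := @gauss_cas t x 0 t0.
have [_ _] := hartley_adj iG ig; rewrite /ip => H.
transitivity (\int[mu]_x0 (expR (- (t * dotv x0 x0)) * cas (dotv x x0) * hartley g x0)).
  by apply: eq_Rintegral => y _; rewrite [dotv y x]dotvC mulrAC.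
rewrite H; apply: eq_Rintegral => y _; congr (_ * _).
by rewrite -(gauss_cas x y t0).2; apply: eq_Rintegral => z _.
Qed.

(** * Plancherel's theorem for functions in both L^1 and L^2 *)

Section plancherel_L1.
Variables (f : Rn -> R).
Hypotheses (f1 : L1 mu f) (f2 : L2 mu f).

Definition autocorr (u : Rn) : R := ip mu f (fun x => f (x + u)).

(* As [s -> 0], the right-hand side tends to [(2 pi)^n |f|^2] by continuity of translations. *)
Lemma hartley_gauss_autocorr (s : R) : 0 < s ->
  L1 mu (fun v => heat_kernel 1 v * autocorr (s *: v)) /\
  \int[mu]_xi (expR (- (s ^+ 2 * dotv xi xi)) * (hartley f xi * hartley f xi)) =
  \int[mu]_v (heat_kernel 1 v * autocorr (s *: v)).
Proof.
move=> s0; have t0 : 0 < s ^+ 2 by rewrite exprn_gt0.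
have mf := L1_measurable f1.
(* The substitution [y = x + s v] turns the kernel at time [s^2] into the one at time 1, so that the
   small parameter sits only in the translation of [f]. *)
have scale (v : Rn) : s ^+ n * heat_kernel (s ^+ 2) (- (s *: v)) = heat_kernel 1 v.
  rewrite /heat_kernel mulrA -exprMn dotvNl dotvNr opprK dotvZl dotvZr.
  rewrite sqrtrM ?pi_ge0// sqrtrV ?ltW// sqrtr_sqr gtr0_norm//.
  congr (_ ^+ _ * expR (- _)); last by field; rewrite gt_eqF.
  by rewrite divr1; field; rewrite gt_eqF.
have inner x : L1 mu (fun v => f (x + s *: v) * heat_kernel 1 v) /\
    \int[mu]_y (f y * heat_kernel (s ^+ 2) (x - y)) =
    \int[mu]_v (f (x + s *: v) * heat_kernel 1 v).
  have iF : L1 mu (fun y => f y * heat_kernel (s ^+ 2) (x - y)).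
    apply: (L1_boundedM f1 _ (fun y => heat_kernel_le (x - y) t0)).
    apply: measurableT_comp; first exact: measurable_heat_kernel.
    have := measurable_affine_rV (-1) x.
    by under [X in measurable_fun _ X -> _]eq_fun do rewrite scaleN1r addrC.
  have [iS ->] := L1_affine x (lt0r_neq0 s0) iF.
  have E v : s ^+ n * (f (s *: v + x) * heat_kernel (s ^+ 2) (x - (s *: v + x))) =
      f (x + s *: v) * heat_kernel 1 v.
    by rewrite mulrCA addrC opprD addrA subrr add0r scale.
  rewrite gtr0_norm// -RintegralTZ//; split.
    by have := L1Z (s ^+ n) iS; apply: eq_integrable => // v _ /=; rewrite E.
  by apply: eq_Rintegral => v _; rewrite E.
have maff : measurable_fun setT (fun z : Rn * Rn => z.1 + s *: z.2).
  apply: measurable_fun_rV => i; under eq_fun do rewrite !mxE.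
  apply: measurable_funD.
    exact: (measurableT_comp (measurable_coord i) measurable_fst).
  apply: measurable_funM => //.
  exact: (measurableT_comp (measurable_coord i) measurable_snd).
have mF : measurable_fun setT (fun z : Rn * Rn => f z.1 * (f (z.1 + s *: z.2) * heat_kernel 1 z.2)).
  apply: measurable_funM; first exact: (measurableT_comp mf measurable_fst).
  apply: measurable_funM; first exact: (measurableT_comp mf maff).
  exact: (measurableT_comp (measurable_heat_kernel 1) measurable_snd).
have [iK mK] := @heat_kernel_mass R n 1 ltr01.
have ffs u : L1 mu (fun x => f x * f (x + u)) by apply: L2_L1M => //; exact: L2_shift.
have ip_ : (mu \x mu)%E.-integrable setT
    (EFin \o (fun z : Rn * Rn => f z.1 * (f (z.1 + s *: z.2) * heat_kernel 1 z.2))).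
  apply/integrable21ltyP; first exact/measurable_EFinP.
  (* By [|a b| <= (a^2 + b^2) / 2] and translation invariance, the integral in [x] of the absolute
     value is at most [heat_kernel 1 v] times [|f|^2]. *)
  apply: (@le_lt_trans _ _ (\int[mu]_v (heat_kernel 1 v * sqn mu f)%:E)%E); last first.
    have : L1 mu (fun v => heat_kernel 1 v * sqn mu f).
      by under [X in L1 _ X]eq_fun do rewrite mulrC; exact: L1Z.
    by move=> /integral_fune_lt_pinfty; exact.
  apply: ge0_le_integral => //.
  - by move=> v _; exact: integral_ge0.
  - apply: (measurable_fun_fubini_tonelli_G (abse \o (EFin \o
      (fun z : Rn * Rn => f z.1 * (f (z.1 + s *: z.2) * heat_kernel 1 z.2))))) => //=.
    by apply: measurableT_comp => //; exact/measurable_EFinP.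
  - apply/measurable_EFinP; apply: measurable_funM => //; exact: measurable_heat_kernel.
  move=> v _.
  have b x : `|f x * (f (x + s *: v) * heat_kernel 1 v)| <=
      heat_kernel 1 v / 2 * f x ^+ 2 + heat_kernel 1 v / 2 * f (x + s *: v) ^+ 2.
    rewrite mulrA normrM (ger0_norm (heat_kernel_ge0 _ _)) mulrC -mulrDr -mulrA.
    apply: ler_wpM2l; first exact: heat_kernel_ge0.
    by rewrite ler_norml; apply/andP; split;
      [have := sqr_ge0 (f x + f (x + s *: v))|have := sqr_ge0 (f x - f (x + s *: v))]; nra.
  have iR : L1 mu (fun x => heat_kernel 1 v / 2 * f x ^+ 2 + heat_kernel 1 v / 2 * f (x + s *: v) ^+ 2).
    by apply: L1D; apply: L1Z; [case: f2|case: (L2_shift (s *: v) f2)].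
  have -> : heat_kernel 1 v * sqn mu f = \int[mu]_x (heat_kernel 1 v / 2 * f x ^+ 2 +
      heat_kernel 1 v / 2 * f (x + s *: v) ^+ 2).
    have i1 : L1 mu (fun x => f x ^+ 2) by case: f2.
    have i2 : L1 mu (fun x => f (x + s *: v) ^+ 2) by case: (L2_shift (s *: v) f2).
    rewrite RintegralTD; [|exact: L1Z..].
    rewrite !RintegralTZ// -[X in _ + _ * X]/(sqn mu (fun x => f (x + s *: v))) sqn_shift//.
    by rewrite -/(sqn mu f); field.
  rewrite Rintegral_EFin//; apply: ge0_le_integral => //.
  - apply/measurable_EFinP; apply: measurableT_comp => //.
    exact: (measurable_fun_pair1 v mF).
  - by apply/measurable_EFinP; exact: L1_measurable iR.
  - by move=> x _; rewrite lee_fin.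
have [_ e1] := Rfubini1 ip_; have [i2 e2] := Rfubini2 ip_.
have E v : \int[mu]_x (f x * (f (x + s *: v) * heat_kernel 1 v)) =
    heat_kernel 1 v * autocorr (s *: v).
  rewrite /autocorr /ip -RintegralTZ//.
  by apply: eq_Rintegral => x _; rewrite mulrA mulrC.
split; first by move: i2; apply: eq_integrable => // v _ /=; rewrite E.
rewrite (hartley_gauss t0 f1 f1).2.
transitivity (\int[mu]_x \int[mu]_v (f x * (f (x + s *: v) * heat_kernel 1 v))).
  by apply: eq_Rintegral => x _; rewrite (inner x).2 -RintegralTZ//; exact: (inner x).1.
by rewrite e1 -e2; apply: eq_Rintegral => v _; rewrite E.
Qed.

Lemma autocorr_cvg (v : Rn) :
  autocorr (k.+1%:R^-1 *: v) @[k --> \oo] --> sqn mu f.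
Proof.
have c0 : k.+1%:R^-1 *: v @[k --> \oo] --> (0 : Rn).
  by rewrite -(scale0r v); apply: cvgZr_tmp; exact: cvg_harmonic.
rewrite sqnE; have := cvgL2_ip (fun k => L2_shift (k.+1%:R^-1 *: v) f2) f2 f2 (tcont_L2 f2 c0).
by under eq_fun do rewrite ipC.
Qed.

Lemma autocorr_le u : `|autocorr u| <= sqn mu f.
Proof.
rewrite -ler_sqr ?nnegrE ?sqn_ge0// real_normK ?num_real//.
apply: (le_trans (ip_sqr_le f2 (L2_shift u f2))).
by rewrite sqn_shift// -expr2.
Qed.

(** The Gaussian-damped integrals of [hartley f ^+ 2] are bounded by the expected value, so Fatou's
    lemma puts [hartley f] in L^2. Then [hartley f ^+ 2] itself dominates them, and their limit,
    known from the autocorrelation, is its integral. *)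
Lemma plancherel_L1 : L2 mu (hartley f) /\
  sqn mu (hartley f) = (2 * pi) ^+ n * sqn mu f.
Proof.
pose s k : R := k.+1%:R^-1.
have s0 k : 0 < s k by rewrite invr_gt0.
have [iK mK] := @heat_kernel_mass R n 1 ltr01.
have mH := measurable_hartley f1.
pose g k xi := expR (- (s k ^+ 2 * dotv xi xi)) * (hartley f xi * hartley f xi).
have ig k : L1 mu (g k) by apply: (hartley_gauss _ f1 f1).1; rewrite exprn_gt0.
have g0 k x : 0 <= g k x by rewrite mulr_ge0 ?expR_ge0// -expr2 sqr_ge0.
have cg x : g k x @[k --> \oo] --> hartley f x ^+ 2.
  rewrite -[X in _ --> X]mul1r -expR0; apply: cvgM; last exact: cvg_cst.
  apply: continuous_cvg; first exact: continuous_expR.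
  rewrite -oppr0; apply: cvgN; rewrite -(mul0r (dotv x x)); apply: cvgM; last exact: cvg_cst.
  rewrite -(mul0r 0); apply: cvgM; exact: cvg_harmonic.
have lim : \int[mu]_x g k x @[k --> \oo] --> (2 * pi) ^+ n * sqn mu f.
  rewrite -mK mulrC -RintegralTZ//.
  have [|||||_ +] := @Rdominated_convergence _ _ _ mu
    (fun k v => heat_kernel 1 v * autocorr (s k *: v))
    (fun v => sqn mu f * heat_kernel 1 v) (fun v => sqn mu f * heat_kernel 1 v).
  - by move=> k; exact: L1_measurable (hartley_gauss_autocorr (s0 k)).1.
  - by apply: measurable_funM => //; exact: measurable_heat_kernel.
  - apply: aeW => v; rewrite mulrC; apply: cvgM; [exact: cvg_cst|exact: autocorr_cvg].
  - exact: L1Z.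
  - move=> k v; rewrite normrM (ger0_norm (heat_kernel_ge0 _ _)) mulrC.
    by apply: ler_wpM2r; [exact: heat_kernel_ge0|exact: autocorr_le].
  apply: cvg_trans; apply: near_eq_cvg; apply: nearW => k.
  by rewrite (hartley_gauss_autocorr (s0 k)).2.
have bnd k : (\int[mu]_x (g k x)%:E <= ((2 * pi) ^+ n * sqn mu f)%:E)%E.
  rewrite -Rintegral_EFin// lee_fin (hartley_gauss_autocorr (s0 k)).2.
  rewrite -mK mulrC -RintegralTZ//; apply: le_RintegralT.
  - exact: (hartley_gauss_autocorr (s0 k)).1.
  - exact: L1Z.
  - move=> v; rewrite mulrC; apply: ler_wpM2r; first exact: heat_kernel_ge0.
    exact: le_trans (ler_norm _) (autocorr_le _).
have mH2 : measurable_fun setT (fun x => hartley f x ^+ 2) by exact: measurable_funX.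
have [i2 _] := @L1_fatou _ _ _ mu g _ _ 0%N (fun k => L1_measurable (ig k)) mH2 g0 cg (fun k _ => bnd k).
split; first by split.
have gle k x : `|g k x| <= hartley f x ^+ 2.
  rewrite ger0_norm// /g -expr2 -[leRHS]mul1r; apply: ler_wpM2r; first exact: sqr_ge0.
  by rewrite -expR0 ler_expR oppr_le0 mulr_ge0 ?dotv_ge0// sqr_ge0.
have [_ c2] := Rdominated_convergence (fun k => L1_measurable (ig k)) mH2
  (aeW _ cg) i2 gle.
by apply: (cvg_unique _ c2 lim).
Qed.

End plancherel_L1.

Lemma plancherel_L1_ip f g : L1 mu f -> L2 mu f -> L1 mu g -> L2 mu g ->
  ip mu (hartley f) (hartley g) = (2 * pi) ^+ n * ip mu f g.
Proof.
move=> f1 f2 g1 g2.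
have [Lf ef] := plancherel_L1 f1 f2; have [Lg eg] := plancherel_L1 g1 g2.
have [_] := plancherel_L1 (L1D f1 g1) (L2D f2 g2).
have -> : sqn mu (hartley (fun x => f x + g x)) = sqn mu (fun x => hartley f x + hartley g x).
  by apply: eq_Rintegral => x _; rewrite hartleyD.
by rewrite !sqnD// ef eg; lra.
Qed.

(** * The Hartley transform on L^2 *)

Definition eball (k : nat) : set Rn := [set x | enorm x <= k%:R].

Lemma measurable_eball k : measurable (eball k).
Proof.
rewrite (_ : eball k = enorm @^-1` `]-oo, k%:R]%classic).
  by have := @measurable_enorm R n measurableT _ (measurable_itv `]-oo, k%:R]); rewrite setTI.
by apply/seteqP; split => x /=; rewrite in_itv.
Qed.

Lemma eball_lty k : (mu (eball k) < +oo)%E.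
Proof.
apply: (le_lt_trans _ (ball_lty (0 : Rn) k.+1%:R)); apply: le_measure; rewrite ?inE.
- exact: measurable_eball.
- exact: measurable_ball_rV.
- move=> x xk; rewrite mx_norm_ball /ball_ /= sub0r normrN.
  by rewrite (le_lt_trans (norm_le_enorm x))// (le_lt_trans xk)// ltr_nat.
Qed.

Definition trunc (k : nat) f x := f x * \1_(eball k) x.

Lemma trunc_le k f x : `|trunc k f x| <= `|f x|.
Proof.
by rewrite /trunc normrM indicE; case: (_ \in _); rewrite ?normr1 ?mulr1 ?normr0 ?mulr0.
Qed.

Lemma measurable_trunc k f : measurable_fun setT f -> measurable_fun setT (trunc k f).
Proof.
by move=> mf; apply: measurable_funM => //; apply: measurable_indic; exact: measurable_eball.
Qed.

Lemma L2_trunc k f : L2 mu f -> L2 mu (trunc k f).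
Proof.
by move=> Lf; apply: (L2_le _ Lf); [apply: measurable_trunc; exact: L2_measurable Lf|exact: trunc_le].
Qed.

Lemma L1_trunc k f : L2 mu f -> L1 mu (trunc k f).
Proof.
move=> Lf; apply: L2_L1M => //; apply: L2_indic; [exact: measurable_eball|exact: eball_lty].
Qed.

Lemma trunc_cvg f x : trunc k f x @[k --> \oo] --> f x.
Proof.
apply: cvg_near_cst; exists (Num.truncn (enorm x)).+1 => // k /= xk.
rewrite /trunc indicE mem_set ?mulr1//= /eball /=.
by rewrite (le_trans (ltW (truncnS_gt _)))// ler_nat.
Qed.

Lemma trunc_cvgL2 f : L2 mu f -> cvgL2 mu (fun k => trunc k f) f.
Proof.
move=> Lf; apply: (cvgL2_dominated _ _ Lf).
- by move=> k; apply: measurable_trunc; exact: L2_measurable Lf.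
- exact: L2_measurable Lf.
- by move=> k x; exact: trunc_le.
- exact: trunc_cvg.
Qed.

(** A relation, because the extension to L^2 is determined only almost everywhere. The truncations
    are to Euclidean balls, as in [fourier_trunc], so that the two transforms can be compared. *)
Definition is_hartley f h := L2 mu h /\ cvgL2 mu (fun k => hartley (trunc k f)) h.

Local Notation C := ((2 * pi) ^+ n : R).

Lemma hartley_const_gt0 : 0 < C.
Proof. by rewrite exprn_gt0// mulr_gt0// pi_gt0. Qed.

Lemma L2_hartley_trunc k f : L2 mu f -> L2 mu (hartley (trunc k f)).
Proof. by move=> Lf; apply: (plancherel_L1 (L1_trunc k Lf) (L2_trunc k Lf)).1. Qed.

Lemma sqn_hartleyB f g : L1 mu f -> L2 mu f -> L1 mu g -> L2 mu g ->
  sqn mu (fun x => hartley f x - hartley g x) = C * sqn mu (fun x => f x - g x).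
Proof.
move=> f1 f2 g1 g2; rewrite -(plancherel_L1 (L1B f1 g1) (L2B f2 g2)).2.
by apply: eq_Rintegral => x _; rewrite hartleyB.
Qed.

Lemma is_hartley_ex f : L2 mu f -> exists h, is_hartley f h.
Proof.
move=> Lf; have Lt k := L2_trunc k Lf; have L1t k := L1_trunc k Lf.
have [|h Lh ch] := L2_complete (fun k => L2_hartley_trunc k Lf); last by exists h.
move=> e e0; have C0 := hartley_const_gt0.
have := trunc_cvgL2 Lf => /cvgrPdist_lt /(_ (e / (4 * C))).
rewrite divr_gt0 ?mulr_gt0// => /(_ isT)[K _ KP]; exists K => k l kK lK.
rewrite sqn_hartleyB//.
have := KP k kK; have := KP l lK.
rewrite /= !sub0r !normrN !ger0_norm ?sqn_ge0// !ltr_pdivlMr ?mulr_gt0//.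
have := sqn_tri (Lt k) Lf (Lt l); rewrite [X in _ <= _ + 2 * X]sqnBC.
move=> H /ltW a /ltW b.
have : C * sqn mu (fun x => trunc k f x - trunc l f x) <=
  C * (2 * sqn mu (fun x => trunc k f x - f x) + 2 * sqn mu (fun x => trunc l f x - f x)).
  by rewrite ler_pM2l.
lra.
Qed.

Lemma is_hartley_unique f h1 h2 : L2 mu f -> is_hartley f h1 -> is_hartley f h2 ->
  {ae mu, forall x, h1 x = h2 x}.
Proof.
move=> Lf [L1_ c1] [L2_ c2].
exact: (cvgL2_unique (fun k => L2_hartley_trunc k Lf) L1_ L2_ c1 c2).
Qed.

Lemma is_hartley_aer f h1 h2 : is_hartley f h1 -> measurable_fun setT h2 ->
  {ae mu, forall x, h1 x = h2 x} -> is_hartley f h2.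
Proof.
move=> [Lh c] mh2 E; split; first exact: L2_ae_eq Lh E.
apply: cvg_trans c; apply: near_eq_cvg; apply: nearW => k; apply: sqn_ae.
by apply: filterS E => x ->.
Qed.

Lemma hartley_ae f g : {ae mu, forall x, f x = g x} -> hartley f =1 hartley g.
Proof. by move=> E xi; apply: ae_eq_RintegralT; apply: filterS E => x ->. Qed.

Lemma is_hartley_ael f g h : is_hartley f h -> {ae mu, forall x, f x = g x} ->
  is_hartley g h.
Proof.
move=> [Lh c] E; split; first exact: Lh.
have e : (fun k => hartley (trunc k g)) = (fun k => hartley (trunc k f)).
  apply/funext => k; apply/funext => xi; apply: hartley_ae.
  by apply: filterS E => y; rewrite /trunc => ->.
by rewrite e.
Qed.

Lemma is_hartley_sqn f h : L2 mu f -> is_hartley f h -> sqn mu h = C * sqn mu f.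
Proof.
move=> Lf [Lh c].
have c1 := cvgL2_sqn (fun k => L2_hartley_trunc k Lf) Lh c.
have c2 : C * sqn mu (trunc k f) @[k --> \oo] --> C * sqn mu f.
  apply: cvgM; first exact: cvg_cst.
  exact: cvgL2_sqn (fun k => L2_trunc k Lf) Lf (trunc_cvgL2 Lf).
apply: (cvg_unique _ c1); first by [].
apply: cvg_trans c2; apply: near_eq_cvg; apply: nearW => k /=.
by rewrite (plancherel_L1 (L1_trunc k Lf) (L2_trunc k Lf)).2.
Qed.

Lemma is_hartley_lin a b f g F G : L2 mu f -> L2 mu g ->
  is_hartley f F -> is_hartley g G ->
  is_hartley (fun x => a * f x + b * g x) (fun x => a * F x + b * G x).
Proof.
move=> Lf Lg [LF cF] [LG cG]; split; first by apply: L2D; exact: L2Z.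
pose B k := 2 * (a ^+ 2 * sqn mu (fun x => hartley (trunc k f) x - F x)) +
  2 * (b ^+ 2 * sqn mu (fun x => hartley (trunc k g) x - G x)).
apply: (@squeeze_cvgr _ _ _ _ (cst 0)); last first.
- have : B k @[k --> \oo] --> 2 * (a ^+ 2 * 0) + 2 * (b ^+ 2 * 0).
    by apply: cvgD; apply: cvgM; try exact: cvg_cst; apply: cvgM => //; exact: cvg_cst.
  by rewrite !mulr0 addr0; exact.
- exact: cvg_cst.
apply: nearW => k; rewrite sqn_ge0 /=.
have LA := L2B (L2_hartley_trunc k Lf) LF; have LB := L2B (L2_hartley_trunc k Lg) LG.
rewrite /B -!sqnZ//; apply: le_trans (sqn_leD (L2Z a LA) (L2Z b LB)).
rewrite le_eqVlt; apply/orP; left; apply/eqP/eq_Rintegral => x _.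
rewrite (_ : trunc k (fun x => a * f x + b * g x) =
  fun x => a * trunc k f x + b * trunc k g x); last first.
  by apply/funext => y; rewrite /trunc mulrDl !mulrA.
have it := L1_trunc k Lf; have ig := L1_trunc k Lg.
by rewrite hartleyD ?hartleyZ//; [congr (_ ^+ 2); ring|exact: L1Z|exact: L1Z].
Qed.

(** Polarisation of [is_hartley_sqn]. *)
Lemma is_hartley_ip f g F G : L2 mu f -> L2 mu g -> is_hartley f F -> is_hartley g G ->
  ip mu F G = C * ip mu f g.
Proof.
move=> Lf Lg hF hG; have [LF _] := hF; have [LG _] := hG.
have h1 := is_hartley_lin 1 1 Lf Lg hF hG.
have := is_hartley_sqn (L2D (L2Z 1 Lf) (L2Z 1 Lg)) h1.
rewrite !sqnD; [|exact: L2Z..].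
rewrite !sqnZ// !ipZl// ?[ip _ _ (fun x => 1 * _)]ipC ?ipZl//; try exact: L2Z.
rewrite (is_hartley_sqn Lf hF) (is_hartley_sqn Lg hG) [ip _ G F]ipC [ip _ g f]ipC.
by lra.
Qed.

Lemma is_hartley_adj f g F G : L2 mu f -> L2 mu g -> is_hartley f F -> is_hartley g G ->
  ip mu F g = ip mu f G.
Proof.
move=> Lf Lg [LF cF] [LG cG].
have H l : ip mu F (trunc l g) = ip mu f (hartley (trunc l g)).
  have c1 := cvgL2_ip (fun k => L2_hartley_trunc k Lf) LF (L2_trunc l Lg) cF.
  have c2 := cvgL2_ip (fun k => L2_trunc k Lf) Lf (L2_hartley_trunc l Lg) (trunc_cvgL2 Lf).
  apply: (cvg_unique _ c1); first by [].
  apply: cvg_trans c2; apply: near_eq_cvg; apply: nearW => k /=.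
  by have [_ _ ->] := hartley_adj (L1_trunc k Lf) (L1_trunc l Lg); rewrite ipC.
have c1 := cvgL2_ip (fun k => L2_trunc k Lg) Lg LF (trunc_cvgL2 Lg).
have c2 := cvgL2_ip (fun k => L2_hartley_trunc k Lg) LG Lf cG.
rewrite ipC [RHS]ipC; apply: (cvg_unique _ c1); first by [].
apply: cvg_trans c2; apply: near_eq_cvg; apply: nearW => k /=.
by rewrite ipC -H ipC.
Qed.

Lemma is_hartley_L1 f : L1 mu f -> L2 mu f -> is_hartley f (hartley f).
Proof.
move=> f1 f2; split; first exact: (plancherel_L1 f1 f2).1.
rewrite /cvgL2 -[X in _ --> X](mulr0 C); under eq_fun do rewrite (sqn_hartleyB (L1_trunc _ f2) (L2_trunc _ f2) f1 f2).
by apply: cvgM; [exact: cvg_cst|exact: trunc_cvgL2].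
Qed.

(* [hartley] is, up to the factor [C], isometric and self-adjoint, so
   [|H H f - C f|^2 = C^2 |f|^2 - 2 C |H f|^2 + C^2 |f|^2 = 0]. *)
Lemma is_hartley_inv f F : L2 mu f -> is_hartley f F -> is_hartley F (fun x => C * f x).
Proof.
move=> Lf hF; have [LF _] := hF; have [K hK] := is_hartley_ex LF.
have [LK _] := hK.
apply: (is_hartley_aer hK); first exact: L2_measurable (L2Z _ Lf).
apply: sqnB_eq0 => //; first exact: L2Z.
rewrite sqnB//; last exact: L2Z.
rewrite sqnZ// [ip _ K _]ipC ipZl// (is_hartley_sqn LF hK).
have -> : ip mu f K = C * sqn mu f.
  by rewrite -(is_hartley_adj Lf LF hF hK) -sqnE (is_hartley_sqn Lf hF).
by rewrite (is_hartley_sqn Lf hF); ring.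
Qed.

(** By inversion, [C^-1] times a transform of [F] is a preimage of [F]. *)
Lemma is_hartley_surj F : L2 mu F -> exists2 f, L2 mu f & is_hartley f F.
Proof.
move=> LF; have [K hK] := is_hartley_ex LF; have [LK _] := hK.
have C0 := hartley_const_gt0.
exists (fun x => C^-1 * K x); first exact: L2Z.
have := is_hartley_lin C^-1 0 LK LK (is_hartley_inv LF hK) (is_hartley_inv LF hK).
rewrite (_ : (fun x => C^-1 * (C * F x) + _) = F); last first.
  by apply/funext => x; rewrite mul0r addr0 mulrA mulVf ?mul1r// gt_eqF.
by rewrite (_ : (fun x => _ + 0 * K x) = fun x => C^-1 * K x)//; apply/funext => x; rewrite mul0r addr0.
Qed.

End hartley.

(** * Mellin transforms *)

Section mellin.
Context {R : realType}.
Local Notation mu := (@lebesgue_measure R).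

(** Integrand of the Mellin transform of [phi] at [q], extended by 0 to [t <= 0], so that integrals
    run over the whole line and affine changes of variable apply directly. *)
Definition mellin_wt (q : R) (phi : R -> R) (t : R) : R :=
  if 0 < t then t `^ (q - 1) * phi t else 0.

Lemma measurable_mellin_wt q (phi : R -> R) : measurable_fun setT phi ->
  measurable_fun setT (mellin_wt q phi).
Proof.
move=> mphi; apply: measurable_fun_ifT => //.
  by apply: measurable_fun_ltr.
by apply: measurable_funM => //; exact: measurable_powR.
Qed.

Lemma mellin_wt_ge0 q (phi : R -> R) t : (forall t, 0 < t -> 0 <= phi t) ->
  0 <= mellin_wt q phi t.
Proof.
by move=> phi0; rewrite /mellin_wt; case: ltP => // t0; rewrite mulr_ge0 ?powR_ge0 ?phi0.
Qed.

Lemma mellin_scale q (phi : R -> R) (l : R) : 0 < l -> L1 mu (mellin_wt q phi) ->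
  L1 mu (mellin_wt q (fun t => phi (l * t))) /\
  \int[mu]_t mellin_wt q (fun t => phi (l * t)) t =
    l `^ (- q) * \int[mu]_t mellin_wt q phi t.
Proof.
move=> l0 iphi.
have E t : mellin_wt q (fun t => phi (l * t)) t =
    l `^ (1 - q) * mellin_wt q phi (l * t + 0).
  rewrite /mellin_wt addr0 pmulr_rgt0//; case: ltP => t0; last by rewrite mulr0.
  rewrite powRM ?ltW// mulrA; congr (_ * _).
  rewrite mulrA -powRD; last by apply/implyP; rewrite (gt_eqF l0).
  by rewrite (_ : 1 - q + (q - 1) = 0) ?powRr0 ?mul1r//; lra.
have [iS eS] := L1_affineR 0 (lt0r_neq0 l0) iphi.
split; first by have := L1Z (l `^ (1 - q)) iS; apply: eq_integrable => // t _ /=; rewrite E.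
under eq_Rintegral do rewrite E.
rewrite (RintegralTZ _ iS) eS (gtr0_norm l0) mulrA; congr (_ * _).
rewrite powRD ?powRr1 ?(ltW l0)//; last by apply/implyP; rewrite (gt_eqF l0).
by rewrite mulrC.
Qed.

Lemma mellin_fubini d (X : measurableType d) (nu : {sigma_finite_measure set X -> \bar R})
    q (phi : R -> R) (lam Phi : X -> R) :
  measurable_fun setT phi -> (forall t, 0 < t -> 0 <= phi t) ->
  L1 mu (mellin_wt q phi) ->
  measurable_fun setT lam -> measurable_fun setT Phi ->
  (forall x, Phi x != 0 -> 0 < lam x) ->
  L1 nu (fun x => lam x `^ (- q) * Phi x) ->
  \int[mu]_t \int[nu]_x (mellin_wt q (fun t => phi (lam x * t)) t * Phi x) =
  (\int[mu]_t mellin_wt q phi t) * \int[nu]_x (lam x `^ (- q) * Phi x).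
Proof.
move=> mphi phi0 iphi mlam mPhi Phil iPhi.
pose F (z : X * measurableTypeR R) : R := mellin_wt q (fun t => phi (lam z.1 * t)) z.2 * Phi z.1.
have mF : measurable_fun setT F.
  apply: measurable_funM; last exact: (measurableT_comp mPhi measurable_fst).
  have m2 : measurable_fun setT (fun z : X * measurableTypeR R => z.2 : R) by exact: measurable_snd.
  apply: measurable_fun_ifT => //.
    by apply: measurable_fun_ltr.
  apply: measurable_funM; first exact: (measurableT_comp (measurable_powR (q - 1)) m2).
  apply: (measurableT_comp mphi); apply: measurable_funM => //.
  exact: (measurableT_comp mlam measurable_fst).
have S x : L1 mu (fun t => F (x, t)) /\ \int[mu]_t F (x, t) =
    (\int[mu]_t mellin_wt q phi t) * (lam x `^ (- q) * Phi x).
  have [Phix|Phix] := eqVneq (Phi x) 0.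
    have F0 t : F (x, t) = 0 by rewrite /F /= Phix mulr0.
    split; first by under [X in L1 _ X]eq_fun do rewrite F0; exact: L1_0.
    by rewrite Phix !mulr0; under eq_Rintegral do rewrite F0; rewrite Rintegral0.
  have [i e] := mellin_scale (Phil x Phix) iphi.
  split; first by have := L1Z (Phi x) i; apply: eq_integrable => // t _ /=; rewrite mulrC.
  rewrite -[LHS](_ : Phi x * \int[mu]_t mellin_wt q (fun t => phi (lam x * t)) t = _).
    by rewrite e; ring.
  by rewrite -RintegralTZ//; apply: eq_Rintegral => t _; rewrite mulrC.
have Sn x : \int[mu]_t `|F (x, t)| =
    (\int[mu]_t mellin_wt q phi t) * (lam x `^ (- q) * `|Phi x|).
  have [Phix|Phix] := eqVneq (Phi x) 0.
    have F0 t : F (x, t) = 0 by rewrite /F /= Phix mulr0.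
    by rewrite Phix normr0 !mulr0; under eq_Rintegral do rewrite F0 normr0; rewrite Rintegral0.
  have [i e] := mellin_scale (Phil x Phix) iphi.
  rewrite -[LHS](_ : `|Phi x| * \int[mu]_t mellin_wt q (fun t => phi (lam x * t)) t = _).
    by rewrite e; ring.
  rewrite -RintegralTZ//; apply: eq_Rintegral => t _; rewrite mulrC normrM; congr (_ * _).
  rewrite ger0_norm//; apply: mellin_wt_ge0 => u u0; apply: phi0.
  by rewrite mulr_gt0// Phil.
have iF : (nu \x mu)%E.-integrable setT (EFin \o F).
  apply/integrable12ltyP; first exact/measurable_EFinP.
  have : L1 nu (fun x => (\int[mu]_t mellin_wt q phi t) * (lam x `^ (- q) * `|Phi x|)).
    apply: L1Z; have := L1_norm iPhi; apply: eq_integrable => // x _ /=.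
    by rewrite normrM ger0_norm ?powR_ge0.
  move=> /(integral_fune_lt_pinfty measurableT); apply: le_lt_trans.
  rewrite le_eqVlt; apply/orP; left; apply/eqP.
  apply: eq_integral => x _; rewrite /= -Sn.
  by rewrite Rintegral_EFin//; apply: L1_norm; exact: (S x).1.
have [_ e1] := Rfubini1 iF; have [_ e2] := Rfubini2 iF.
rewrite e2 -e1 -RintegralTZ//.
by apply: eq_Rintegral => x _; rewrite (S x).2.
Qed.

Lemma Rintegral_gt0 (f : R -> R) : L1 mu f -> (forall x, 0 <= f x) ->
  (forall x, 0 < x -> 0 < f x) -> 0 < \int[mu]_x f x.
Proof.
move=> if_ f0 fpos; rewrite lt0r; apply/andP; split; last exact: Rintegral_ge0.
apply/negP => /eqP /(ge0_ae0 if_ f0) [N [mN N0 sN]].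
have : (mu `]0%R, 1%R[%classic <= mu N)%E.
  apply: le_measure; rewrite ?inE// => x /=; rewrite in_itv/= => /andP[x0 _].
  by apply: sN => /=; apply/eqP; rewrite gt_eqF// fpos.
by rewrite N0 lebesgue_measure_itv/= lte_fin ltr01 -EFinD lee_fin; lra.
Qed.

Lemma integral_powR_itv (p a b : R) : 0 < a -> a < b -> p + 1 != 0 ->
  (\int[mu]_(t in `[a, b]) (t `^ p)%:E = ((b `^ (p + 1) - a `^ (p + 1)) / (p + 1))%:E)%E.
Proof.
move=> a0 ab p1.
have d (t : R) : 0 < t -> is_derive t 1 (fun t => (p + 1)^-1 * t `^ (p + 1)) (t `^ p).
  move=> t0; have tin : t \in `]0, +oo[ by rewrite in_itv/= t0.
  have D : derivable (fun t : R => t `^ (p + 1)) t 1 by apply: derivable_powR.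
  have Dc := @derivable_cst R R^o R (p + 1)^-1 t 1.
  apply: DeriveDef; first exact: (derivableM Dc D).
  rewrite (deriveM Dc D) derive_cst scaler0 addr0 -derive1E powR_derive1//.
  by rewrite addrK /GRing.scale /= mulrA mulVf ?mul1r.
have c (t : R) : 0 < t -> {for t, continuous (fun t => (p + 1)^-1 * t `^ (p + 1))}.
  by move=> t0; apply: differentiable_continuous; apply/derivable1_diffP; have [] := d t t0.
have cp (t : R) : 0 < t -> {for t, continuous (fun t => t `^ p)}.
  move=> t0; apply: differentiable_continuous; apply/derivable1_diffP.
  by apply: derivable_powR; rewrite in_itv/= t0.
rewrite (@continuous_FTC2 _ _ (fun t => (p + 1)^-1 * t `^ (p + 1))) //.
- by rewrite -EFinB; congr EFin; field.
- apply: continuous_in_subspaceT => x; rewrite inE/= in_itv/= => /andP[ax _].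
  by apply: cp; apply: lt_le_trans ax.
- split.
  + by move=> x; rewrite in_itv/= => /andP[ax _]; have [] := d x (lt_trans a0 ax).
  + by apply: cvg_at_right_filter; exact: c.
  + by apply: cvg_at_left_filter; apply: c; exact: lt_trans ab.
- move=> x; rewrite in_itv/= => /andP[ax _].
  by rewrite derive1E; apply: (@derive_val _ _ _ _ _ _ _ (d x (lt_trans a0 ax))).
Qed.

(** An improper integral: the power is integrated exactly over segments exhausting [A], and the
    uniform bound passes to the limit by Fatou's lemma. *)
Lemma L1_powR_fatou (p e : R) (A : set R) (a b : nat -> R) : measurable A ->
  (forall k, 0 < a k < b k) -> p + 1 != 0 ->
  (forall x, \1_(`[a k, b k]%classic) x @[k --> \oo] --> (\1_A x : R)) ->
  (forall k, (b k `^ (p + 1) - a k `^ (p + 1)) / (p + 1) <= e) ->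
  L1 mu (fun t => t `^ p * \1_A t).
Proof.
move=> mA ab p1 cA be.
have mp : measurable_fun setT (fun t : R => t `^ p) by exact: measurable_powR.
apply: (@L1_fatou _ (measurableTypeR R) R mu (fun k t => t `^ p * \1_(`[a k, b k]%classic) t) _ e 0%N _ _ _ _ _).1.
- by move=> k; apply: measurable_funM => //; exact: measurable_indic.
- by apply: measurable_funM => //; exact: measurable_indic.
- by move=> k x; rewrite mulr_ge0 ?powR_ge0// indicE.
- by move=> x; apply: cvgM => //; exact: cvg_cst.
- move=> k _; have /andP[a0 abk] := ab k.
  rewrite (_ : integral _ _ _ = \int[mu]_(t in `[a k, b k]) (t `^ p)%:E)%E.
    by rewrite integral_powR_itv// lee_fin.
  rewrite [RHS]integral_mkcond; apply: eq_integral => x _.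
  by rewrite patchE indicE; case: (_ \in _); rewrite ?mulr1 ?mulr0.
Qed.

Lemma L1_powR_unit (p : R) : -1 < p -> L1 mu (fun t => t `^ p * \1_(`]0, 1]%classic) t).
Proof.
move=> p1; have p10 : 0 < p + 1 by lra.
apply: (@L1_powR_fatou p (p + 1)^-1 _ (fun k => k.+2%:R^-1) (fun=> 1)) => //.
- by move=> k; rewrite invr_gt0 ltr0n /= invf_lt1// ltr1n.
- by rewrite gt_eqF.
- move=> x; rewrite !indicE; have [x0|x0] := ltP 0 x; last first.
    rewrite (_ : (x \in `]0, 1]%classic) = false); last first.
      by apply/negbTE; rewrite notin_setE /= in_itv/= ltNge x0.
    apply: cvg_near_cst; apply: nearW => k; rewrite indicE.
    rewrite (_ : (_ \in _) = false)//; apply/negbTE; rewrite notin_setE /= in_itv/=.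
    move=> /andP[kx _]; have := le_trans kx x0.
    by rewrite leNgt invr_gt0 ltr0n.
  apply: cvg_near_cst; exists (Num.truncn x^-1).+1 => // k /= kx.
  rewrite indicE; congr (_%:R); congr nat_of_bool.
  apply/idP/idP; rewrite !inE /= !in_itv/=.
    by move=> /andP[_ ->]; rewrite x0.
  move=> /andP[_ ->]; rewrite andbT invf_ple ?posrE//.
  by rewrite (le_trans (ltW (truncnS_gt _)))// ler_nat (leq_trans kx)// ltnW.
- by move=> k; rewrite powR1 -[leRHS]mul1r ler_pM2r ?invr_gt0// lerBlDr lerDl powR_ge0.
Qed.

Lemma L1_powR_tail (p : R) : p < -1 -> L1 mu (fun t => t `^ p * \1_(`[1, +oo[%classic) t).
Proof.
move=> p1; have p10 : p + 1 < 0 by lra.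
apply: (@L1_powR_fatou p (- (p + 1)^-1) _ (fun=> 1) (fun k => k.+2%:R)) => //.
- by move=> k; rewrite ltr01 /= ltr1n.
- by rewrite lt_eqF.
- move=> x; rewrite !indicE; apply: cvg_near_cst; exists (Num.truncn x).+1 => // k /= kx.
  rewrite indicE; congr (_%:R); congr nat_of_bool.
  apply/idP/idP; rewrite !inE /= !in_itv/= andbT; first by move=> /andP[].
  move=> ->; rewrite /= (le_trans (ltW (truncnS_gt _)))// ler_nat (leq_trans kx)//.
  by rewrite (leq_trans (leqnSn _))// leqnSn.
- move=> k; rewrite powR1 -[leRHS]mulN1r; apply: ler_wnM2r; first by rewrite invr_le0 ltW.
  by have := powR_ge0 (k.+2%:R : R) (p + 1); lra.
Qed.

Lemma L1_mellin_wt q (phi : R -> R) (A a B b : R) : measurable_fun setT phi ->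
  (forall t, 0 < t <= 1 -> `|phi t| <= A * t `^ a) ->
  (forall t, 1 <= t -> `|phi t| <= B * t `^ b) -> 0 < q + a -> q + b < 0 ->
  L1 mu (mellin_wt q phi).
Proof.
move=> mphi phiA phiB qa qb.
pose U : set R := `]0, 1]%classic; pose V : set R := `[1, +oo[%classic.
apply: (@L1_le _ (measurableTypeR R) R mu _ (fun t => A * (t `^ (q - 1 + a) * \1_U t) +
  B * (t `^ (q - 1 + b) * \1_V t))).
- exact: measurable_mellin_wt.
- by apply: L1D; apply: L1Z; [apply: L1_powR_unit|apply: L1_powR_tail]; lra.
have A0 : 0 <= A by have := phiA 1; rewrite ltr01 lexx powR1 mulr1 => /(_ isT); apply: le_trans.
have B0 : 0 <= B by have := phiB 1 (lexx _); rewrite powR1 mulr1; apply: le_trans.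
move=> t; rewrite /mellin_wt.
have U0 : 0 <= A * (t `^ (q - 1 + a) * \1_U t) by rewrite mulr_ge0// mulr_ge0 ?powR_ge0// indicE.
have V0 : 0 <= B * (t `^ (q - 1 + b) * \1_V t) by rewrite mulr_ge0// mulr_ge0 ?powR_ge0// indicE.
case: ltP => t0; last by rewrite normr0 addr_ge0.
rewrite normrM (ger0_norm (powR_ge0 _ _)).
have [t1|/ltW t1] := leP t 1.
  rewrite -[leLHS]addr0; apply: lerD => //.
  rewrite indicE mem_set ?mulr1/=; last by rewrite /U /= in_itv/= t0.
  rewrite [t `^ (q - 1 + a)]powRD; last by apply/implyP; rewrite (gt_eqF t0).
  by rewrite mulrCA; apply: ler_wpM2l; rewrite ?powR_ge0// phiA// t0.
rewrite -[leLHS]add0r; apply: lerD => //.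
rewrite indicE mem_set ?mulr1/=; last by rewrite /V /= in_itv/= t1.
rewrite [t `^ (q - 1 + b)]powRD; last by apply/implyP; rewrite (gt_eqF t0).
by rewrite mulrCA; apply: ler_wpM2l; rewrite ?powR_ge0// phiB.
Qed.

Lemma pow_le_fact_expR (x : R) n : 0 <= x -> x ^+ n <= n`!%:R * expR x.
Proof.
move=> x0; case: n => [|n]; first by rewrite expr0 fact0 mul1r -expR0 ler_expR.
have := expR_ge1Dxn n x0.
rewrite -ler_pdivrMl ?ltr0n ?fact_gt0// mulrC; lra.
Qed.

Lemma natr_ge (p : R) : exists N : nat, p <= N%:R.
Proof. by exists (Num.truncn p).+1; rewrite ltW// truncnS_gt. Qed.

(** The value is [Gamma(q)]; its positivity is what allows the constant to be divided out.
    Integrability at infinity comes from [t^N <= N! e^t]. *)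
Lemma mellin_exp (q : R) : 0 < q ->
  L1 mu (mellin_wt q (fun t => expR (- t))) /\ 0 < \int[mu]_t mellin_wt q (fun t => expR (- t)) t.
Proof.
move=> q0; have [N NP] := natr_ge (q + 1).
have m : measurable_fun setT (fun t : R => expR (- t)).
  by apply: measurableT_comp => //; exact: measurable_expR.
have i : L1 mu (mellin_wt q (fun t => expR (- t))).
  apply: (@L1_mellin_wt _ _ 1 0 N`!%:R (- (q + 1))) => //; [| |lra|lra].
  - move=> t /andP[t0 _]; rewrite powRr0 mulr1 ger0_norm ?expR_ge0//.
    by rewrite -expR0 ler_expR; lra.
  - move=> t t1; have t0 : 0 < t by lra.
    rewrite ger0_norm ?expR_ge0// expRN powRN ler_pdivlMr ?powR_gt0//.
    rewrite mulrC ler_pdivrMr ?expR_gt0//.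
    apply: le_trans (pow_le_fact_expR N (ltW t0)).
    by rewrite -(powR_mulrn N (ltW t0)); exact: (ler_powR t1 NP).
split => //; apply: Rintegral_gt0 => //.
- by move=> x; apply: mellin_wt_ge0 => t _; exact: expR_ge0.
- by move=> x x0; rewrite /mellin_wt x0 mulr_gt0 ?powR_gt0 ?expR_gt0.
Qed.

(* Written with [`^ (-1)] rather than [^-1], whose measurability is in the library. *)
Lemma mellin_heat (q : R) : q < 0 ->
  L1 mu (mellin_wt q (fun t => expR (- (4 * t) `^ (-1)))) /\
  0 < \int[mu]_t mellin_wt q (fun t => expR (- (4 * t) `^ (-1))) t.
Proof.
move=> q0; have [N NP] := natr_ge (1 - q).
have m : measurable_fun setT (fun t : R => expR (- (4 * t) `^ (-1))).
  apply: measurableT_comp; first exact: measurable_expR.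
  apply: measurable_funN; apply: (measurableT_comp (measurable_powR (-1))).
  exact: measurable_funM.
have i : L1 mu (mellin_wt q (fun t => expR (- (4 * t) `^ (-1)))).
  apply: (@L1_mellin_wt _ _ (N`!%:R * 4 ^+ N) (1 - q) 1 0) => //.
  - move=> t /andP[t0 t1]; have x0 : 0 < 4 * t by lra.
    rewrite powR_inv1 ?(ltW x0)// ger0_norm ?expR_ge0// expRN -mulrA.
    apply: (@le_trans _ _ (N`!%:R * (4 * t) ^+ N)); last first.
      rewrite exprMn !ler_pM2l ?ltr0n ?fact_gt0 ?exprn_gt0//.
      by rewrite -(powR_mulrn N (ltW t0)); apply: (ger_powR _ NP); rewrite t0.
    rewrite -[leLHS]mul1r ler_pdivrMr ?expR_gt0// mulrAC.
    have := @pow_le_fact_expR (4 * t)^-1 N; rewrite invr_ge0 ltW// => /(_ isT).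
    by rewrite exprVn -[leLHS]mul1r ler_pdivrMr ?exprn_gt0.
  - move=> t t1; rewrite powRr0 mulr1 ger0_norm ?expR_ge0// -expR0 ler_expR oppr_le0 powR_ge0 //.
  - lra.
  - lra.
split => //; apply: Rintegral_gt0 => //.
- by move=> x; apply: mellin_wt_ge0 => t _; exact: expR_ge0.
- by move=> x x0; rewrite /mellin_wt x0 mulr_gt0 ?powR_gt0 ?expR_gt0.
Qed.

(* [exp_rem m t = (-1)^m (e^{-t} - \sum_(j < m) (-t)^j / j!)] *)
Fixpoint exp_rem (m : nat) (t : R) : R :=
  if m is m'.+1 then t ^+ m' / m'`!%:R - exp_rem m' t else expR (- t).

Lemma is_derive_exp_rem m (t : R) : is_derive t 1 (exp_rem m.+1) (exp_rem m t).
Proof.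
elim: m t => [|m IH] t.
  rewrite [X in is_derive _ _ X _](_ : _ = fun t => 1 - expR (- t)); last first.
    by apply/funext => u /=; rewrite expr0 fact0 divr1.
  by apply: is_derive_eq; rewrite /= /GRing.scale/=; ring.
rewrite [X in is_derive _ _ X _](_ : _ = fun t => t ^+ m.+1 / m.+1`!%:R - exp_rem m.+1 t)//.
have D1 : is_derive t 1 (fun t : R => t ^+ m.+1 / m.+1`!%:R) (t ^+ m / m`!%:R).
  rewrite (_ : (fun u : R => _) = (m.+1`!%:R^-1 : R) *: (id ^+ m.+1 : R -> R)); last first.
    by apply/funext => u; rewrite mulrC -[RHS]/(m.+1`!%:R^-1 * (id ^+ m.+1 : R -> R) u) fctE.
  apply: is_derive_eq; rewrite /GRing.scale/= factS natrM.
  rewrite -mulr_natl; field.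
  by rewrite pnatr_eq0 -lt0n fact_gt0 addrC natr1 pnatr_eq0.
exact: is_deriveB D1 (IH t).
Qed.

Lemma exp_rem0 m : exp_rem m.+1 0 = 0.
Proof.
elim: m => [|m IH] /=; first by rewrite oppr0 expR0 expr0 fact0; lra.
by move: IH => /= ->; rewrite expr0n mul0r subrr.
Qed.

(** Induction: [exp_rem m.+1] vanishes at 0 and has the positive derivative [exp_rem m]. *)
Lemma exp_rem_gt0 m (t : R) : 0 < t -> 0 < exp_rem m t.
Proof.
elim: m t => [|m IH] t t0; first exact: expR_gt0.
have [c] := MVT t0 (fun x _ => is_derive_exp_rem m x)
  (continuous_subspaceT (fun x => differentiable_continuous ((derivable1_diffP _ _).1 (@ex_derive _ _ _ _ _ _ _ (is_derive_exp_rem m x))))).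
rewrite exp_rem0 !subr0 in_itv => /andP[c0 _] ->.
by rewrite mulr_gt0 ?IH.
Qed.

Lemma measurable_exp_rem m : measurable_fun setT (exp_rem m).
Proof.
elim: m => [|m IH] /=.
  by apply: measurableT_comp => //; exact: measurable_expR.
by apply: measurable_funB => //; apply: measurable_funM => //; exact: measurable_funX.
Qed.

(** Positivity of the neighbouring remainders gives [exp_rem m.+1 t <= t^(m+1) / (m+1)!], integrable
    at 0 as [q < m + 1], and [exp_rem m.+1 t <= t^m / m!], integrable at infinity as [m < q]. The
    value is [Gamma(-q)] up to sign. *)
Lemma mellin_exp_rem m (q : R) : m%:R < q < m.+1%:R ->
  L1 mu (mellin_wt (- q) (exp_rem m.+1)) /\ 0 < \int[mu]_t mellin_wt (- q) (exp_rem m.+1) t.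
Proof.
move=> /andP[mq qm].
have r0 t : 0 < t -> 0 <= exp_rem m.+1 t by move=> t0; rewrite ltW// exp_rem_gt0.
have i : L1 mu (mellin_wt (- q) (exp_rem m.+1)).
  apply: (@L1_mellin_wt _ _ (m.+1`!%:R^-1) m.+1%:R (m`!%:R^-1) m%:R); [|move=> t|move=> t t1|lra|lra].
  - exact: measurable_exp_rem.
  - move=> /andP[t0 _]; rewrite ger0_norm ?r0// powR_mulrn ?ltW//.
    by have := exp_rem_gt0 m.+2 t0; rewrite [exp_rem m.+2 t]/= -/(exp_rem m.+1 t) mulrC; lra.
  - have t0 : 0 < t by lra.
    rewrite ger0_norm ?r0// powR_mulrn ?ltW// mulrC /=.
    by have := exp_rem_gt0 m t0; lra.
split => //; apply: Rintegral_gt0 => //.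
- by move=> x; exact: mellin_wt_ge0.
- by move=> x x0; rewrite /mellin_wt x0 mulr_gt0 ?powR_gt0 ?exp_rem_gt0.
Qed.

End mellin.

(** * Test functions *)

Section smooth_functions.
Context {R : realType} {V : normedModType R}.
Implicit Types (f g : V -> R).

(** Induction on the list of directions. It replaces formulas for iterated derivatives by the choice
    of a class of functions stable under derivation. *)
Lemma smooth_coind (P : (V -> R) -> Prop) :
  (forall f, P f -> continuous f /\
    forall v, (forall x, derivable f x v) /\ P (fun x => 'D_v f x)) ->
  forall f, P f -> smooth f.
Proof.
move=> PP f Pf vs.
have Pvs : P (iter_derive vs f) by elim: vs => [//|v vs /PP[_ /(_ v)[]]].
by have [c d] := PP _ Pvs; split => // x v; have [] := d v.
Qed.

Lemma smooth_derive f v : smooth f -> smooth (fun x => 'D_v f x).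
Proof. by move=> sf vs; have := sf (rcons vs v); rewrite /iter_derive foldr_rcons. Qed.

Lemma smooth_continuous f : smooth f -> continuous f.
Proof. by move=> /(_ [::])[]. Qed.

Lemma smooth_derivable f x v : smooth f -> derivable f x v.
Proof. by move=> /(_ [::])[_]; exact. Qed.

Inductive algebra_of (S : set (V -> R)) : (V -> R) -> Prop :=
| algebra_of_gen f : S f -> algebra_of S f
| algebra_of_cst c : algebra_of S (fun=> c)
| algebra_ofD f g : algebra_of S f -> algebra_of S g -> algebra_of S (fun x => f x + g x)
| algebra_ofM f g : algebra_of S f -> algebra_of S g -> algebra_of S (fun x => f x * g x).

(** By the Leibniz rule the generated algebra is stable under derivation as soon as the derivatives
    of its generators belong to it. *)
Lemma smooth_algebra (S : set (V -> R)) :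
  (forall f, S f -> continuous f /\
    forall v, (forall x, derivable f x v) /\ algebra_of S (fun x => 'D_v f x)) ->
  forall f, algebra_of S f -> smooth f.
Proof.
move=> SS; apply: smooth_coind => f; elim => {f}[f /SS//|c|f g Sf [cf df] Sg [cg dg]|f g Sf [cf df] Sg [cg dg]].
- split; first by move=> x; exact: cvg_cst.
  move=> v; split; first by move=> x; exact: derivable_cst.
  rewrite (_ : 'D_v _ = fun=> 0); first exact: algebra_of_cst.
  by apply/funext => x; rewrite derive_cst.
- split; first by move=> x; apply: cvgD; [exact: cf|exact: cg].
  move=> v; have [df1 df2] := df v; have [dg1 dg2] := dg v.
  split; first by move=> x; apply: derivableD.
  rewrite (_ : 'D_v _ = fun x => 'D_v f x + 'D_v g x); first exact: algebra_ofD.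
  by apply/funext => x; exact: deriveD.
- split; first by move=> x; apply: cvgM; [exact: cf|exact: cg].
  move=> v; have [df1 df2] := df v; have [dg1 dg2] := dg v.
  split; first by move=> x; apply: derivableM.
  rewrite (_ : 'D_v _ = fun x => f x * 'D_v g x + g x * 'D_v f x).
    by apply: algebra_ofD; apply: algebra_ofM.
  by apply/funext => x; exact: deriveM.
Qed.

Let smooth_smooth f : algebra_of smooth f -> smooth f.
Proof.
apply: smooth_algebra => {}f sf; split; first exact: smooth_continuous.
move=> v; split; first by move=> x; exact: smooth_derivable.
by apply: algebra_of_gen; exact: smooth_derive.
Qed.

Lemma smooth_cst c : smooth (fun _ : V => c).
Proof. by apply: smooth_smooth; exact: algebra_of_cst. Qed.

Lemma smoothD f g : smooth f -> smooth g -> smooth (fun x => f x + g x).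
Proof. by move=> sf sg; apply: smooth_smooth; apply: algebra_ofD; apply: algebra_of_gen. Qed.

Lemma smoothM f g : smooth f -> smooth g -> smooth (fun x => f x * g x).
Proof. by move=> sf sg; apply: smooth_smooth; apply: algebra_ofM; apply: algebra_of_gen. Qed.

Lemma smooth_prod (I : Type) (s : seq I) (F : I -> V -> R) :
  (forall i, smooth (F i)) -> smooth (fun x => \prod_(i <- s) F i x).
Proof.
move=> sF; elim: s => [|i s IH].
  by under eq_fun do rewrite big_nil; exact: smooth_cst.
by under eq_fun do rewrite big_cons; exact: (smoothM (sF i) IH).
Qed.

End smooth_functions.

Section smooth_comp.
Context {R : realType} {V W : normedModType R} (A l : V -> W).
Hypothesis Al : forall h x v, A (h *: v + x) = h *: l v + A x.
Hypothesis cA : continuous A.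

Lemma derivable_comp_affine (f : W -> R) x v : derivable f (A x) (l v) ->
  derivable (f \o A) x v /\ 'D_v (f \o A) x = 'D_(l v) f (A x).
Proof.
have E : (fun h : R => h^-1 *: (((f \o A) \o shift x) (h *: v) - (f \o A) x)) =
    (fun h : R => h^-1 *: ((f \o shift (A x)) (h *: l v) - f (A x))).
  by apply/funext => h /=; rewrite Al.
by rewrite /derivable /derive E.
Qed.

Lemma smooth_comp_affine (f : W -> R) : smooth f -> smooth (f \o A).
Proof.
move=> sf.
apply: (@smooth_coind _ _ (fun g => exists2 f, smooth f & g = f \o A)); last by exists f.
move=> g [{sf}f sf ->]; split.
  by move=> x; apply: continuous_comp; [exact: cA|exact: smooth_continuous].
move=> v; have D x := @derivable_comp_affine f x v (@smooth_derivable _ _ f (A x) (l v) sf).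
split; first by move=> x; have [] := D x.
exists (fun x => 'D_(l v) f x); first exact: smooth_derive.
by apply/funext => x; have [] := D x.
Qed.

End smooth_comp.

Section smooth_real.
Context {R : realType}.

Lemma is_derive_dir (f : R -> R) (x w d : R) : is_derive x 1 f d -> is_derive (x : R^o) w f (w * d).
Proof.
move=> [df fd].
have diff : differentiable f x by apply/derivable1_diffP.
apply: DeriveDef; first exact: diff_derivable.
by rewrite deriveE// diff1E// derive1E fd.
Qed.

Lemma smooth_algebra_real (S : set (R^o -> R)) :
  (forall f, S f -> exists2 g, algebra_of S g & forall x : R, is_derive x 1 f (g x)) ->
  forall f, algebra_of S f -> smooth f.
Proof.
move=> SS; apply: smooth_algebra => f /SS[g Sg fg]; split.
  move=> x; apply: differentiable_continuous; apply/derivable1_diffP.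
  by have [] := fg x.
move=> w; split; first by move=> x; have [] := is_derive_dir w (fg x).
rewrite (_ : 'D_w _ = fun x => w * g x).
  by apply: algebra_ofM => //; exact: algebra_of_cst.
by apply/funext => x; have [] := is_derive_dir w (fg x).
Qed.

Lemma smooth_trigo : smooth (cos : R^o -> R) /\ smooth (sin : R^o -> R).
Proof.
pose S : set (R^o -> R) := [set f | f = cos \/ f = sin].
have SS f : S f -> exists2 g, algebra_of S g & forall x : R, is_derive x 1 f (g x).
  move=> [] ->.
    exists (fun x => (-1) * sin x); last by move=> x; rewrite mulN1r; exact: is_derive_cos.
    by apply: algebra_ofM; [exact: algebra_of_cst|apply: algebra_of_gen; right].
  by exists cos; [apply: algebra_of_gen; left|move=> x; exact: is_derive_sin].
by split; apply: (smooth_algebra_real SS); apply: algebra_of_gen; [left|right].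
Qed.

(* The class [p(1/x) e^{-1/x}], extended by 0 to [x <= 0], is stable under derivation. *)
Definition flat (p : {poly R}) (x : R) : R :=
  if 0 < x then p.[x^-1] * expR (- x^-1) else 0.

(** Apply [y^(i+2) <= (i+2)! e^y] with [y = 1 / x] to each monomial of degree [i]. The quadratic
    bound is what makes the derivative at 0 exist and vanish. *)
Lemma flat_le (p : {poly R}) : exists2 c, 0 <= c & forall x, `|flat p x| <= c * x ^+ 2.
Proof.
exists (\sum_(i < size p) `|p`_i| * (i.+2)`!%:R).
  by apply: sumr_ge0 => i _; rewrite mulr_ge0.
move=> x; rewrite /flat; case: ltP => x0; last first.
  rewrite normr0 mulr_ge0 ?sqr_ge0//.
  by apply: sumr_ge0 => i _; rewrite mulr_ge0.
rewrite horner_coef mulr_suml mulr_suml.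
apply: le_trans (ler_norm_sum _ _ _) _; apply: ler_sum => i _.
rewrite -!mulrA normrM; apply: ler_wpM2l => //.
rewrite ger0_norm; last by rewrite mulr_ge0 ?expR_ge0 ?exprn_ge0 ?invr_ge0 ?ltW.
have y0 : 0 < x^-1 by rewrite invr_gt0.
rewrite expRN ler_pdivrMr ?expR_gt0// mulrAC.
have := pow_le_fact_expR i.+2 (ltW y0).
rewrite -addn2 exprD => /(ler_wpM2r (sqr_ge0 x)); apply: le_trans.
by rewrite -mulrA -exprMn mulVf ?gt_eqF// expr1n mulr1.
Qed.

(** For [x > 0] and [y = 1 / x], the chain rule gives [y^2 (p(y) - p'(y)) e^(-y)]; at 0 the
    difference quotient is at most [c |x|] by [flat_le]. *)
Lemma is_derive_flat (p : {poly R}) (x : R) :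
  is_derive x 1 (flat p) (flat ('X ^+ 2 * (p - p^`())) x).
Proof.
have [x0|x0|->] := ltgtP x 0.
- rewrite /flat ltNge (ltW x0) /=.
  apply: (@near_eq_is_derive _ _ _ (cst 0)).
    near=> y; have y0 : y < 0 by near: y; exact: lt_nbhsl.
    by rewrite ltNge (ltW y0).
- rewrite [X in is_derive _ _ _ X]/flat x0.
  apply: (@near_eq_is_derive _ _ _ (fun y : R => p.[y^-1] * expR (- y^-1))).
    near=> y; have y0 : 0 < y by near: y; exact: lt_nbhsr.
    by rewrite /flat y0.
  have dV : is_derive x 1 (fun y : R => y^-1) (- x ^- 2).
    by apply: is_derive_eq; first (apply: is_deriveV; rewrite gt_eqF//); rewrite /GRing.scale/= mulr1.
  have dp := is_derive1_comp (is_derive_poly p x^-1) dV.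
  have de := @is_derive1_comp _ expR (fun y : R => - y^-1) x _ _ (is_derive_expR _) (is_deriveN dV).
  have D := is_deriveM dp de; apply: (@is_derive_eq _ _ _ _ _ _ _ _ D).
  rewrite /GRing.scale/= !hornerE /= exprVn; ring.
- rewrite [X in is_derive _ _ _ X]/flat ltxx.
  have [c c0 fc] := flat_le p.
  have f0 : flat p 0 = 0 by rewrite /flat ltxx.
  have cv : h^-1 *: (flat p (h *: 1 + 0) - flat p 0) @[h --> (0 : R)^'] --> (0 : R).
    apply/cvgrPdist_le => e e0; near=> h.
    rewrite f0 subr0 addr0 sub0r normrN /GRing.scale/= mulr1 normrM normfV.
    have h0 : h != 0 by near: h; exact: nbhs_dnbhs_neq.
    rewrite ler_pdivrMl ?normr_gt0//; apply: le_trans (fc h) _.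
    rewrite -real_normK ?num_real// expr2 mulrA mulrC; apply: ler_wpM2l => //.
    have : `|h| <= e / (c + 1).
      near: h; apply: dnbhs0_le; rewrite divr_gt0//; lra.
    rewrite ler_pdivlMr; last lra.
    by apply: le_trans; rewrite mulrC; apply: ler_wpM2l => //; lra.
  by apply: DeriveDef; [apply: cvgP cv|apply/cvg_lim].
Unshelve. all: by end_near. Qed.

Lemma smooth_flat (p : {poly R}) : smooth (flat p : R^o -> R).
Proof.
apply: (@smooth_algebra_real [set flat p | p in setT]); last by apply: algebra_of_gen; exists p.
move=> _ [q _ <-]; exists (flat ('X ^+ 2 * (q - q^`()))); last exact: is_derive_flat.
by apply: algebra_of_gen; eexists.
Qed.

Definition bump1 (t : R) : R := flat 1 (1 + t) * flat 1 (1 - t).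

Lemma bump1_ge0 t : 0 <= bump1 t.
Proof.
have f0 x : 0 <= flat 1 x.
  by rewrite /flat; case: ifP => // _; rewrite hornerE mul1r expR_ge0.
by rewrite mulr_ge0.
Qed.

Lemma bump1_gt0 : 0 < bump1 0.
Proof. by rewrite /bump1 subr0 addr0 /flat ltr01 -[1 : {poly R}]/(1%:P) !hornerC !mul1r mulr_gt0 ?expR_gt0. Qed.

Lemma bump1_neq0 t : bump1 t != 0 -> `|t| < 1.
Proof.
rewrite /bump1 /flat ltr_norml.
case: (ltP 0 (1 + t)) => [t1|]; last by rewrite mul0r eqxx.
case: (ltP 0 (1 - t)) => [t2|]; last by rewrite mulr0 eqxx.
by move=> _; apply/andP; split; lra.
Qed.

Lemma smooth_bump1 : smooth (bump1 : R^o -> R).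
Proof.
have H (e : R) : smooth ((fun t => flat 1 (1 + e * t)) : R^o -> R).
  apply: (@smooth_comp_affine R R^o R^o (fun t => 1 + e * t) (fun v => e * v) _ _ (flat 1)).
  - by move=> h x v; rewrite /GRing.scale/=; ring.
  - by move=> x; apply: cvgD; [exact: cvg_cst|apply: cvgM; [exact: cvg_cst|exact: cvg_id]].
  - exact: smooth_flat.
have -> : bump1 = fun t => flat 1 (1 + 1 * t) * flat 1 (1 + (-1) * t).
  by apply/funext => t; rewrite mul1r mulN1r.
by apply: smoothM; exact: H.
Qed.

End smooth_real.

Section continuous_real.
Context {R : realType} {T : topologicalType}.
Implicit Types (f g : T -> R).

Lemma continuous_add f g : continuous f -> continuous g -> continuous (fun x => f x + g x).
Proof. by move=> cf cg x; apply: cvgD; [apply: cf|apply: cg]. Qed.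

Lemma continuous_mul f g : continuous f -> continuous g -> continuous (fun x => f x * g x).
Proof. by move=> cf cg x; apply: cvgM; [apply: cf|apply: cg]. Qed.

Lemma continuous_opp f : continuous f -> continuous (fun x => - f x).
Proof. by move=> cf x; apply: cvgN; apply: cf. Qed.

Lemma continuous_cst (c : R) : continuous (fun _ : T => c).
Proof. by move=> x; apply: cvg_cst. Qed.

End continuous_real.

Section test_function_lemmas.
Context {R : realType} {V : normedModType R}.
Implicit Types (U : set V) (f g : V -> R).

Lemma supp_closed f : closed (supp f).
Proof. exact: closed_closure. Qed.

Lemma sub_supp f x : f x != 0 -> supp f x.
Proof. by move=> fx; apply: subset_closure. Qed.

Lemma supp_sub f (K : set V) : closed K -> (forall x, f x != 0 -> K x) -> supp f `<=` K.
Proof. by move=> /closure_id cK fK; rewrite cK; exact: closureS. Qed.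

Lemma Cc_infty0 U : Cc_infty U (fun=> 0).
Proof.
have S0 : supp (fun _ : V => 0 : R) `<=` set0.
  by apply: supp_sub; [exact: closed0|move=> x; rewrite eqxx].
split; first exact: smooth_cst.
  by move: S0; rewrite subset0 => ->; exact: compact0.
exact: subset_trans S0 (@sub0set _ _).
Qed.

Lemma Cc_infty_supp U f g : Cc_infty U f -> smooth g -> (forall x, g x != 0 -> supp f x) ->
  Cc_infty U g.
Proof.
move=> [sf cf fU] sg gf; have S := supp_sub (@supp_closed f) gf.
split => //; last exact: subset_trans S fU.
by apply: subclosed_compact S => //; exact: supp_closed.
Qed.

Lemma Cc_inftyMr U f g : Cc_infty U f -> smooth g -> Cc_infty U (fun x => f x * g x).
Proof.
move=> Cf sg; have [sf _ _] := Cf; apply: (Cc_infty_supp Cf); first exact: smoothM.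
by move=> x /eqP fg; apply: sub_supp; apply/eqP => f0; apply: fg; rewrite f0 mul0r.
Qed.

Lemma Cc_inftyD U f g : Cc_infty U f -> Cc_infty U g -> Cc_infty U (fun x => f x + g x).
Proof.
move=> [sf cf fU] [sg cg gU].
have S : supp (fun x => f x + g x) `<=` supp f `|` supp g.
  apply: supp_sub; first by apply: closedU; exact: supp_closed.
  move=> x; have [->|f0 _] := eqVneq (f x) 0; last by left; exact: sub_supp.
  by rewrite add0r; right; exact: sub_supp.
split; first exact: smoothD.
  by apply: subclosed_compact S; [exact: supp_closed|exact: compactU].
by apply: (subset_trans S) => x [/fU|/gU].
Qed.

Lemma Cc_infty_sum U (I : Type) (s : seq I) (F : I -> V -> R) :
  (forall i, Cc_infty U (F i)) -> Cc_infty U (fun x => \sum_(i <- s) F i x).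
Proof.
move=> UF; elim: s => [|i s IH].
  by under eq_fun do rewrite big_nil; exact: Cc_infty0.
by under eq_fun do rewrite big_cons; exact: Cc_inftyD.
Qed.

Lemma Cc_infty_derive U f v : Cc_infty U f -> Cc_infty U (fun x => 'D_v f x).
Proof.
move=> Cf; have [sf _ _] := Cf; apply: (Cc_infty_supp Cf); first exact: smooth_derive.
move=> x; apply: contra_neqP => nx.
have <- : 'D_v (cst 0 : V -> R) x = 0 by rewrite derive_cst.
apply: near_eq_derive.
have : open_nbhs x (~` supp f) by split => //; apply/closed_openC/supp_closed.
move=> /open_nbhs_nbhs; apply: filterS => y ny /=.
by apply/eqP/negPn/negP => /sub_supp.
Qed.

Lemma Cc_infty_eq0 U f x : Cc_infty U f -> ~ U x -> f x = 0.
Proof. by move=> [_ _ fU] Ux; apply/eqP/negPn/negP => /sub_supp /fU. Qed.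

Lemma Cc_infty_sub U U' f : U `<=` U' -> Cc_infty U f -> Cc_infty U' f.
Proof. by move=> UU' [sf cf fU]; split => //; exact: subset_trans UU'. Qed.

Lemma compact_supp_le_indic f : continuous f -> compact (supp f) ->
  exists c M, 0 <= c /\ forall x, `|f x| <= c * \1_(ball (0 : V) M) x.
Proof.
move=> ctf cf.
have := @continuous_compact _ _ f (supp f) (continuous_subspaceT ctf) cf.
move=> /compact_bounded[c [creal fc]].
have [M [Mreal fM]] := compact_bounded cf.
exists (`|c| + 1), (`|M| + 2); split; first by rewrite addr_ge0.
move=> x; have [->|fx] := eqVneq (f x) 0.
  by rewrite normr0 mulr_ge0// ?addr_ge0// indicE.
rewrite indicE mem_set ?mulr1.
  apply: fc; first by rewrite (le_lt_trans (ler_norm _))// ltrDl.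
  by exists x => //; exact: sub_supp.
rewrite -ball_normE /ball_/= sub0r normrN.
rewrite (@le_lt_trans _ _ (`|M| + 1))//; last by rewrite ltrD2l ltr1n.
by apply: fM; [rewrite (le_lt_trans (ler_norm _))// ltrDl|exact: sub_supp].
Qed.

End test_function_lemmas.

(** * Test functions on R^n and their Hartley transforms *)

Section test_function_rV.
Context {R : realType} {n : nat}.
Local Notation Rn := 'rV[R]_n.
Local Notation mu := (@lebesgue_rV R n).
Implicit Types (U : set Rn) (f g : Rn -> R).

Lemma compact_supp_L12 f : continuous f -> compact (supp f) -> L1 mu f /\ L2 mu f.
Proof.
move=> ctf cf; have mf := continuous_measurable_rV ctf.
have [c [M [c0 fM]]] := compact_supp_le_indic ctf cf.
have i1 := L1_indic (measurable_ball_rV (0 : Rn) M) (ball_lty 0 M).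
have i2 := L2_indic (measurable_ball_rV (0 : Rn) M) (ball_lty 0 M).
split; first by apply: (L1_le mf (L1Z c i1)).
apply: (L2_le mf (L2Z c i2)) => x; apply: le_trans (fM x) _; exact: ler_norm.
Qed.

Lemma Cc_infty_L12 U f : Cc_infty U f -> L1 mu f /\ L2 mu f.
Proof.
by move=> [sf cf _]; apply: compact_supp_L12 => //; exact: smooth_continuous.
Qed.

Lemma L1_Cc_inftyM U f g : continuous f -> Cc_infty U g -> L1 mu (fun x => f x * g x).
Proof.
move=> ctf [sg cg _]; have ct := continuous_mul ctf (smooth_continuous sg).
apply: (compact_supp_L12 ct _).1; apply: (subclosed_compact _ cg); first exact: supp_closed.
apply: supp_sub; first exact: supp_closed.
by move=> x; rewrite mulf_eq0 negb_or => /andP[_ gx]; exact: sub_supp.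
Qed.

Lemma is_derive_line f (x v : Rn) (t : R) : smooth f ->
  is_derive t 1 (fun t : R => f (x + t *: v)) ('D_v f (x + t *: v)).
Proof.
move=> sf.
have Al (h : R) (a w : R^o) : x + (h *: w + a) *: v = h *: (w *: v) + (x + a *: v).
  by rewrite scalerDl scalerA addrCA.
have [d1 d2] := @derivable_comp_affine R R^o Rn (fun t => x + t *: v) (fun w => w *: v) Al f t 1
  (@smooth_derivable _ _ f _ _ sf).
by apply: DeriveDef => //; rewrite -[LHS]/('D_1 (f \o (fun t0 : R^o => x + t0 *: v)) t) d2 scale1r.
Qed.

(** By translation invariance the integral of [f (x + t v)] does not depend on [t]; differentiate at
    [t = 0]. *)
Lemma Rintegral_derive U f v : Cc_infty U f -> \int[mu]_x 'D_v f x = 0.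
Proof.
move=> Cf; have [sf _ _] := Cf; have [f1 _] := Cc_infty_L12 Cf.
have CD := Cc_infty_derive v Cf.
have [sD cD _] := CD.
have [c [M [c0 DM]]] := compact_supp_le_indic (smooth_continuous sD) cD.
have iG := L1Z c (L1_indic (measurable_ball_rV (0 : Rn) (M + `|v|)) (ball_lty 0 (M + `|v|))).
have D := @is_derive_under_integral _ _ _ mu (fun t x => f (x + t *: v))
  (fun t x => 'D_v f (x + t *: v)) _ 0 (fun t => L1_shift (t *: v) f1)
  (fun t x => is_derive_line x v t sf) iG.
have : is_derive (0 : R) 1 (fun t => \int[mu]_x f (x + t *: v)) (\int[mu]_x 'D_v f (x + 0 *: v)).
  apply: D => t x; rewrite subr0 => t1; apply: le_trans (DM _) _; apply: ler_wpM2l => //.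
  rewrite !indicE ler_nat; case: (boolP (x + t *: v \in _)) => //; rewrite inE => xM.
  rewrite mem_set//; move: xM; rewrite -!ball_normE /ball_/= !sub0r !normrN => xM.
  rewrite -[x](addrK (t *: v)) (le_lt_trans (ler_normB _ _))// ltr_leD//.
  by rewrite normrZ ler_piMl// ltW.
under eq_fun do rewrite (Rintegral_shift (_ *: v) f1).
under [X in is_derive _ _ _ X]eq_Rintegral do rewrite scale0r addr0.
move=> [_ <-]; exact: derive_cst.
Qed.

(** The derivative of [cas]; its own derivative is [- cas]. *)
Definition casd (a : R) : R := cos a - sin a.

Lemma smooth_cas_dotv (xi : Rn) :
  smooth (fun x : Rn => cas (dotv x xi)) /\ smooth (fun x : Rn => casd (dotv x xi)).
Proof.
have H (f : R^o -> R) : smooth f -> smooth (fun x : Rn => f (dotv x xi)).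
  apply: (@smooth_comp_affine R Rn R^o (fun x => dotv x xi) (fun x => dotv x xi)).
  - by move=> h x v; rewrite dotvDl dotvZl.
  - have Fx (x : Rn) : Filter (nbhs x) by exact: nbhs_filter.
    by apply: continuous_dotv => x; [exact: cvg_id|apply: cvg_cst].
have [sc ss] := @smooth_trigo R; split; first by apply: smoothD; exact: H.
have -> : (fun x : Rn => casd (dotv x xi)) = fun x => cos (dotv x xi) + (-1) * sin (dotv x xi).
  by apply/funext => x; rewrite mulN1r.
by apply: smoothD; [exact: H|apply: smoothM; [exact: smooth_cst|exact: H]].
Qed.

Lemma derive_cas_dotv (xi v x : Rn) :
  'D_v (fun x : Rn => cas (dotv x xi)) x = dotv v xi * casd (dotv x xi) /\
  'D_v (fun x : Rn => casd (dotv x xi)) x = - (dotv v xi * cas (dotv x xi)).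
Proof.
have Al h (y u : Rn) : dotv (h *: u + y) xi = h * dotv u xi + dotv y xi.
  by rewrite dotvDl dotvZl.
have H (f : R -> R) (d : R) : is_derive (dotv x xi) 1 f d ->
    'D_v (fun x : Rn => f (dotv x xi)) x = dotv v xi * d.
  move=> /(is_derive_dir (dotv v xi)) [df fd].
  by have [_] := @derivable_comp_affine R Rn R^o (fun x => dotv x xi) (fun x => dotv x xi) Al f x v df; rewrite fd.
have dc := is_derive_cos (dotv x xi); have ds := is_derive_sin (dotv x xi).
split; [rewrite (H _ _ (is_deriveD dc ds))|rewrite (H _ _ (is_deriveB dc ds))];
  by rewrite /cas /casd; ring.
Qed.

(** Two integrations by parts. A single derivative would exchange [cas] and [casd]; the second one
    restores [cas], so the formula closes for even orders. *)
Lemma hartley_derive2 U f v xi : Cc_infty U f ->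
  hartley (fun x => 'D_v (fun y => 'D_v f y) x) xi = - dotv v xi ^+ 2 * hartley f xi.
Proof.
move=> Cf; have CD := Cc_infty_derive v Cf; have CDD := Cc_infty_derive v CD.
have [sf _ _] := Cf; have [sDf _ _] := CD.
have [sc sd] := smooth_cas_dotv xi.
have I1 := Rintegral_derive v (Cc_inftyMr CD sc).
have I2 := Rintegral_derive v (Cc_inftyMr Cf sd).
have E1 x : 'D_v (fun x => 'D_v f x * cas (dotv x xi)) x =
    dotv v xi * ('D_v f x * casd (dotv x xi)) + 'D_v (fun y => 'D_v f y) x * cas (dotv x xi).
  rewrite (deriveM (@smooth_derivable _ _ _ x v sDf) (@smooth_derivable _ _ _ x v sc)).
  by rewrite (derive_cas_dotv _ _ _).1 /GRing.scale/=; ring.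
have E2 x : 'D_v (fun x => f x * casd (dotv x xi)) x =
    'D_v f x * casd (dotv x xi) + (- dotv v xi) * (f x * cas (dotv x xi)).
  rewrite (deriveM (@smooth_derivable _ _ _ x v sf) (@smooth_derivable _ _ _ x v sd)).
  by rewrite (derive_cas_dotv _ _ _).2 /GRing.scale/=; ring.
have i1 := (Cc_infty_L12 (Cc_inftyMr CD sd)).1.
have i2 := (Cc_infty_L12 (Cc_inftyMr Cf sc)).1.
have i3 := (Cc_infty_L12 (Cc_inftyMr CDD sc)).1.
move: I1 I2; under eq_Rintegral do rewrite E1.
rewrite (RintegralTD (L1Z _ i1) i3) (RintegralTZ _ i1) => I1.
under eq_Rintegral do rewrite E2.
rewrite (RintegralTD i1 (L1Z _ i2)) (RintegralTZ _ i2) => I2.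
rewrite /hartley; set a := \int[mu]_x ('D_v f x * _) in I1 I2.
set c := \int[mu]_x (f x * _) in I2 *.
have ea : a = dotv v xi * c by lra.
by move: I1; rewrite ea => /eqP; rewrite addrC addr_eq0 => /eqP ->; ring.
Qed.

Definition neg_laplacian f (x : Rn) : R :=
  \sum_(i < n) (-1) * 'D_(delta_mx 0 i) (fun y => 'D_(delta_mx 0 i) f y) x.

Lemma Cc_infty_neg_laplacian U f k : Cc_infty U f -> Cc_infty U (iter k neg_laplacian f).
Proof.
move=> Cf; elim: k => [//|k IH] /=; apply: Cc_infty_sum => i.
have -> : (fun x => -1 * 'D_(delta_mx 0 i) (fun y => 'D_(delta_mx 0 i) (iter k neg_laplacian f) y) x) =
    fun x => 'D_(delta_mx 0 i) (fun y => 'D_(delta_mx 0 i) (iter k neg_laplacian f) y) x * -1.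
  by apply/funext => x; rewrite mulrC.
by apply: Cc_inftyMr; [do 2 apply: Cc_infty_derive|exact: smooth_cst].
Qed.

Lemma hartley_sum (I : Type) (s : seq I) (F : I -> Rn -> R) xi : (forall i, L1 mu (F i)) ->
  hartley (fun x => \sum_(i <- s) F i x) xi = \sum_(i <- s) hartley (F i) xi.
Proof.
move=> iF.
suff [] : L1 mu (fun x => \sum_(i <- s) F i x) /\
  hartley (fun x => \sum_(i <- s) F i x) xi = \sum_(i <- s) hartley (F i) xi by [].
elim: s => [|i s [IH1 IH2]].
  under eq_fun do rewrite big_nil; rewrite big_nil; split; first exact: L1_0.
  by rewrite /hartley; under eq_Rintegral do rewrite mul0r; rewrite Rintegral0.
rewrite (_ : (fun x => _) = fun x => F i x + \sum_(j <- s) F j x).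
  by rewrite big_cons -IH2 -hartleyD//; split => //; exact: L1D.
by apply/funext => x; rewrite big_cons.
Qed.

Lemma hartley_neg_laplacian U f xi k : Cc_infty U f ->
  hartley (iter k neg_laplacian f) xi = dotv xi xi ^+ k * hartley f xi.
Proof.
move=> Cf; elim: k => [|k IH]; first by rewrite expr0 mul1r.
have Ck := Cc_infty_neg_laplacian k Cf.
have i1 i := (Cc_infty_L12 (Cc_infty_derive (delta_mx 0 i) (Cc_infty_derive (delta_mx 0 i) Ck))).1.
rewrite /= {1}/neg_laplacian hartley_sum; last by move=> i; apply: L1Z; exact: i1.
rewrite exprS -mulrA -IH /dotv mulr_suml; apply: eq_bigr => i _.
rewrite hartleyZ// (hartley_derive2 _ _ Ck).
suff -> : dotv (delta_mx 0 i) xi = xi ord0 i by ring.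
rewrite /dotv (bigD1 i)//= mxE !eqxx mul1r big1 ?addr0// => j /negbTE ji.
by rewrite mxE ji andbF mul0r.
Qed.

Definition bumpV (y : Rn) (r : R) (x : Rn) : R :=
  \prod_(i < n) bump1 (r^-1 * (x ord0 i - y ord0 i)).

Lemma bumpV_ge0 y r x : 0 <= bumpV y r x.
Proof. by apply: prodr_ge0 => i _; exact: bump1_ge0. Qed.

Lemma bumpV_gt0 y r : 0 < bumpV y r y.
Proof. by apply: prodr_gt0 => i _; rewrite subrr mulr0 bump1_gt0. Qed.

Lemma smooth_bumpV y r : smooth (bumpV y r).
Proof.
apply: smooth_prod => i.
apply: (@smooth_comp_affine R Rn R^o (fun x => r^-1 * (x ord0 i - y ord0 i))
  (fun v => r^-1 * v ord0 i) _ _ bump1); last exact: smooth_bump1.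
- by move=> h x v; rewrite !mxE /GRing.scale/=; ring.
- apply: continuous_mul; first exact: continuous_cst.
  by apply: continuous_add; [exact: continuous_coord|exact: continuous_cst].
Qed.

Lemma bumpV_neq0 y r x : 0 < r -> bumpV y r x != 0 -> `|x - y| <= r.
Proof.
move=> r0; rewrite prodf_seq_neq0 => /allP b0.
apply: norm_le_coord; first exact: ltW.
move=> i; have := b0 i (mem_index_enum _) => /= /bump1_neq0.
by rewrite !mxE normrM normfV (gtr0_norm r0) ltr_pdivrMl// mulr1 => /ltW.
Qed.

Lemma continuous_dist (y : Rn) : continuous (fun x : Rn => `|x - y|).
Proof.
move=> x; have Fx : Filter (nbhs x) by exact: nbhs_filter.
apply: (@cvg_norm _ Rn _ _ Fx); apply: (@cvgB _ Rn _ _ Fx id (cst y)); [exact: cvg_id|exact: cvg_cst].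
Qed.

Lemma Cc_infty_bumpV U y r : 0 < r -> (forall x, `|x - y| <= r -> U x) ->
  Cc_infty U (bumpV y r).
Proof.
move=> r0 rU.
have S : supp (bumpV y r) `<=` [set x | `|x - y| <= r].
  apply: supp_sub; last by move=> x; exact: bumpV_neq0.
  apply: (@preimage_closed _ _ (fun x : Rn => `|x - y|) [set x | x <= r]); last exact: closed_le.
  by move=> x _; exact: continuous_dist.
split; first exact: smooth_bumpV.
- apply: bounded_closed_compact; last exact: supp_closed.
  exists (r + `|y|); split; first by rewrite num_real.
  move=> M rM x /S /= xr; rewrite -[x](subrK y) (le_trans (ler_normD _ _))//.
  by rewrite (le_trans _ (ltW rM))// lerD2r.
- by apply: (subset_trans S) => x /rU.
Qed.

Lemma continuous_ae0 f : continuous f -> {ae mu, forall x, f x = 0} -> forall x, f x = 0.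
Proof.
move=> cf [N [mN N0 fN]] x; apply/eqP/negPn/negP => fx.
have Fx : Filter (nbhs x) by exact: nbhs_filter.
have fnear := cvgr_neq0 _ (cf x) fx.
move: (fnear Fx) => /nbhs_ballP[r /= r0 fr].
have : (mu (ball x r) <= mu N)%E.
  apply: le_measure; rewrite ?inE//; first exact: measurable_ball_rV.
  by move=> y /fr fy; apply: fN => /=; exact/eqP.
by rewrite N0 lebesgue_rV_ball// lee_fin leNgt exprn_gt0// mulr_gt0.
Qed.

(** If [f y > 0], a bump supported where [f > 0] makes the product a nonnegative continuous function
    of integral 0, hence identically 0, although it is positive at [y]. *)
Lemma test_functions_separate U f : open U -> continuous f ->
  (forall chi, Cc_infty U chi -> \int[mu]_x (f x * chi x) = 0) ->
  forall y, U y -> f y = 0.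
Proof.
have pos (g : Rn -> R) y : open U -> continuous g ->
    (forall chi, Cc_infty U chi -> \int[mu]_x (g x * chi x) = 0) -> U y -> g y <= 0.
  move=> oU cg gchi Uy; rewrite leNgt; apply/negP => gy.
  have [r r0 rU] : exists2 r : R, 0 < r & forall x, `|x - y| <= r -> U x /\ 0 < g x.
    have : \forall x \near y, U x /\ 0 < g x.
      near=> x; split; first by near: x; exact: open_nbhs_nbhs.
      by near: x; exact: (cvgr_gt _ (cg y)).
    move=> /nbhs_ballP[r /= r0 rU]; exists (r / 2); first by rewrite divr_gt0.
    move=> x xr; apply: rU; rewrite -ball_normE /ball_/= distrC.
    by rewrite (le_lt_trans xr)// ltr_pdivrMr// mulr_natr mulr2n ltrDl.
  have Cb := Cc_infty_bumpV r0 (fun x xr => (rU x xr).1).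
  have [sb _ _] := Cb.
  have gb0 x : 0 <= g x * bumpV y r x.
    have [->|b0] := eqVneq (bumpV y r x) 0; first by rewrite mulr0.
    by rewrite mulr_ge0 ?bumpV_ge0// ltW//; exact: (rU _ (bumpV_neq0 r0 b0)).2.
  have cgb : continuous (fun x => g x * bumpV y r x).
    by apply: continuous_mul => //; exact: smooth_continuous.
  have igb := L1_Cc_inftyM cg Cb.
  have := continuous_ae0 cgb (ge0_ae0 igb gb0 (gchi _ Cb)) y.
  by move=> /eqP; rewrite mulf_eq0 (gt_eqF gy) (gt_eqF (bumpV_gt0 _ _)).
move=> oU cf fchi y Uy; apply/eqP; rewrite eq_le pos//= -oppr_le0.
apply: (pos (fun x => - f x)) => //; first exact: continuous_opp.
move=> chi Cchi; under eq_Rintegral do rewrite mulNr.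
by rewrite RintegralTN ?fchi ?oppr0//; exact: L1_Cc_inftyM cf Cchi.
Unshelve. all: by end_near. Qed.

End test_function_rV.

(** * Unique continuation *)

Section product_sigma_finite.
Context d1 d2 (T1 : measurableType d1) (T2 : measurableType d2) (R : realType).
Variables (m1 : {sigma_finite_measure set T1 -> \bar R}).
Variables (m2 : {sigma_finite_measure set T2 -> \bar R}).

Lemma product_measure1_sigma_finite : sigma_finite setT (product_measure1 m1 m2).
Proof.
have /sigma_finiteP[F [TF ndF Foo]] := sigma_finiteT m1.
have /sigma_finiteP[G [TG ndG Goo]] := sigma_finiteT m2.
exists (fun k => F k `*` G k).
  rewrite -setXTT TF TG predeqE => -[x y]; split.
    move=> [/= [k _ Fkx] [l _ Gly]]; exists (maxn k l) => //; split.
    - by move: x Fkx; exact/subsetPset/ndF/leq_maxl.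
    - by move: y Gly; exact/subsetPset/ndG/leq_maxr.
  by move=> [k _ []/= ? ?]; split; exists k.
move=> k; have [? ?] := Foo k; have [? ?] := Goo k.
split; first exact: measurableX.
by rewrite product_measure1E// lte_mul_pinfty// ge0_fin_numE.
Qed.

(* An alias of [m1 \x m2], which is a sigma-finite measure in the library only when
   [m1] and [m2] are finite. *)
Definition sfprod : set (T1 * T2) -> \bar R := product_measure1 m1 m2.

HB.instance Definition _ := Measure.copy sfprod (product_measure1 m1 m2).

HB.instance Definition _ := Measure_isSigmaFinite.Build _ _ _
  sfprod product_measure1_sigma_finite.

End product_sigma_finite.

(** * Vanishing moments and exponential series *)

Section moments.
Context d (X : measurableType d) (R : realType) (nu : {sigma_finite_measure set X -> \bar R}).
Implicit Types (Phi lam g : X -> R).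
Local Notation leb := (@lebesgue_measure R).

Lemma L1_boundedM_on Phi g k : L1 nu Phi -> measurable_fun setT g ->
  (forall x, Phi x != 0 -> `|g x| <= k) -> L1 nu (fun x => g x * Phi x).
Proof.
move=> iPhi mg gk; apply: (L1_le _ (L1Z k (L1_norm iPhi))).
  by apply: measurable_funM => //; exact: L1_measurable iPhi.
move=> x; have [->|/gk] := eqVneq (Phi x) 0; first by rewrite mulr0 normr0 mulr0.
by rewrite normrM; apply: ler_wpM2r.
Qed.

(** Up to the sign [(-1)^m], the remainder differs from the exponential by a polynomial in [lam],
    which integrates to 0 against [Phi]. *)
Lemma exp_rem_moments Phi lam (t : R) m : measurable_fun setT lam ->
  L1 nu (fun x => expR (- (lam x * t)) * Phi x) ->
  (forall j, L1 nu (fun x => lam x ^+ j * Phi x)) ->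
  (forall j, \int[nu]_x (lam x ^+ j * Phi x) = 0) ->
  L1 nu (fun x => exp_rem m (lam x * t) * Phi x) /\
  \int[nu]_x (exp_rem m (lam x * t) * Phi x) =
  (-1) ^+ m * \int[nu]_x (expR (- (lam x * t)) * Phi x).
Proof.
move=> mlam ie ij Ij; elim: m => [|m [i e]]; first by rewrite expr0 mul1r.
have E x : exp_rem m.+1 (lam x * t) * Phi x =
    (t ^+ m / m`!%:R) * (lam x ^+ m * Phi x) - exp_rem m (lam x * t) * Phi x.
  by rewrite /= exprMn; ring.
under eq_fun do rewrite E; split; first by apply: L1B => //; exact: L1Z.
by rewrite RintegralTB//; [rewrite RintegralTZ// Ij mulr0 sub0r e exprS mulN1r mulNr|exact: L1Z].
Qed.

Lemma fact_pow_cvg0 (x : R) : x ^+ m / m`!%:R @[m --> \oo] --> (0 : R).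
Proof. by have := cvg_series_cvg_0 (@is_cvg_series_exp_coeff R x). Qed.

Lemma exp_rem_le m (t : R) : 0 <= t -> 0 <= exp_rem m t <= t ^+ m / m`!%:R.
Proof.
have ge0 k : 0 <= t -> 0 <= exp_rem k t.
  rewrite le_eqVlt => /predU1P[<-|t0]; last by rewrite ltW// exp_rem_gt0.
  by case: k => [|k]; [rewrite expR_ge0|rewrite exp_rem0].
move=> t0; rewrite ge0//= -subr_ge0; have := ge0 m.+1 t0.
by rewrite /=.
Qed.

(** By [exp_rem_moments] the exponential may be replaced by any of its Taylor remainders; the one of
    order [m] is at most [(b t)^m / m!] on the support of [Phi], which tends to 0. *)
Lemma moments_exp Phi lam (b t : R) : L1 nu Phi -> measurable_fun setT lam ->
  (forall x, Phi x != 0 -> 0 <= lam x <= b) -> 0 <= t ->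
  (forall k, \int[nu]_x (lam x ^+ k * Phi x) = 0) ->
  \int[nu]_x (expR (- (lam x * t)) * Phi x) = 0.
Proof.
move=> iPhi mlam lamb t0 Ik.
have ik k : L1 nu (fun x => lam x ^+ k * Phi x).
  apply: (@L1_boundedM_on _ _ (b ^+ k)) => //; first exact: measurable_funX.
  by move=> x /lamb/andP[l0 lb]; rewrite ger0_norm ?exprn_ge0// lerXn2r ?nnegrE ?(le_trans l0).
have ie : L1 nu (fun x => expR (- (lam x * t)) * Phi x).
  apply: (@L1_boundedM_on _ _ 1) => //.
    apply: measurableT_comp; first exact: measurable_expR.
    by apply: measurable_funN; apply: measurable_funM.
  move=> x /lamb/andP[l0 _]; rewrite ger0_norm ?expR_ge0// -expR0 ler_expR oppr_le0.
  by rewrite mulr_ge0.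
set I := \int[nu]_x _.
have bound m : `|I| <= ((b * t) ^+ m / m`!%:R) * \int[nu]_x `|Phi x|.
  have [i e] := exp_rem_moments m mlam ie ik Ik.
  have -> : `|I| = `|\int[nu]_x (exp_rem m (lam x * t) * Phi x)|.
    by rewrite e normrM normrX normrN1 expr1n mul1r.
  rewrite -RintegralTZ; last exact: L1_norm.
  apply: le_trans (le_normr_Rintegral measurableT _) _; first exact: i.
  apply: le_RintegralT; [exact: L1_norm|by apply: L1Z; exact: L1_norm|].
  move=> x /=; rewrite normrM; have [->|/lamb/andP[l0 lb]] := eqVneq (Phi x) 0.
    by rewrite normr0 !mulr0.
  apply: ler_wpM2r => //; have /andP[r0 r1] := exp_rem_le m (mulr_ge0 l0 t0).
  rewrite ger0_norm// (le_trans r1)// ler_wpM2r ?invr_ge0//.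
  by apply: lerXn2r; rewrite ?nnegrE ?mulr_ge0 ?(le_trans l0 lb)//; exact: ler_wpM2r.
have c0 : (b * t) ^+ m / m`!%:R * \int[nu]_x `|Phi x| @[m --> \oo] --> (0 : R).
  rewrite -[X in _ --> X](mul0r (\int[nu]_x `|Phi x|)).
  by apply: cvgM; [exact: fact_pow_cvg0|exact: cvg_cst].
by have := ge_cvgn c0 bound; rewrite normr_le0 => /eqP.
Qed.

(* [e^{-t lam}] is a series of powers of [lam], and its Mellin transform in [t] is a
   negative power of [lam]. *)
Lemma moments_neg Phi lam (a b al : R) : L1 nu Phi -> measurable_fun setT lam ->
  0 < a -> 0 < al -> (forall x, Phi x != 0 -> a <= lam x <= b) ->
  (forall k, \int[nu]_x (lam x `^ (al + k%:R) * Phi x) = 0) ->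
  forall j, \int[nu]_x (lam x `^ (- j%:R) * Phi x) = 0.
Proof.
move=> iPhi mlam a0 al0 lamab Ik j.
have mp p : measurable_fun setT (fun x => lam x `^ p) by exact: (measurableT_comp (measurable_powR p)).
have lam0 x : Phi x != 0 -> 0 < lam x by move=> /lamab/andP[+ _]; exact: lt_le_trans.
pose Psi x := lam x `^ al * Phi x.
have Psi0 x : Psi x != 0 -> Phi x != 0 by rewrite mulf_eq0 negb_or => /andP[].
have iPsi : L1 nu Psi.
  apply: (@L1_boundedM_on _ _ (b `^ al)) => // x Px; have /andP[la lb] := lamab x Px.
  have l0 := lam0 x Px; rewrite ger0_norm ?powR_ge0// ge0_ler_powR ?nnegrE//; first exact: ltW.
  - exact: ltW.
  - by rewrite (le_trans (ltW l0)).
have exp0 (t : R) : 0 <= t -> \int[nu]_x (expR (- (lam x * t)) * Psi x) = 0.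
  move=> t0; apply: (moments_exp (b := b)) => //.
    by move=> x /Psi0 Px; have /andP[_ ->] := lamab x Px; rewrite ltW// lam0.
  move=> k; rewrite -[RHS](Ik k); apply: eq_Rintegral => x _; rewrite /Psi mulrA.
  have [->|Px] := eqVneq (Phi x) 0; first by rewrite !mulr0.
  have l0 := lam0 x Px; rewrite [lam x `^ (al + _)]powRD; last by rewrite (gt_eqF l0) implybT.
  by rewrite powR_mulrn ?ltW// [lam x ^+ k * _]mulrC.
(* At the Mellin exponent [al + j], the factor [lam^al] in [Psi] cancels and [lam^(-j)] remains. *)
have [me pe] := mellin_exp (ltr_wpDr (ler0n R j) al0).
have E x : lam x `^ (- (al + j%:R)) * Psi x = lam x `^ (- j%:R) * Phi x.
  rewrite /Psi mulrA; have [->|Px] := eqVneq (Phi x) 0; first by rewrite !mulr0.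
  rewrite -powRD; last by rewrite (gt_eqF (lam0 x Px)) implybT.
  by congr (_ `^ _ * _); ring.
have iE : L1 nu (fun x => lam x `^ (- (al + j%:R)) * Psi x).
  under eq_fun do rewrite E.
  apply: (@L1_boundedM_on _ _ (a `^ (- j%:R))) => // x Px; have /andP[la lb] := lamab x Px.
  rewrite ger0_norm ?powR_ge0// !powRN lef_pV2 ?posrE ?powR_gt0//; last exact: lam0.
  by rewrite ge0_ler_powR ?nnegrE// ltW// lam0.
have mex : measurable_fun setT (fun t : R => expR (- t)).
  by apply: measurableT_comp => //; exact: measurable_expR.
have := mellin_fubini mex (fun t _ => expR_ge0 (- t)) me mlam (L1_measurable iPsi)
  (fun x Px => lam0 x (Psi0 x Px)) iE.
rewrite [X in _ = _ * X -> _](eq_Rintegral _ (fun x _ => E x)).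
rewrite (_ : \int[leb]_t _ = 0).
  by move=> /esym/eqP; rewrite mulf_eq0 (gt_eqF pe) => /eqP.
rewrite -[RHS](@Rintegral0 _ (measurableTypeR R) R leb); apply: eq_Rintegral => t _.
rewrite /mellin_wt; case: ltP => t0; last first.
  by under eq_Rintegral do rewrite mul0r; rewrite Rintegral0.
under eq_Rintegral do rewrite -mulrA.
rewrite RintegralTZ ?exp0 ?mulr0 ?ltW//.
apply: (@L1_boundedM_on _ _ 1) => //.
  by apply: (measurableT_comp mex); exact: measurable_funM.
move=> x /Psi0/lam0 l0; rewrite ger0_norm ?expR_ge0// -expR0 ler_expR oppr_le0.
by rewrite mulr_ge0// ltW.
Qed.

End moments.

(** * The two Mellin transforms of the heat pairing *)

Section ucp.
Context {R : realType} {n : nat}.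
Local Notation Rn := 'rV[R]_n.
Local Notation mu := (@lebesgue_rV R n).
Local Notation leb := (@lebesgue_measure R).
Local Notation mm := (sfprod mu mu).
Implicit Types (w chi : Rn -> R) (U : set Rn).

Definition sqd (z : Rn * Rn) : R := dotv (z.1 - z.2) (z.1 - z.2).

Lemma measurable_sqd : measurable_fun setT sqd.
Proof.
rewrite /sqd /dotv; apply: measurable_sum => i.
have m : measurable_fun setT (fun z : Rn * Rn => (z.1 - z.2) ord0 i).
  under eq_fun do rewrite !mxE; apply: measurable_funB.
    by apply: (measurableT_comp (measurable_coord i)); exact: measurable_fst.
  by apply: (measurableT_comp (measurable_coord i)); exact: measurable_snd.
exact: measurable_funM.
Qed.

Lemma measurable_dotv_self : measurable_fun setT (fun x : Rn => dotv x x).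
Proof. by rewrite /dotv; apply: measurable_sum => i; apply: measurable_funM; exact: measurable_coord. Qed.

(** Parseval's identity for [w] and [(-Delta)^k chi], the latter being again supported in [U], where
    [w] vanishes. *)
Lemma spectral_moments U w chi : L1 mu w -> L2 mu w -> Cc_infty U chi ->
  (forall x, U x -> w x = 0) -> forall k,
  L1 mu (fun xi => dotv xi xi ^+ k * (hartley w xi * hartley chi xi)) /\
  \int[mu]_xi (dotv xi xi ^+ k * (hartley w xi * hartley chi xi)) = 0.
Proof.
move=> w1 w2 Cchi Uw k.
have Ck := Cc_infty_neg_laplacian k Cchi; have [c1 c2] := Cc_infty_L12 Ck.
have E xi : dotv xi xi ^+ k * (hartley w xi * hartley chi xi) =
    hartley w xi * hartley (iter k neg_laplacian chi) xi.
  by rewrite (hartley_neg_laplacian _ _ Cchi); ring.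
under eq_fun do rewrite E.
split; first by apply: L2_L1M; [exact: (plancherel_L1 w1 w2).1|exact: (plancherel_L1 c1 c2).1].
rewrite -[LHS]/(ip mu (hartley w) (hartley (iter k neg_laplacian chi))) plancherel_L1_ip//.
rewrite (_ : ip _ _ _ = 0) ?mulr0// -[RHS](@Rintegral0 _ _ _ mu); apply: eq_Rintegral => x _.
have [Ux|Ux] := pselect (U x); first by rewrite Uw ?mul0r.
by rewrite (Cc_infty_eq0 Ck Ux) mulr0.
Qed.

(** For an integer [N >= q], the power [|xi|^(2q)] is at most [1 + |xi|^(2N)]. *)
Lemma L1_powR_spectral w chi q : 0 <= q ->
  (forall k, L1 mu (fun xi => dotv xi xi ^+ k * (hartley w xi * hartley chi xi))) ->
  L1 mu (fun xi => dotv xi xi `^ q * (hartley w xi * hartley chi xi)).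
Proof.
move=> q0 ik; have [N qN] := natr_ge q.
have i0 := ik 0; have iN := ik N.
have mP : measurable_fun setT (fun xi : Rn => hartley w xi * hartley chi xi).
  by have := L1_measurable i0; under eq_fun do rewrite expr0 mul1r.
apply: (L1_le _ (L1D (L1_norm i0) (L1_norm iN))).
  by apply: measurable_funM => //; apply: (measurableT_comp (measurable_powR q)); exact: measurable_dotv_self.
move=> xi; rewrite expr0 mul1r !normrM; set P := _ * `|_|.
have P0 : 0 <= P by rewrite mulr_ge0.
have l0 := dotv_ge0 xi; rewrite (ger0_norm (powR_ge0 _ _)) (ger0_norm (exprn_ge0 _ _))//.
rewrite -[X in X + _]mul1r -mulrDl ler_wpM2r//.
have [l1|/ltW l1] := leP (dotv xi xi) 1.
  rewrite ler_wpDr ?exprn_ge0//.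
  by have := ge0_ler_powR q0 (l0 : _ \is Num.nneg) (ler01 : (1 : R) \is Num.nneg) l1; rewrite powR1.
by rewrite ler_wpDl// -powR_mulrn//; apply: ler_powR.
Qed.

Lemma frac_moments U w s chi : 0 < s ->
  (forall chi, Cc_infty U chi ->
    \int[mu]_xi (dotv xi xi `^ s * (hartley w xi * hartley chi xi)) = 0) ->
  Cc_infty U chi -> forall k : nat,
  \int[mu]_xi (dotv xi xi `^ (s + k%:R) * (hartley w xi * hartley chi xi)) = 0.
Proof.
move=> s0 H Cchi k; rewrite -[RHS](H _ (Cc_infty_neg_laplacian k Cchi)).
apply: eq_Rintegral => xi _; rewrite (hartley_neg_laplacian _ _ Cchi).
rewrite powRD; last by rewrite gt_eqF// ltr_wpDr.
by rewrite powR_mulrn ?dotv_ge0//; ring.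
Qed.

(** With [N] the integer part of [s + k], strictly below it because [s] is not an integer, the
    Mellin transform of [exp_rem N.+1] at [-(s + k)] converges. By [mellin_fubini] it produces a
    multiple of the moment of order [s + k], which is 0; by [exp_rem_moments] the remainder can be
    traded for the exponential. *)
Lemma heat_moments U w s chi k : 0 < s -> s \isn't a Num.int -> L1 mu w -> L2 mu w ->
  (forall chi, Cc_infty U chi ->
    \int[mu]_xi (dotv xi xi `^ s * (hartley w xi * hartley chi xi)) = 0) ->
  (forall x, U x -> w x = 0) -> Cc_infty U chi ->
  \int[leb]_t mellin_wt (- (s + k%:R)) (fun t =>
    \int[mu]_xi (expR (- (t * dotv xi xi)) * (hartley w xi * hartley chi xi))) t = 0.
Proof.
move=> s0 sint w1 w2 H Uw Cchi.
pose P xi := hartley w xi * hartley chi xi.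
have sm := spectral_moments w1 w2 Cchi Uw.
have FM := frac_moments s0 H Cchi k.
pose N := (Num.truncn s + k)%N.
have qN : N%:R < s + k%:R < N.+1%:R.
  have /andP[a b] := Num.Theory.truncn_itv (ltW s0).
  rewrite /N -addSn !natrD ltrD2r ltrD2r b andbT lt_neqAle a andbT.
  by apply: contraNneq sint => <-; exact: natr_int.
have [i0 p0] := mellin_exp_rem qN.
(* At [xi = 0] the condition [0 < lam] of [mellin_fubini] fails, so the density is set to 0 there;
   this changes nothing, as the powers and the remainder involved vanish at [|xi| = 0]. The sign
   compensates that of [exp_rem_moments]. *)
pose Q xi := if dotv xi xi == 0 then 0 else (-1) ^+ N.+1 * P xi.
have mP : measurable_fun setT P.
  by have := L1_measurable (sm 0).1; under eq_fun do rewrite expr0 mul1r.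
have mQ : measurable_fun setT Q.
  apply: measurable_fun_ifT => //; last by apply: measurable_funM.
  apply: measurable_fun_eqr => //; exact: measurable_dotv_self.
have qneq0 : s + k%:R != 0 by rewrite gt_eqF// ltr_wpDr.
have EQ q xi : q != 0 -> dotv xi xi `^ q * Q xi = (-1) ^+ N.+1 * (dotv xi xi `^ q * P xi).
  move=> q0; rewrite /Q; case: eqP => [->|_]; last by ring.
  by rewrite powR0// !mul0r mulr0.
have ip0 : L1 mu (fun xi => dotv xi xi `^ (s + k%:R) * P xi).
  apply: L1_powR_spectral => [|j]; first by rewrite addr_ge0// ltW.
  exact: (sm j).1.
have iQ : L1 mu (fun xi => dotv xi xi `^ (- - (s + k%:R)) * Q xi).
  by under eq_fun do rewrite opprK (EQ _ _ qneq0); exact: L1Z.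
have Q0 xi : Q xi != 0 -> 0 < dotv xi xi.
  rewrite /Q; have [_|d0 _] := eqVneq (dotv xi xi) 0; first by rewrite eqxx.
  by rewrite lt0r d0 dotv_ge0.
have := mellin_fubini (measurable_exp_rem N.+1) (fun t t0 => ltW (exp_rem_gt0 N.+1 t0)) i0
  measurable_dotv_self mQ Q0 iQ.
have -> : \int[mu]_xi (dotv xi xi `^ (- - (s + k%:R)) * Q xi) = 0.
  under eq_Rintegral do rewrite opprK (EQ _ _ qneq0).
  by rewrite RintegralTZ// FM mulr0.
rewrite mulr0 => <-; apply: eq_Rintegral => t _.
rewrite /mellin_wt; case: ltP => t0; last first.
  by under [RHS]eq_Rintegral do rewrite mul0r; rewrite Rintegral0.
have ie : L1 mu (fun xi => expR (- (dotv xi xi * t)) * P xi).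
  apply: (@L1_boundedM_on _ _ _ mu _ _ 1).
  - by have := (sm 0).1; under eq_fun do rewrite expr0 mul1r.
  - apply: measurableT_comp; first exact: measurable_expR.
    by apply: measurable_funN; apply: measurable_funM => //; exact: measurable_dotv_self.
  - move=> xi _; rewrite ger0_norm ?expR_ge0// -expR0 ler_expR oppr_le0.
    by rewrite mulr_ge0 ?dotv_ge0// ltW.
have [ier eer] := exp_rem_moments N.+1 measurable_dotv_self ie (fun j => (sm j).1) (fun j => (sm j).2).
under [RHS]eq_Rintegral do rewrite -mulrA.
have EE xi : exp_rem N.+1 (dotv xi xi * t) * Q xi =
    (-1) ^+ N.+1 * (exp_rem N.+1 (dotv xi xi * t) * P xi).
  rewrite /Q; case: eqP => [->|_]; last by ring.
  by rewrite mul0r exp_rem0 !mul0r mulr0.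
under [in RHS]eq_Rintegral do rewrite EE.
rewrite RintegralTZ; last exact: L1Z.
congr (_ * _); rewrite RintegralTZ// eer mulrA -exprD -signr_odd oddD addbb expr0 mul1r.
by apply: eq_Rintegral => xi _; rewrite [t * _]mulrC.
Qed.

Lemma L1_heat chi t x : 0 < t -> L1 mu chi -> L1 mu (fun y => chi y * heat_kernel t (x - y)).
Proof.
move=> t0 c1; apply: (L1_boundedM (k := Num.sqrt (pi / t) ^+ n)) => //.
  apply: (measurableT_comp (measurable_heat_kernel t)).
  apply: measurable_fun_rV => i; under eq_fun do rewrite !mxE.
  by apply: measurable_funB => //; exact: measurable_coord.
by move=> y; exact: heat_kernel_le.
Qed.

(** In terms of [lam = |x - y|^(-2)], the heat kernel is [pi^(n/2) t^(-n/2) e^(-1 / (4 lam t))]. The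
    factor [t^(-n/2)] shifts the Mellin exponent from [-q] to [-(q + n/2)], and [mellin_fubini]
    produces the power [q + n/2] of [lam]. The lower bound [a] on the squared distance keeps this
    power bounded. *)
Lemma pair_moments w chi (a b q : R) : L1 mu w -> L1 mu chi -> 0 < a -> 0 < q ->
  (forall x y, w x != 0 -> chi y != 0 -> a <= sqd (x, y) <= b) ->
  \int[leb]_t mellin_wt (- q) (fun t =>
     \int[mu]_x (w x * \int[mu]_y (chi y * heat_kernel t (x - y)))) t = 0 ->
  \int[mm]_z ((sqd z `^ (-1)) `^ (q + n%:R / 2) * (w z.1 * chi z.2)) = 0.
Proof.
move=> w1 c1 a0 q0 wab.
pose K : R := pi `^ (n%:R / 2).
have K0 : 0 < K by rewrite powR_gt0// pi_gt0.
pose Phi (z : Rn * Rn) := K * (w z.1 * chi z.2).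
have iP : L1 mm (fun z => w z.1 * chi z.2) := L1_prod w1 c1.
have iPhi : L1 mm Phi by exact: L1Z.
pose lam z := sqd z `^ (-1).
have mlam : measurable_fun setT lam by apply: (measurableT_comp (measurable_powR (-1))); exact: measurable_sqd.
have Pab z : Phi z != 0 -> a <= sqd z <= b.
  by case: z => x y; rewrite /Phi !mulf_eq0 !negb_or => /and3P[_ wx cy]; exact: wab.
have Plam z : Phi z != 0 -> 0 < sqd z /\ lam z = (sqd z)^-1.
  move=> /Pab/andP[az _]; have z0 := lt_le_trans a0 az; split => //.
  by rewrite /lam powR_inv1// ltW.
have lam0 z : Phi z != 0 -> 0 < lam z by move=> /Plam[z0 ->]; rewrite invr_gt0.
pose q' := - (q + n%:R / 2).
have q'0 : q' < 0 by rewrite oppr_lt0 ltr_wpDr// divr_ge0.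
have [im pm] := mellin_heat q'0.
have il : L1 mm (fun z => lam z `^ (- q') * Phi z).
  apply: (@L1_boundedM_on _ _ _ mm _ _ (a^-1 `^ (- q'))) => //.
    exact: (measurableT_comp (measurable_powR (- q'))).
  move=> z Pz; have [z0 ez] := Plam z Pz; have /andP[az _] := Pab z Pz.
  have le1 : lam z <= a^-1 by rewrite ez lef_pV2 ?posrE.
  rewrite ger0_norm ?powR_ge0//; apply: ge0_ler_powR => //; first by rewrite oppr_ge0 ltW.
    by rewrite nnegrE ltW// lam0.
  by rewrite nnegrE invr_ge0 ltW.
have m : measurable_fun setT (fun t : R => expR (- (4 * t) `^ (-1))).
  apply: measurableT_comp; first exact: measurable_expR.
  apply: measurable_funN; apply: (measurableT_comp (measurable_powR (-1))).
  exact: measurable_funM.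
have F := mellin_fubini m (fun t _ => expR_ge0 _) im mlam (L1_measurable iPhi) lam0 il.
move=> I0; move: F; rewrite (_ : \int[leb]_t _ = 0).
  move=> /esym/eqP; rewrite mulf_eq0 (gt_eqF pm) /= /Phi.
  under eq_Rintegral do rewrite mulrCA; rewrite RintegralTZ.
    by rewrite mulf_eq0 (gt_eqF K0) /= opprK => /eqP.
  have := L1Z K^-1 il; apply: eq_integrable => // z _ /=; congr EFin.
  by rewrite /Phi; field; rewrite gt_eqF.
rewrite -[RHS]I0; apply: eq_Rintegral => t _; rewrite /mellin_wt.
case: ltP => t0; last by under eq_Rintegral do rewrite mul0r; rewrite Rintegral0.
under eq_Rintegral do rewrite -mulrA.
pose E (z : Rn * Rn) := expR (- (4 * (lam z * t)) `^ (-1)).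
have mE : measurable_fun setT E.
  by apply: (measurableT_comp m); apply: measurable_funM.
have E1 z : `|E z| <= 1.
  by rewrite ger0_norm ?expR_ge0// -expR0 ler_expR oppr_le0 powR_ge0.
have iE : L1 mm (fun z => E z * Phi z) by apply: (@L1_boundedM_on _ _ _ mm _ _ 1).
rewrite (RintegralTZ _ iE).
have hk z : Phi z != 0 -> heat_kernel t (z.1 - z.2) = K * t `^ (- (n%:R / 2)) * E z.
  move=> Pz; have [z0 ez] := Plam z Pz.
  rewrite /heat_kernel /E ez powR_inv1; last by rewrite !mulr_ge0 ?invr_ge0 ?ltW.
  rewrite -/(sqd z); congr (_ * expR (- _)); last by field; rewrite !gt_eqF.
  have pt : 0 <= pi / t by rewrite divr_ge0 ?pi_ge0// ltW.
  rewrite -powR12_sqrt// -powR_mulrn ?powR_ge0// -powRrM powRM ?pi_ge0 ?invr_ge0 ?ltW//.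
  rewrite -(powR_inv1 (ltW t0)) -powRrM /K.
  by congr (_ `^ _ * _ `^ _); ring.
have ihk : L1 mm (fun z => w z.1 * chi z.2 * heat_kernel t (z.1 - z.2)).
  apply: (L1_boundedM (k := Num.sqrt (pi / t) ^+ n)) => //.
    apply: (measurableT_comp (measurable_heat_kernel t)).
    apply: measurable_fun_rV => i; under eq_fun do rewrite !mxE; apply: measurable_funB.
      by apply: (measurableT_comp (measurable_coord i)); exact: measurable_fst.
    by apply: (measurableT_comp (measurable_coord i)); exact: measurable_snd.
  by move=> z; exact: heat_kernel_le.
have -> : \int[mu]_x (w x * \int[mu]_y (chi y * heat_kernel t (x - y))) =
    \int[mm]_z (w z.1 * chi z.2 * heat_kernel t (z.1 - z.2)).
  rewrite -(Rfubini1 ihk).2; apply: eq_Rintegral => x _.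
  rewrite -RintegralTZ; first by apply: eq_Rintegral => y _ /=; rewrite mulrA.
  exact: L1_heat.
have -> : \int[mm]_z (w z.1 * chi z.2 * heat_kernel t (z.1 - z.2)) =
    \int[mm]_z (t `^ (- (n%:R / 2)) * (E z * Phi z)).
  apply: eq_Rintegral => z _; have [Pz|Pz] := eqVneq (Phi z) 0.
    rewrite Pz !mulr0; move: Pz; rewrite /Phi => /eqP; rewrite mulf_eq0 (gt_eqF K0) /= => /eqP ->.
    by rewrite mul0r.
  by rewrite hk// /Phi; ring.
rewrite RintegralTZ// mulrA -powRD; last by rewrite (gt_eqF t0) implybT.
by congr (_ `^ _ * _); rewrite /q'; ring.
Qed.

End ucp.

(** * Functions that are polynomial on every line *)

Section line_polynomials.
Context {R : realType} {n : nat}.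
Local Notation Rn := 'rV[R]_n.
Implicit Types (b : Rn -> R).

(** Continuity is needed for testing against bumps, polynomiality along lines for continuation from
    an open set; both survive sums and products, and multivariate polynomials are avoided. *)
Definition poly_like b := continuous b /\
  forall y z, exists P : {poly R}, forall t, b (y + t *: z) = P.[t].

Lemma poly_like_cst c : poly_like (fun=> c).
Proof.
split; first exact: continuous_cst.
by move=> y z; exists c%:P => t; rewrite hornerC.
Qed.

Lemma poly_like_coord i : poly_like (fun y : Rn => y ord0 i).
Proof.
split; first exact: continuous_coord.
move=> y z; exists ((y ord0 i)%:P + 'X * (z ord0 i)%:P) => t.
by rewrite !hornerE !mxE.
Qed.

Lemma poly_likeD b1 b2 : poly_like b1 -> poly_like b2 -> poly_like (fun y => b1 y + b2 y).
Proof.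
move=> [c1 p1] [c2 p2]; split; first exact: continuous_add.
move=> y z; have [P1 e1] := p1 y z; have [P2 e2] := p2 y z.
by exists (P1 + P2) => t; rewrite hornerD e1 e2.
Qed.

Lemma poly_likeM b1 b2 : poly_like b1 -> poly_like b2 -> poly_like (fun y => b1 y * b2 y).
Proof.
move=> [c1 p1] [c2 p2]; split; first exact: continuous_mul.
move=> y z; have [P1 e1] := p1 y z; have [P2 e2] := p2 y z.
by exists (P1 * P2) => t; rewrite hornerM e1 e2.
Qed.

(** On the line from [y0] to [y] the function is a polynomial [P] in the parameter [t], with the
    roots [e / (k + 1)], which stay close to [y0]; taking [size P] of them forces [P = 0], and
    [t = 1] is the point [y]. *)
Lemma poly_like_eq0 (U : set Rn) b y0 : poly_like b -> open U -> U y0 ->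
  (forall y, U y -> b y = 0) -> forall y, b y = 0.
Proof.
move=> [_ bp] oU Uy0 bU y; have [P PE] := bp y0 (y - y0).
have [e e0 eU] : exists2 e : R, 0 < e & forall t, `|t| <= e -> U (y0 + t *: (y - y0)).
  have /nbhs_ballP[r /= r0 rU] : nbhs y0 U by exact: open_nbhs_nbhs.
  have d0 : 0 < `|y - y0| + 1 by rewrite ltr_wpDl.
  exists (r / (`|y - y0| + 1)); first by rewrite divr_gt0.
  move=> t te; apply: rU; rewrite -ball_normE /ball_/= opprD addNKr normrN normrZ.
  apply: (@le_lt_trans _ _ (r / (`|y - y0| + 1) * `|y - y0|)); first exact: ler_wpM2r.
  by rewrite mulrAC ltr_pdivrMr// ltr_pM2l// ltrDl.
suff P0 : P = 0 by rewrite -[y](subrKC y0) -[y - y0]scale1r PE P0 horner0.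
apply: (@roots_geq_poly_eq0 _ _ [seq e / k.+1%:R | k <- iota 0 (size P)]).
- apply/allP => _ /mapP[k _ ->]; rewrite /root -PE; apply/eqP; apply: bU; apply: eU.
  by rewrite ger0_norm ?divr_ge0 ?(ltW e0)// ler_pdivrMr// ler_pMr// ler1n.
- rewrite map_inj_uniq ?iota_uniq// => k l /(mulfI (lt0r_neq0 e0)) /invr_inj /eqP.
  by rewrite eqr_nat => /eqP[].
- by rewrite size_map size_iota.
Qed.

End line_polynomials.

(** * Positive moments and vanishing of the function *)

Section ucp_final.
Context {R : realType} {n : nat}.
Local Notation Rn := 'rV[R]_n.
Local Notation mu := (@lebesgue_rV R n).
Local Notation mm := (sfprod mu mu).

Lemma continuous_bounded_ball (a : Rn -> R) (M : R) : continuous a ->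
  exists k, forall x, `|x| <= M -> `|a x| <= k.
Proof.
move=> ca; pose K := [set x : Rn | `|x| <= M].
have cK : compact K.
  apply: bounded_closed_compact.
    exists M; split; first by rewrite num_real.
    by move=> B MB x /= xM; rewrite (le_trans xM)// ltW.
  apply: (@preimage_closed _ _ (fun x : Rn => `|x|) [set x | x <= M]); last exact: closed_le.
  by move=> x _; exact: (@norm_continuous _ Rn).
have := @continuous_compact _ _ a K (continuous_subspaceT ca) cK.
move=> /compact_bounded[c [_ ac]]; exists (c + 1) => x xM.
by apply: ac; [rewrite ltrDl|exists x].
Qed.

Section compact_moments.
Variables (w : Rn -> R) (M : R).
Hypothesis w1 : L1 mu w.
Hypothesis wM : forall x, w x != 0 -> `|x| <= M.

Lemma L1_compactM (a : Rn -> R) : continuous a -> L1 mu (fun x => w x * a x).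
Proof.
move=> ca; have [k ak] := continuous_bounded_ball M ca.
under eq_fun do rewrite mulrC.
apply: (L1_boundedM_on w1 (continuous_measurable_rV ca) (k := k)).
by move=> x /wM; exact: ak.
Qed.

(* The factor [a] makes the class stable under multiplication by functions of [x] alone. *)
Definition sep_kernel (G : Rn -> Rn -> R) := forall a : Rn -> R, continuous a ->
  (forall y, L1 mu (fun x => w x * (a x * G x y))) /\
  poly_like (fun y => \int[mu]_x (w x * (a x * G x y))).

Lemma sep_kernel1 : sep_kernel (fun _ _ => 1).
Proof.
move=> a ca; under eq_fun do rewrite mulr1; split; last exact: poly_like_cst.
by move=> y; apply: L1_compactM.
Qed.

Lemma sep_kernelMl G (a : Rn -> R) : continuous a -> sep_kernel G -> sep_kernel (fun x y => a x * G x y).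
Proof.
move=> ca sG a' ca'; have [i p] := sG _ (continuous_mul ca' ca).
split=> [y|]; first by apply: eq_integrable (i y) => // x _ /=; rewrite !mulrA.
suff -> : (fun y => \int[mu]_x (w x * (a' x * (a x * G x y)))) =
  (fun y => \int[mu]_x (w x * (a' x * a x * G x y))) by [].
by apply/funext => y; apply: eq_Rintegral => x _; rewrite !mulrA.
Qed.

Lemma sep_kernelMr G b : poly_like b -> sep_kernel G -> sep_kernel (fun x y => b y * G x y).
Proof.
move=> pb sG a ca; have [i p] := sG _ ca.
have E x y : w x * (a x * (b y * G x y)) = b y * (w x * (a x * G x y)) by ring.
split=> [y|]; first by under eq_fun do rewrite E; exact: L1Z.
suff -> : (fun y => \int[mu]_x (w x * (a x * (b y * G x y)))) =
  (fun y => b y * \int[mu]_x (w x * (a x * G x y))) by exact: poly_likeM.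
by apply/funext => y; rewrite -RintegralTZ//; apply: eq_Rintegral => x _; rewrite E.
Qed.

Lemma sep_kernelD G1 G2 : sep_kernel G1 -> sep_kernel G2 ->
  sep_kernel (fun x y => G1 x y + G2 x y).
Proof.
move=> s1 s2 a ca; have [i1 p1] := s1 _ ca; have [i2 p2] := s2 _ ca.
have E x y : w x * (a x * (G1 x y + G2 x y)) = w x * (a x * G1 x y) + w x * (a x * G2 x y).
  by ring.
split=> [y|]; first by under eq_fun do rewrite E; exact: L1D.
suff -> : (fun y => \int[mu]_x (w x * (a x * (G1 x y + G2 x y)))) =
  (fun y => \int[mu]_x (w x * (a x * G1 x y)) + \int[mu]_x (w x * (a x * G2 x y))).
  exact: poly_likeD.
by apply/funext => y; rewrite -RintegralTD//; apply: eq_Rintegral => x _; rewrite E.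
Qed.

(** Each [(x_i - y_i)^2] expands into [x_i^2 - 2 x_i y_i + y_i^2], products of a function of [x] and
    a function of [y]. *)
Lemma sep_kernel_sqd G : sep_kernel G -> sep_kernel (fun x y => sqd (x, y) * G x y).
Proof.
move=> sG.
have S (s : seq 'I_n) : sep_kernel (fun x y =>
    (\sum_(i <- s) (x ord0 i - y ord0 i) * (x ord0 i - y ord0 i)) * G x y).
  elim: s => [|i s IH].
    have := sep_kernelMl (@continuous_cst _ _ (0 : R)) sG.
    by congr sep_kernel; apply/funext => x; apply/funext => y; rewrite big_nil.
  have cx := @continuous_coord R n i; have py := @poly_like_coord R n i.
  have s1 := sep_kernelMl (continuous_mul cx cx) sG.
  have s2 := sep_kernelMl (continuous_mul (@continuous_cst _ _ (-2 : R)) cx) (sep_kernelMr py sG).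
  have s3 := sep_kernelMr (poly_likeM py py) sG.
  have := sep_kernelD (sep_kernelD (sep_kernelD s1 s2) s3) IH.
  congr sep_kernel; apply/funext => x; apply/funext => y.
  by rewrite big_cons /=; ring.
have := S (index_enum 'I_n); congr sep_kernel; apply/funext => x; apply/funext => y.
by rewrite /sqd /dotv; congr (_ * _); apply: eq_bigr => i _; rewrite !mxE.
Qed.

Lemma poly_like_moment j :
  (forall y, L1 mu (fun x => w x * sqd (x, y) ^+ j)) /\
  poly_like (fun y => \int[mu]_x (w x * sqd (x, y) ^+ j)).
Proof.
have S : sep_kernel (fun x y => sqd (x, y) ^+ j).
  elim: j => [|j IH].
    by under eq_fun do under eq_fun do rewrite expr0; exact: sep_kernel1.
  by under eq_fun do under eq_fun do rewrite exprS; exact: sep_kernel_sqd.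
have [i p] := S _ (@continuous_cst _ _ 1).
split; first by move=> y; have := i y; under eq_fun do rewrite mul1r.
by move: p; under eq_fun do under eq_Rintegral do rewrite mul1r.
Qed.

End compact_moments.

Lemma continuous_sqd (y : Rn) : continuous (fun x : Rn => sqd (x, y)).
Proof.
have -> : (fun x : Rn => sqd (x, y)) = fun x =>
    \sum_(i < n) (x ord0 i - y ord0 i) * (x ord0 i - y ord0 i).
  by apply/funext => x; rewrite /sqd /dotv; apply: eq_bigr => i _; rewrite !mxE.
elim: (index_enum _) => [|i s IH].
  by under eq_fun do rewrite big_nil; exact: continuous_cst.
under eq_fun do rewrite big_cons.
apply: continuous_add => //.
by apply: continuous_mul; apply: continuous_add;
  [exact: continuous_coord|exact: continuous_cst|exact: continuous_coord|exact: continuous_cst].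
Qed.

Lemma sqd_ge0 z : 0 <= @sqd R n z.
Proof. exact: dotv_ge0. Qed.

(** The bounds [a] and [b] keep all powers of the squared distance, of either sign, bounded on the
    support of [w(x) chi(y)]; every double integral below is therefore absolutely convergent. *)
Lemma unique_continuation (U : set Rn) (y0 : Rn) (w : Rn -> R) (M a b s : R) :
  0 < s -> s \isn't a Num.int -> open U -> U y0 -> L2 mu w ->
  (forall x, w x != 0 -> `|x| <= M) ->
  0 < a -> a <= b -> (forall x y, w x != 0 -> U y -> a <= sqd (x, y) <= b) ->
  (forall chi, Cc_infty U chi ->
    \int[mu]_xi (dotv xi xi `^ s * (hartley w xi * hartley chi xi)) = 0) ->
  {ae mu, forall x, w x = 0}.
Proof.
move=> s0 sint oU Uy0 w2 wM a0 ab wab H.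
have w1 : L1 mu w.
  have mb := measurable_ball_rV (0 : Rn) (M + 1).
  have := L2_L1M w2 (L2_indic mb (ball_lty 0 (M + 1))); apply: eq_integrable => // x _ /=.
  have [->|/wM xM] := eqVneq (w x) 0; first by rewrite mul0r.
  rewrite indicE mem_set ?mulr1//= -ball_normE /ball_/= sub0r normrN.
  by rewrite (le_lt_trans xM)// ltrDl.
have Uw x : U x -> w x = 0.
  move=> Ux; apply/eqP/negPn/negP => wx; have /andP[+ _] := wab x x wx Ux.
  by rewrite /sqd subrr /dotv big1 ?leNgt ?a0// => i _; rewrite mxE mul0r.
have Q j y : \int[mu]_x (w x * sqd (x, y) ^+ j) = 0.
  have [im pm] := poly_like_moment w1 wM j.
  apply: (poly_like_eq0 pm oU Uy0) => {}y Uy.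
  apply: (test_functions_separate oU pm.1 _ Uy) => chi Cchi.
  have [c1 c2] := Cc_infty_L12 Cchi.
  have cU y' : chi y' != 0 -> U y'.
    by move=> cy; apply: contrapT => /(Cc_infty_eq0 Cchi) c0; rewrite c0 eqxx in cy.
  have wab' x y' : w x != 0 -> chi y' != 0 -> a <= sqd (x, y') <= b.
    by move=> wx /cU; exact: wab.
  pose Phi (z : Rn * Rn) := w z.1 * chi z.2.
  have iPhi : L1 mm Phi by exact: L1_prod.
  have Pab z : Phi z != 0 -> a <= sqd z <= b.
    by case: z => x y'; rewrite /Phi mulf_eq0 negb_or => /andP[]; exact: wab'.
  have E k : \int[mm]_z ((sqd z `^ (-1)) `^ (s + n%:R / 2 + k%:R) * Phi z) = 0.
    rewrite (_ : s + n%:R / 2 + k%:R = s + k%:R + n%:R / 2); last by ring.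
    apply: (pair_moments w1 c1 a0 _ wab'); first by rewrite ltr_wpDr.
    rewrite -[RHS](heat_moments k s0 sint w1 w2 H Uw Cchi).
    apply: eq_Rintegral => t _; rewrite /mellin_wt; case: ltP => // t0.
    by rewrite (hartley_gauss t0 w1 c1).2.
  have mlam : measurable_fun setT (fun z : Rn * Rn => sqd z `^ (-1)).
    by apply: (measurableT_comp (measurable_powR (-1))); exact: measurable_sqd.
  have b0 : 0 < b by exact: lt_le_trans ab.
  have Plam z : Phi z != 0 -> b^-1 <= sqd z `^ (-1) <= a^-1.
    move=> Pz; have /andP[az zb] := Pab z Pz; have z0 := lt_le_trans a0 az.
    by rewrite powR_inv1 ?(ltW z0)// !lef_pV2 ?posrE// az zb.
  have al0 : 0 < s + n%:R / 2 by rewrite ltr_wpDr// divr_ge0.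
  have bV : 0 < b^-1 by rewrite invr_gt0.
  (* Here [lam] is the inverse of the squared distance, so its negative powers are the positive
     powers of the squared distance. *)
  have := moments_neg iPhi mlam bV al0 Plam E j.
  have EP z : (sqd z `^ (-1)) `^ (- j%:R) * Phi z = Phi z * sqd z ^+ j.
    have [->|Pz] := eqVneq (Phi z) 0; first by rewrite mulr0 mul0r.
    rewrite -powRrM mulN1r opprK powR_mulrn ?sqd_ge0// mulrC //.
  under eq_Rintegral do rewrite EP.
  have iF : L1 mm (fun z => Phi z * sqd z ^+ j).
    under eq_fun do rewrite mulrC; apply: (L1_boundedM_on iPhi (k := b ^+ j)).
      by apply: measurable_funX; exact: measurable_sqd.
    move=> z /Pab/andP[az zb]; rewrite ger0_norm ?exprn_ge0 ?sqd_ge0//.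
    by apply: lerXn2r => //; rewrite nnegrE ?sqd_ge0// ltW.
  have [_ e] := Rfubini2 iF; rewrite -[\int[mm]_z _]e => {e} <-.
  apply: eq_Rintegral => y' _; rewrite mulrC -RintegralTZ//.
  by apply: eq_Rintegral => x _; rewrite /Phi /=; ring.
have G y t : 0 <= t -> \int[mu]_x (w x * expR (- (sqd (x, y) * t))) = 0.
  move=> t0; have [k yk] := continuous_bounded_ball M (@continuous_sqd y).
  under eq_Rintegral do rewrite mulrC.
  apply: (moments_exp (b := k)) => //.
  - by apply: continuous_measurable_rV; exact: continuous_sqd.
  - by move=> x /wM/yk; rewrite ger0_norm ?sqd_ge0.
  - by move=> j; rewrite -[RHS](Q j y); apply: eq_Rintegral => x _; rewrite mulrC.
(* The heat pairing of [w] with itself at time 1 vanishes in its space form, by [G] at [t = 1/4]. In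
   frequency it is the integral of [e^(-|xi|^2) (hartley w xi)^2], so [hartley w] is 0 almost
   everywhere. *)
have [iG eG] := hartley_gauss ltr01 w1 w1.
have G0 : \int[mu]_xi (expR (- (1 * dotv xi xi)) * (hartley w xi * hartley w xi)) = 0.
  rewrite eG -[RHS](@Rintegral0 _ _ _ mu); apply: eq_Rintegral => x _.
  rewrite (_ : \int[mu]_y _ = Num.sqrt (pi / 1) ^+ n * \int[mu]_y (w y * expR (- (sqd (y, x) * 4^-1)))).
    by rewrite G ?mulr0// invr_ge0.
  rewrite -RintegralTZ; last first.
    apply: (L1_compactM w1 wM) => y; apply: continuous_comp; last exact: continuous_expR.
    apply: continuous_opp; apply: continuous_mul; last exact: continuous_cst.
    exact: continuous_sqd.
  apply: eq_Rintegral => y _; rewrite /heat_kernel mulrCA mulr1 /sqd /=.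
  by rewrite -opprB dotvNl dotvNr opprK.
have [LH eH] := plancherel_L1 w1 w2.
have C0 := @hartley_const_gt0 R n.
apply: sqn_eq0 => //.
have : sqn mu (hartley w) = 0.
  have -> : sqn mu (hartley w) = sqn mu (fun=> 0).
    apply: sqn_ae; have := ge0_ae0 iG _ G0.
    move=> /(_ (fun xi => mulr_ge0 (expR_ge0 _) (sqr_ge0 (hartley w xi)))).
    apply: filterS => xi /eqP; rewrite mulf_eq0 gt_eqF ?expR_gt0//=.
    by rewrite mulf_eq0 orbb => /eqP.
  by rewrite /sqn; under eq_Rintegral do rewrite expr0n; rewrite Rintegral0.
by rewrite eH => /eqP; rewrite mulf_eq0 (gt_eqF C0) => /eqP.
Qed.

End ucp_final.

(** * Test functions of time *)

Section time_test_functions.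
Context {R : realType}.
Local Notation leb := (@lebesgue_measure R).

Lemma Rintegral_supp (D : set R) (g : R -> R) : (forall t, ~ D t -> g t = 0) ->
  \int[leb]_(t in D) g t = \int[leb]_t g t.
Proof.
move=> gD; rewrite /Rintegral; congr fine; rewrite integral_mkcond; apply: eq_integral => t _.
by rewrite patchE; case: ifPn => //; rewrite notin_setE => /gD ->.
Qed.

Lemma L1_compact_supp_real (a b : R) (g : R -> R) : continuous g ->
  (forall t, ~ (`]a, b[%classic : set R) t -> g t = 0) -> L1 leb g.
Proof.
move=> cg gab.
have : leb.-integrable `[a, b] (EFin \o g).
  apply: continuous_compact_integrable; first exact: segment_compact.
  exact: continuous_subspaceT.
move=> /integrable_mkcond -/(_ (measurable_itv _)); apply: eq_integrable => // t _.
rewrite patchE /=; case: ifPn => //; rewrite notin_setE => tab; rewrite gab// => tab'.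
by apply: tab; move: tab'; rewrite /= !in_itv/= => /andP[/ltW -> /ltW ->].
Qed.

Definition bumpR (t0 r t : R) : R := bump1 (r^-1 * (t - t0)).

Lemma Cc_infty_bumpR (T t0 r : R) : 0 < r -> 0 < t0 - r -> t0 + r < T ->
  @Cc_infty R R^o (`]0, T[) (bumpR t0 r).
Proof.
move=> r0 t0r rT.
have S : supp (bumpR t0 r : R^o -> R) `<=` `[t0 - r, t0 + r].
  apply: supp_sub; first exact: interval_closed.
  move=> t /bump1_neq0; rewrite normrM normfV (gtr0_norm r0) ltr_pdivrMl// mulr1.
  by rewrite ltr_norml /= in_itv/= => /andP[a b]; apply/andP; split; lra.
split.
- apply: (@smooth_comp_affine R R^o R^o (fun t => r^-1 * (t - t0)) (fun t => r^-1 * t) _ _ bump1).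
  + by move=> h x v; rewrite /GRing.scale/=; ring.
  + apply: continuous_mul; first exact: continuous_cst.
    by apply: continuous_add; [move=> x; exact: cvg_id|exact: continuous_cst].
  + exact: smooth_bump1.
- by apply: subclosed_compact S; [exact: supp_closed|exact: segment_compact].
- apply: (subset_trans S) => t; rewrite /= !in_itv/= => /andP[a b].
  by apply/andP; split; lra.
Qed.

Lemma test_functions_separate_real (T : R) (f : R -> R) : continuous f ->
  (forall eta, @Cc_infty R R^o (`]0, T[) eta -> \int[leb]_(t in `]0, T[) (f t * eta t) = 0) ->
  forall t, (`]0, T[%classic : set R) t -> f t = 0.
Proof.
have pos (g : R -> R) t : continuous g ->
    (forall eta, @Cc_infty R R^o (`]0, T[) eta -> \int[leb]_(t in `]0, T[) (g t * eta t) = 0) ->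
    (`]0, T[%classic : set R) t -> g t <= 0.
  move=> cg geta; rewrite /= in_itv/= => /andP[t0 tT]; rewrite leNgt; apply/negP => gt.
  have [r /and3P[r0 rt rT] rg] : exists2 r : R, [&& 0 < r, 0 < t - r & t + r < T] &
      forall x, `|x - t| < r -> 0 < g x.
    have gn := cvgr_gt _ (cg t) _ gt.
    have : \forall x \near t, 0 < g x by exact: gn.
    move=> /nbhs_ballP[e /= e0 eg].
    have m0 : 0 < Num.min e (Num.min t (T - t)) by rewrite !lt_min e0 t0 subr_gt0.
    exists (Num.min e (Num.min t (T - t)) / 2).
      have m1 : Num.min e (Num.min t (T - t)) <= t by rewrite !ge_min lexx orbT.
      have m2 : Num.min e (Num.min t (T - t)) <= T - t by rewrite !ge_min lexx !orbT.
      by apply/and3P; split; lra.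
    have m1 : Num.min e (Num.min t (T - t)) <= e by rewrite ge_min lexx.
    by move=> x xt; apply: eg; rewrite -ball_normE /ball_/= distrC; lra.
  have Cb := Cc_infty_bumpR r0 rt rT.
  have [sb _ _] := Cb; have cb := smooth_continuous sb.
  have gb0 x : 0 <= g x * bumpR t r x.
    have [->|b0] := eqVneq (bumpR t r x) 0; first by rewrite mulr0.
    rewrite mulr_ge0 ?bump1_ge0// ltW//; apply: rg.
    by have := bump1_neq0 b0; rewrite normrM normfV (gtr0_norm r0) ltr_pdivrMl// mulr1.
  have out x : ~ (`]0, T[%classic : set R) x -> g x * bumpR t r x = 0.
    by move=> /(Cc_infty_eq0 Cb) ->; rewrite mulr0.
  have cgb := continuous_mul cg cb.
  have igb := L1_compact_supp_real cgb out.
  have := geta _ Cb; rewrite (Rintegral_supp out) => /(ge0_ae0 igb gb0).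
  move=> [N [mN N0 gN]].
  have gbt : g t * bumpR t r t > 0 by rewrite mulr_gt0// /bumpR subrr mulr0 bump1_gt0.
  have gn := cvgr_gt _ (cgb t) _ gbt.
  have : \forall x \near t, 0 < g x * bumpR t r x by exact: gn.
  move=> /nbhs_ballP[e /= e0 eg].
  have : (leb (ball t e) <= leb N)%E.
    apply: le_measure; rewrite ?inE//; first exact: measurable_ball.
    by move=> x /eg gx; apply: gN => /=; apply/eqP; rewrite gt_eqF.
  rewrite (lebesgue_measure_ball _ (ltW e0)) => /le_trans; rewrite N0 => /(_ _ (lexx _)).
  by rewrite lee_fin leNgt mulr2n addr_gt0.
move=> cf feta t tT; apply/eqP; rewrite eq_le pos//= -oppr_le0.
apply: (pos (fun x => - f x)) => //; first exact: continuous_opp.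
move=> eta Ceta.
have out x : ~ (`]0, T[%classic : set R) x -> f x * eta x = 0.
  by move=> /(Cc_infty_eq0 Ceta) ->; rewrite mulr0.
have [se _ _] := Ceta.
have i := L1_compact_supp_real (continuous_mul cf (smooth_continuous se)) out.
rewrite Rintegral_supp; last by move=> x /out; rewrite mulNr => ->; rewrite oppr0.
under eq_Rintegral do rewrite mulNr.
by rewrite RintegralTN// -(Rintegral_supp out) feta ?oppr0.
Unshelve. all: by end_near. Qed.

(* Composition with [clamp T] extends functions on [[0, T]] continuously to the line. *)
Definition clamp (T t : R) : R := Num.min T (Num.max 0 t).

Lemma clamp_itv (T t : R) : 0 < T -> clamp T t \in `[0, T].
Proof.
by move=> T0; rewrite in_itv/= /clamp ge_min lexx le_min ltW//= le_max lexx.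
Qed.

Lemma clamp_id (T t : R) : t \in `[0, T] -> clamp T t = t.
Proof.
by rewrite in_itv/= => /andP[t0 tT]; rewrite /clamp (max_idPr t0) (min_idPr tT).
Qed.

Lemma clamp_dist (T t t' : R) : `|clamp T t - clamp T t'| <= `|t - t'|.
Proof.
have n1 := ler_norm (t - t'); have n2 := ler_norm (t' - t); rewrite distrC in n2.
rewrite /clamp /Num.min /Num.max ler_norml.
by case: (ltP 0 t) => ?; case: (ltP 0 t') => ?; do 2 case: ltP => ?; apply/andP; split; lra.
Qed.

(** [clamp T] does not increase distances and takes its values in [[0, T]]. The extended functions
    meet the continuity hypothesis of the separation lemmas. *)
Lemma continuous_clamp (T : R) (D : R -> R) : 0 < T ->
  (forall t, t \in `[0, T] -> D tau @[tau --> within `[0, T] (nbhs t)] --> D t) ->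
  continuous (fun t => D (clamp T t)).
Proof.
move=> T0 cD t; apply: (cvg_trans _ (cD _ (clamp_itv t T0))).
move=> A /= [e /= e0 eA].
exists e => //= t' tt'; apply: eA => /=.
  by rewrite (le_lt_trans (clamp_dist _ _ _)).
by rewrite /= clamp_itv.
Qed.

End time_test_functions.

Section product_test_functions.
Context {R : realType} {n : nat}.
Local Notation Rn := 'rV[R]_n.

Lemma Cc_infty_tensor (W : set Rn) (T : R) (chi : Rn -> R) (eta : R -> R) :
  Cc_infty W chi -> @Cc_infty R R^o (`]0, T[) eta ->
  Cc_infty (cylinder W T) (fun z : Rn * R => chi z.1 * eta z.2).
Proof.
move=> [sc cc cW] [se ce eT].
have S : supp (fun z : Rn * R => chi z.1 * eta z.2) `<=` supp chi `*` supp (eta : R^o -> R).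
  apply: supp_sub.
    have c1 := @preimage_closed _ _ (fst : Rn * R -> Rn) (supp chi) (fun x _ => cvg_fst) (@supp_closed _ _ chi).
    have c2 := @preimage_closed _ _ (snd : Rn * R -> R) (supp (eta : R^o -> R)) (fun x _ => cvg_snd) (@supp_closed _ _ (eta : R^o -> R)).
    exact: closedI (c1 _) (c2 _).
  by move=> [x t] /=; rewrite mulf_eq0 negb_or => /andP[xc te]; split; exact: sub_supp.
split.
- apply: smoothM.
    apply: (@smooth_comp_affine R (Rn * R)%type Rn fst fst _ _ chi) => //.
    by move=> z; exact: cvg_fst.
  apply: (@smooth_comp_affine R (Rn * R)%type R^o snd snd _ _ eta) => //.
  by move=> z; exact: cvg_snd.
- apply: subclosed_compact S; first exact: supp_closed.
  exact: compact_setX.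
- by apply: (subset_trans S) => -[x t] [/= /cW xW /eT tT].
Qed.

End product_test_functions.

(** * Fourier transform and fractional Laplacian *)

Section representatives.
Context {R : realType} {n : nat}.
Local Notation Rn := 'rV[R]_n.
Local Notation mu := (@lebesgue_rV R n).
Implicit Types (u v w h : Rn -> R).

(* [Lp 2 setT] only asks for measurability with respect to the completed sigma-algebra. *)
Definition l2rep u u' := L2 mu u' /\ {ae mu, forall x, u x = u' x}.

Lemma L2norm_integral u : L2norm u = ((\int[mu]_x ((u x) ^+ 2)%:E) `^ 2^-1)%E.
Proof.
rewrite /L2norm unlock; congr (_ `^ _)%E; apply: eq_integral => x _ /=.
by rewrite powR_mulrn// real_normK// num_real.
Qed.

Lemma L2norm_lty u : (L2norm u < +oo)%E -> (\int[mu]_x ((u x) ^+ 2)%:E < +oo)%E.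
Proof. by rewrite L2norm_integral => /lty_poweRy -> //; rewrite invr_neq0. Qed.

Lemma L2normE u g : L1 mu g -> {ae mu, forall x, u x ^+ 2 = g x} ->
  L2norm u = (Num.sqrt (\int[mu]_x g x))%:E.
Proof.
move=> ig ug; have g0 : {ae mu, forall x, 0 <= g x}.
  by apply: filterS ug => x <-; rewrite sqr_ge0.
rewrite L2norm_integral.
rewrite (@ae_eq_integralT _ _ _ mu _ (fun x => (g x)%:E)); last first.
  by apply: filterS ug => x ->.
rewrite -Rintegral_EFin// poweR12_sqrt//= lee_fin.
rewrite (@ae_eq_RintegralT _ _ _ mu _ (fun x => `|g x|)).
  by apply: Rintegral_ge0 => x _.
by apply: filterS g0 => x g0; rewrite ger0_norm.
Qed.

Lemma Lp2_l2rep u : Lp 2%:E setT u -> exists u', l2rep u u'.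
Proof.
move=> [[g mg ug] ufin]; exists g.
have {}ug : {ae mu, forall x, u x = g x} by apply: filterS ug => x; exact.
split=> //; split => //; apply: L1_ge0; first exact: measurable_funX.
- by move=> x; exact: sqr_ge0.
- rewrite patch_setT in ufin.
  rewrite -(@ge0_ae_eq_integralT _ _ _ mu (fun x => (u x ^+ 2)%:E)); first exact: L2norm_lty.
  + by move=> x; rewrite lee_fin sqr_ge0.
  + by move=> x; rewrite lee_fin sqr_ge0.
  + by apply: filterS ug => x ->.
Qed.

Lemma l2rep_Lp2 u u' : l2rep u u' -> Lp 2%:E setT u.
Proof.
move=> [[mu' iu'] uu']; split; first by exists u' => //; apply: filterS uu' => x.
rewrite patch_setT -/(L2norm u) (L2normE iu' _) ?ltry//.
by apply: filterS uu' => x ->.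
Qed.

Lemma l2rep_L2norm u u' : l2rep u u' -> L2norm u = (Num.sqrt (sqn mu u'))%:E.
Proof. by move=> [[mu' iu'] uu']; apply: L2normE => //; apply: filterS uu' => x ->. Qed.

Lemma L2_l2rep u : L2 mu u -> l2rep u u.
Proof. by move=> Lu; split => //; apply: nearW. Qed.

Lemma l2rep_lin a b u v u' v' : l2rep u u' -> l2rep v v' ->
  l2rep (fun x => a * u x + b * v x) (fun x => a * u' x + b * v' x).
Proof.
move=> [Lu uu'] [Lv vv']; split; first by apply: L2D; apply: L2Z.
by apply: filterS2 uu' vv' => x -> ->.
Qed.

Lemma l2repB u v u' v' : l2rep u u' -> l2rep v v' -> l2rep (u \- v) (fun x => u' x - v' x).
Proof.
move=> [Lu uu'] [Lv vv']; split; first exact: L2B.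
by apply: filterS2 uu' vv' => x /= -> ->.
Qed.

Lemma inner_l2rep u v u' v' : l2rep u u' -> l2rep v v' -> inner setT u v = ip mu u' v'.
Proof.
move=> [Lu uu'] [Lv vv']; apply: ae_eq_RintegralT.
by apply: filterS2 uu' vv' => x -> ->.
Qed.

End representatives.

Section fourier_hartley.
Context {R : realType} {n : nat}.
Local Notation Rn := 'rV[R]_n.
Local Notation mu := (@lebesgue_rV R n).
Implicit Types (u v w h : Rn -> R).

Definition evenp h (xi : Rn) : R := (h xi + h (- xi)) / 2.
Definition oddp h (xi : Rn) : R := (h xi - h (- xi)) / 2.

(* The Fourier transform recovered from the Hartley transform of a real function. *)
Definition fourier_of h (xi : Rn) : R[i] := Complex (evenp h xi) (- oddp h xi).

Lemma L2_reflect h : L2 mu h -> L2 mu (fun x => h (- x)) /\ sqn mu (fun x => h (- x)) = sqn mu h.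
Proof.
move=> [mh ih]; split; last exact: Rintegral_reflect ih.
split; last exact: L1_reflect ih.
exact: (measurableT_comp mh (@measurable_oppV R n)).
Qed.

Lemma L2_evenp h : L2 mu h -> L2 mu (evenp h) /\ sqn mu (evenp h) <= sqn mu h.
Proof.
move=> Lh; have [Lh' eh'] := L2_reflect Lh.
have E : evenp h = fun x => 2^-1 * (h x + h (- x)) by apply/funext => x; rewrite mulrC.
have LE : L2 mu (evenp h) by rewrite E; apply: L2Z; exact: L2D.
split => //; rewrite E sqnZ; last exact: L2D.
by have := sqn_leD Lh Lh'; rewrite eh'; lra.
Qed.

Lemma L2_oddp h : L2 mu h -> L2 mu (oddp h) /\ sqn mu (oddp h) <= sqn mu h.
Proof.
move=> Lh; have [Lh' eh'] := L2_reflect Lh.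
have E : oddp h = fun x => 2^-1 * (h x + (-1) * h (- x)).
  by apply/funext => x; rewrite /oddp mulN1r mulrC.
have LZ := L2Z (-1) Lh'.
have LE : L2 mu (oddp h) by rewrite E; apply: L2Z; exact: L2D.
split => //; rewrite E sqnZ; last exact: L2D.
by have := sqn_leD Lh LZ; rewrite sqnZ// eh'; lra.
Qed.

Lemma hartley_evenp f xi : L1 mu f ->
  evenp (hartley f) xi = \int[mu]_x (f x * cos (dotv x xi)) /\
  oddp (hartley f) xi = \int[mu]_x (f x * sin (dotv x xi)).
Proof.
move=> if_.
have m (t : R -> R) : continuous t -> measurable_fun setT (fun x : Rn => t (dotv x xi)).
  move=> ct; apply: (measurableT_comp (continuous_measurable_fun ct)).
  by rewrite /dotv; apply: measurable_sum => i; apply: measurable_funM => //; exact: measurable_coord.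
have ic : L1 mu (fun x => f x * cos (dotv x xi)).
  by apply: (L1_boundedM (k := 1)) => //; [exact: (m _ (@continuous_cos R))|move=> x; exact: cos_max].
have is_ : L1 mu (fun x => f x * sin (dotv x xi)).
  by apply: (L1_boundedM (k := 1)) => //; [exact: (m _ (@continuous_sin R))|move=> x; exact: sin_max].
have e1 : hartley f xi = \int[mu]_x (f x * cos (dotv x xi)) + \int[mu]_x (f x * sin (dotv x xi)).
  by rewrite -RintegralTD//; apply: eq_Rintegral => x _; rewrite /cas mulrDr.
have e2 : hartley f (- xi) = \int[mu]_x (f x * cos (dotv x xi)) - \int[mu]_x (f x * sin (dotv x xi)).
  rewrite -RintegralTB//; apply: eq_Rintegral => x _.
  by rewrite /cas dotvNr cosN sinN mulrBr.
by rewrite /evenp /oddp e1 e2; split; field.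
Qed.

Lemma fourier_truncE k u u' xi : l2rep u u' ->
  fourier_trunc k u xi = fourier_of (hartley (trunc k u')) xi.
Proof.
move=> [Lu uu']; have i := L1_trunc k Lu.
have [ec es] := hartley_evenp xi i.
have E (t : R -> R) : \int[mu]_(x in [set x | enorm x <= k%:R]) (u x * t (dotv x xi)) =
    \int[mu]_x (trunc k u' x * t (dotv x xi)).
  rewrite /Rintegral; congr fine; rewrite integral_mkcond; apply: ae_eq_integralT.
  apply: filterS uu' => x ux; rewrite patchE /trunc indicE /eball.
  by case: (x \in _); rewrite ?mulr1 ?ux// mulr0 mul0r.
by rewrite /fourier_trunc /fourier_of ec es !E.
Qed.

Lemma fourier_ofB h g xi :
  fourier_of h xi - fourier_of g xi = fourier_of (fun x => h x - g x) xi.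
Proof. by rewrite /fourier_of /evenp /oddp; congr Complex; field. Qed.

Lemma modulus_fourier_of h xi : modulus (fourier_of h xi) ^+ 2 = (h xi ^+ 2 + h (- xi) ^+ 2) / 2.
Proof.
rewrite /modulus sqr_sqrtr; last by rewrite addr_ge0// sqr_ge0.
by rewrite /= /evenp /oddp; field.
Qed.

(** By [modulus_fourier_of] the integrand is the squared modulus of [fourier_of h]. Integration is
    invariant under reflection, so L^2 norms can be computed from [h] alone. *)
Lemma L1_sqr_reflect h : L2 mu h ->
  L1 mu (fun xi => (h xi ^+ 2 + h (- xi) ^+ 2) / 2) /\
  \int[mu]_xi ((h xi ^+ 2 + h (- xi) ^+ 2) / 2) = sqn mu h.
Proof.
move=> Lh; have [Lh' eh'] := L2_reflect Lh.
have [_ i1] := Lh; have [_ i2] := Lh'.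
have E xi : (h xi ^+ 2 + h (- xi) ^+ 2) / 2 = 2^-1 * (h xi ^+ 2 + h (- xi) ^+ 2) by rewrite mulrC.
under eq_fun do rewrite E; have i := L1D i1 i2; split; first exact: L1Z.
rewrite RintegralTZ// RintegralTD// -/(sqn mu h) -/(sqn mu (fun x => h (- x))) eh'; lra.
Qed.

Lemma fourier_trunc_cvg u u' h : l2rep u u' -> is_hartley u' h ->
  L2norm (fun xi => modulus (fourier_trunc k u xi - fourier_of h xi)) @[k --> \oo] --> 0%E.
Proof.
move=> uu' [Lh ch]; have [Lu _] := uu'.
have E k : L2norm (fun xi => modulus (fourier_trunc k u xi - fourier_of h xi)) =
    (Num.sqrt (sqn mu (fun xi => hartley (trunc k u') xi - h xi)))%:E.
  have Ld := L2B (L2_hartley_trunc k Lu) Lh.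
  have [i e] := L1_sqr_reflect Ld; rewrite -e; apply: L2normE => //.
  apply: nearW => xi; rewrite (fourier_truncE _ _ uu') fourier_ofB.
  exact: modulus_fourier_of.
under eq_fun do rewrite E; apply: cvg_EFin; first exact: nearW.
by rewrite -(@sqrtr0 R); apply: continuous_cvg => //; exact: sqrt_continuous.
Qed.

Lemma is_fourier_of u u' h : l2rep u u' -> is_hartley u' h -> is_fourier u (fourier_of h).
Proof.
move=> uu' hh; have [Lh _] := hh; split; last exact: fourier_trunc_cvg uu' hh.
- exact: l2rep_Lp2 (L2_l2rep (L2_evenp Lh).1).
- apply: (@l2rep_Lp2 _ _ _ (fun xi => (-1) * oddp h xi)); split.
    by apply: L2Z; exact: (L2_oddp Lh).1.
  by apply: nearW => xi /=; rewrite mulN1r.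
Qed.

(** Real and imaginary parts of [U] and of [fourier_of h] are L^2 limits of the same even and odd
    parts of truncated transforms. [A] and [B] are Borel representatives of the two parts of [U]. *)
Lemma is_fourier_ae u u' h U : l2rep u u' -> is_hartley u' h -> is_fourier u U ->
  {ae mu, forall xi, U xi = fourier_of h xi}.
Proof.
move=> uu' [Lh ch] [/Lp2_l2rep[A [LA UA]] /Lp2_l2rep[B [LB UB]] cU]; have [Lu _] := uu'.
pose d k xi := hartley (trunc k u') xi.
have Ld k : L2 mu (d k) := L2_hartley_trunc k Lu.
pose G k xi := (evenp (d k) xi - A xi) ^+ 2 + (- oddp (d k) xi - B xi) ^+ 2.
have LE k := (L2_evenp (Ld k)).1; have LO k := L2Z (-1) (L2_oddp (Ld k)).1.
have iE k := (L2B (LE k) LA).2; have iO k := (L2B (LO k) LB).2.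
have iG k : L1 mu (G k).
  by apply: L1D => //; have := iO k; under eq_fun do rewrite mulN1r.
have eG k : L2norm (fun xi => modulus (fourier_trunc k u xi - U xi)) =
    (Num.sqrt (\int[mu]_xi G k xi))%:E.
  apply: L2normE => //; apply: filterS2 UA UB => xi UAx UBx.
  rewrite (fourier_truncE _ _ uu') /modulus sqr_sqrtr; last by rewrite addr_ge0// sqr_ge0.
  by move: UAx UBx; case: (U xi) => a b /= -> ->.
have cG : \int[mu]_xi G k xi @[k --> \oo] --> (0 : R).
  have G0 k : 0 <= \int[mu]_xi G k xi.
    by apply: Rintegral_ge0 => xi _; rewrite addr_ge0// sqr_ge0.
  have cs : Num.sqrt (\int[mu]_xi G k xi) @[k --> \oo] --> (0 : R).
    by move: cU; under eq_fun do rewrite eG; move=> /fine_cvg.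
  have -> : (fun k => \int[mu]_xi G k xi) =
      fun k => Num.sqrt (\int[mu]_xi G k xi) * Num.sqrt (\int[mu]_xi G k xi).
    by apply/funext => k; rewrite -expr2 sqr_sqrtr.
  by rewrite -[X in _ --> X](mulr0 (0 : R)); exact: cvgM.
have c0 (D : nat -> R) : (forall k, 0 <= D k) -> (forall k, D k <= \int[mu]_xi G k xi) ->
    D k @[k --> \oo] --> (0 : R).
  move=> D0 DG; apply: (@squeeze_cvgr _ _ _ _ (cst 0)); last first.
  - exact: cG.
  - exact: cvg_cst.
  - by apply: nearW => k; rewrite D0 DG.
have cA : cvgL2 mu (fun k => evenp (d k)) A.
  apply: c0 => k; first exact: sqn_ge0.
  by apply: le_RintegralT => // xi; rewrite lerDl sqr_ge0.
have cB : cvgL2 mu (fun k xi => (-1) * oddp (d k) xi) B.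
  apply: c0 => k; first exact: sqn_ge0.
  by apply: le_RintegralT => // xi; rewrite mulN1r lerDr sqr_ge0.
have cH (D : nat -> R) : (forall k, 0 <= D k) -> (forall k, D k <= sqn mu (fun xi => d k xi - h xi)) ->
    D k @[k --> \oo] --> (0 : R).
  move=> D0 DG; apply: (@squeeze_cvgr _ _ _ _ (cst 0)); last first.
  - exact: ch.
  - exact: cvg_cst.
  - by apply: nearW => k; rewrite D0 DG.
have cEh : cvgL2 mu (fun k => evenp (d k)) (evenp h).
  apply: cH => k; first exact: sqn_ge0.
  apply: le_trans (L2_evenp (L2B (Ld k) Lh)).2; rewrite le_eqVlt; apply/orP; left; apply/eqP.
  by apply: eq_Rintegral => xi _; rewrite /evenp; field.
have cOh : cvgL2 mu (fun k xi => (-1) * oddp (d k) xi) (fun xi => (-1) * oddp h xi).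
  apply: cH => k; first exact: sqn_ge0.
  apply: le_trans (L2_oddp (L2B (Ld k) Lh)).2; rewrite le_eqVlt; apply/orP; left; apply/eqP.
  by apply: eq_Rintegral => xi _; rewrite /oddp; field.
have eA := cvgL2_unique LE LA (L2_evenp Lh).1 cA cEh.
have eB := cvgL2_unique LO LB (L2Z (-1) (L2_oddp Lh).1) cB cOh.
apply: filterS2 (filterI UA UB) (filterI eA eB) => xi [UAx UBx] [Ah Bh].
move: UAx UBx; rewrite Ah Bh /fourier_of; case: (U xi) => a b /= -> ->.
by rewrite mulN1r.
Qed.

(** [fourier u] is an arbitrary choice among the functions satisfying [is_fourier u]; there is at
    least one, and all agree almost everywhere. *)
Lemma fourierE u u' h : l2rep u u' -> is_hartley u' h ->
  {ae mu, forall xi, fourier u xi = fourier_of h xi}.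
Proof.
move=> uu' hh; apply: (is_fourier_ae uu' hh).
have := @xgetPex _ (fun=> 0 : R[i]) [set U | is_fourier u U].
by apply; exists (fourier_of h); exact: is_fourier_of uu' hh.
Qed.

End fourier_hartley.

(** * Sobolev norms and the fractional Laplacian on the Hartley side *)

Section sobolev.
Context {R : realType} {n : nat}.
Local Notation Rn := 'rV[R]_n.
Local Notation mu := (@lebesgue_rV R n).
Implicit Types (u v w h g : Rn -> R) (s : R) (xi : Rn).

(** [riesz] and [bessel] are the multipliers of [(-Delta)^(s/2)] and of the H^s norm, acting on
    Hartley transforms. Their symbols are even, so they pass unchanged through [fourier_of]. *)
Definition riesz s h xi : R := enorm xi `^ s * h xi.
Definition bessel s h xi : R := (1 + enorm xi ^+ 2) `^ (s / 2) * h xi.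

Lemma enorm_powRE s xi : enorm xi `^ s = dotv xi xi `^ (s / 2).
Proof. by rewrite /enorm -powR12_sqrt ?dotv_ge0// -powRrM mulrC. Qed.

Lemma enorm_powR_sqr s xi : 0 < s -> enorm xi `^ s * enorm xi `^ s = dotv xi xi `^ s.
Proof.
move=> s0; by rewrite enorm_powRE -powRD -splitr// gt_eqF.
Qed.

Lemma measurable_riesz s h : measurable_fun setT h -> measurable_fun setT (riesz s h).
Proof.
move=> mh; apply: measurable_funM => //.
exact: (measurableT_comp (measurable_powR s) (@measurable_enorm R n)).
Qed.

Lemma measurable_bessel s h : measurable_fun setT h -> measurable_fun setT (bessel s h).
Proof.
move=> mh; apply: measurable_funM => //.
apply: (measurableT_comp (measurable_powR (s / 2))).
by apply: measurable_funD => //; apply: measurable_funX; exact: measurable_enorm.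
Qed.

Lemma fourier_of_riesz s h xi :
  fourier_of (riesz s h) xi = ((enorm xi `^ s)%:C * fourier_of h xi)%C.
Proof.
apply/eqP; rewrite eq_complex /= /evenp /oddp /riesz enormN.
by apply/andP; split; apply/eqP; field.
Qed.

Lemma L2_sqn_le (f g : Rn -> R) : measurable_fun setT f -> L2 mu g -> (forall x, `|f x| <= `|g x|) ->
  L2 mu f /\ sqn mu f <= sqn mu g.
Proof.
move=> mf Lg fg; have Lf := L2_le mf Lg fg; split => //.
apply: le_RintegralT; [exact: Lf.2|exact: Lg.2|move=> x].
by rewrite -[leLHS]real_normK ?num_real// -[leRHS]real_normK ?num_real// lerXn2r ?nnegrE.
Qed.

Lemma L2_bessel s h : 0 <= s -> measurable_fun setT h -> L2 mu (bessel s h) ->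
  [/\ L2 mu h, sqn mu h <= sqn mu (bessel s h), L2 mu (riesz s h) &
      sqn mu (riesz s h) <= sqn mu (bessel s h)].
Proof.
move=> s0 mh Lb.
have e1 xi : 1 <= 1 + enorm xi ^+ 2 by rewrite lerDl sqr_ge0.
have [|L1_ l1] := L2_sqn_le mh Lb.
  move=> xi; rewrite normrM ler_peMl// ger0_norm ?powR_ge0//.
  by have := ler_powR (e1 xi) (divr_ge0 s0 (ler0n R 2)); rewrite powRr0.
have [|L2_ l2] := L2_sqn_le (measurable_riesz s mh) Lb; last by split.
move=> xi; rewrite !normrM ler_wpM2r// !ger0_norm ?powR_ge0//.
rewrite enorm_powRE -enorm_sqr ge0_ler_powR ?nnegrE ?divr_ge0 ?sqr_ge0//.
  by rewrite addr_ge0 ?sqr_ge0.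
by rewrite lerDr.
Qed.

Lemma Hs_norm_density s u u' h : l2rep u u' -> is_hartley u' h -> {ae mu, forall xi,
  ((1 + enorm xi ^+ 2) `^ (s / 2) * modulus (fourier u xi)) ^+ 2 =
  (bessel s h xi ^+ 2 + bessel s h (- xi) ^+ 2) / 2}.
Proof.
move=> uu' hh; apply: filterS (fourierE uu' hh) => xi ->.
by rewrite exprMn modulus_fourier_of /bessel enormN !exprMn; field.
Qed.

Lemma Hs_normE s u u' h : l2rep u u' -> is_hartley u' h -> L2 mu (bessel s h) ->
  Hs_norm s u = (Num.sqrt (sqn mu (bessel s h)))%:E.
Proof.
move=> uu' hh Lb; have [i e] := L1_sqr_reflect Lb; rewrite -e.
exact: L2normE i (Hs_norm_density s uu' hh).
Qed.

Lemma Hs_norm_lty s u u' h : l2rep u u' -> is_hartley u' h -> (Hs_norm s u < +oo)%E ->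
  L2 mu (bessel s h).
Proof.
move=> uu' hh /L2norm_lty fin; have [[mh _] _] := hh.
have mb := measurable_bessel s mh.
have mb' : measurable_fun setT (fun xi => bessel s h (- xi)).
  exact: (measurableT_comp mb (@measurable_oppV R n)).
have i : L1 mu (fun xi => (bessel s h xi ^+ 2 + bessel s h (- xi) ^+ 2) / 2).
  apply: L1_ge0.
  - by apply: measurable_funM => //; apply: measurable_funD; exact: measurable_funX.
  - by move=> xi; rewrite divr_ge0// addr_ge0// sqr_ge0.
  - apply: le_lt_trans fin; rewrite le_eqVlt; apply/orP; left; apply/eqP.
    apply: ae_eq_integralT; apply: filterS (Hs_norm_density s uu' hh) => xi e.
    by rewrite -e.
split => //; apply: (L1_le _ (L1Z 2 i)); first exact: measurable_funX.
move=> xi; rewrite ger0_norm ?sqr_ge0//; have := sqr_ge0 (bessel s h (- xi)); lra.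
Qed.

Lemma Hs_rep s u : Hs s u -> exists u' h,
  [/\ l2rep u u', is_hartley u' h & L2 mu (bessel s h)].
Proof.
move=> [/Lp2_l2rep[u' uu'] fin]; have [h hh] := is_hartley_ex uu'.1.
by exists u', h; split => //; exact: (Hs_norm_lty uu' hh fin).
Qed.

(** The estimates are made on the Hartley side, where the multipliers are linear; [(2 pi)^n] is the
    Plancherel constant. *)
Lemma Hs_diff s u v u' v' h g : 0 <= s -> l2rep u u' -> is_hartley u' h -> L2 mu (bessel s h) ->
  l2rep v v' -> is_hartley v' g -> L2 mu (bessel s g) ->
  [/\ (fine (Hs_norm s (u \- v))) ^+ 2 = sqn mu (bessel s (fun xi => h xi - g xi)),
   sqn mu (fun x => u' x - v' x) <= ((2 * pi) ^+ n)^-1 * (fine (Hs_norm s (u \- v))) ^+ 2 &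
   sqn mu (riesz s (fun xi => h xi - g xi)) <= (fine (Hs_norm s (u \- v))) ^+ 2].
Proof.
move=> s0 uu' hh Lh vv' hg Lg.
have E (a b : Rn -> R) : (fun x => 1 * a x + (-1) * b x) = (fun x => a x - b x).
  by apply/funext => x; rewrite mul1r mulN1r.
have hd := is_hartley_lin 1 (-1) uu'.1 vv'.1 hh hg; rewrite !E in hd.
have rd := l2repB uu' vv'.
have Lb : L2 mu (bessel s (fun xi => h xi - g xi)).
  have -> : bessel s (fun xi => h xi - g xi) = fun xi => bessel s h xi - bessel s g xi.
    by apply/funext => xi; rewrite /bessel mulrBr.
  exact: L2B.
have [_ l1 _ l2] := L2_bessel s0 (L2_measurable hd.1) Lb.
have e : (fine (Hs_norm s (u \- v))) ^+ 2 = sqn mu (bessel s (fun xi => h xi - g xi)).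
  by rewrite (Hs_normE rd hd Lb) /= sqr_sqrtr// sqn_ge0.
split => //; rewrite e //.
have C0 := @hartley_const_gt0 R n.
by rewrite -ler_pdivrMl ?invr_gt0// invrK -(is_hartley_sqn rd.1 hd).
Qed.

(** A fractional Laplacian exists because the Hartley transform is onto L^2; hence the chosen
    [frac_laplacian] satisfies its specification, a Fourier identity from which the Hartley
    transform is read off. *)
Lemma frac_laplacian_hartley s u u' h : l2rep u u' -> is_hartley u' h -> L2 mu (riesz s h) ->
  exists w, l2rep (frac_laplacian (s / 2) u) w /\ is_hartley w (riesz s h).
Proof.
move=> uu' hh Lr.
have s2 : 2 * (s / 2) = s by field.
have [w Lw hw] := is_hartley_surj Lr; have ww := L2_l2rep Lw.
have := @xgetPex _ (fun=> 0 : R) [set w | is_frac_laplacian (s / 2) u w].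
case=> [|/Lp2_l2rep[w' rw']].
  exists w; split; first exact: l2rep_Lp2 ww.
  rewrite s2; apply: filterS2 (fourierE ww hw) (fourierE uu' hh) => xi -> ->.
  exact: fourier_of_riesz.
rewrite -/(frac_laplacian _ _) s2 in rw' * => wf.
exists w'; split; first exact: rw'.
have [h' hh'] := is_hartley_ex rw'.1.
apply: (is_hartley_aer hh'); first exact: L2_measurable Lr.
apply: filterS2 (filterI (fourierE rw' hh') (fourierE uu' hh)) wf => xi [-> ->].
rewrite -fourier_of_riesz => -[e1 e2].
(* The Hartley transform is the real part minus the imaginary part of the Fourier transform. *)
have ev (k : Rn -> R) : k xi = evenp k xi - - oddp k xi by rewrite /evenp /oddp; field.
by rewrite [LHS]ev [RHS]ev e1 e2.
Qed.

Lemma inner_frac_laplacian s u v u' v' h g : 0 < s ->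
  l2rep u u' -> is_hartley u' h -> L2 mu (riesz s h) ->
  l2rep v v' -> is_hartley v' g -> L2 mu (riesz s g) ->
  inner setT (frac_laplacian (s / 2) u) (frac_laplacian (s / 2) v) =
  ((2 * pi) ^+ n)^-1 * ip mu (riesz s h) (riesz s g).
Proof.
move=> s0 uu' hh Lh vv' hg Lg.
have [a [ra ha]] := frac_laplacian_hartley uu' hh Lh.
have [b [rb hb]] := frac_laplacian_hartley vv' hg Lg.
rewrite (inner_l2rep ra rb) (is_hartley_ip ra.1 rb.1 ha hb) mulKf//.
by rewrite gt_eqF// hartley_const_gt0.
Qed.

(** For an integer [N >= s / 2], [|xi|^s <= 1 + |xi|^(2N)], and [|xi|^(2N)] times the transform of
    [chi] is the transform of [(-Delta)^N chi]. *)
Lemma L2_riesz_test s (U : set Rn) chi : 0 <= s -> Cc_infty U chi -> L2 mu (riesz s (hartley chi)).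
Proof.
move=> s0 Cchi; have [c1 c2] := Cc_infty_L12 Cchi.
have [N sN] := natr_ge (s / 2).
have [d1 d2] := Cc_infty_L12 (Cc_infty_neg_laplacian N Cchi).
have LH := (plancherel_L1 c1 c2).1; have LN := (plancherel_L1 d1 d2).1.
have Ln (f : Rn -> R) : L2 mu f -> L2 mu (fun x => `|f x|).
  move=> Lf; apply: (L2_le _ Lf) => [|x]; last by rewrite normr_id.
  by apply: measurableT_comp => //; exact: L2_measurable Lf.
apply: (L2_le _ (L2D (Ln _ LH) (Ln _ LN))).
  by apply: measurable_riesz; exact: L2_measurable LH.
move=> xi; rewrite (hartley_neg_laplacian _ _ Cchi) [leRHS]ger0_norm ?addr_ge0//.
rewrite !normrM (ger0_norm (exprn_ge0 _ (dotv_ge0 _))) (ger0_norm (powR_ge0 _ _)).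
rewrite -[X in X + _]mul1r -mulrDl ler_wpM2r// enorm_powRE.
have l0 := dotv_ge0 xi; have s20 : 0 <= s / 2 by rewrite divr_ge0.
have [l1|/ltW l1] := leP (dotv xi xi) 1.
  rewrite ler_wpDr ?exprn_ge0//.
  by have := ge0_ler_powR s20 (l0 : _ \is Num.nneg) (ler01 : (1 : R) \is Num.nneg) l1; rewrite powR1.
by rewrite ler_wpDl// -powR_mulrn//; apply: ler_powR.
Qed.

End sobolev.

(** * Solutions *)

Section slices.
Context d1 d2 (T1 : measurableType d1) (T2 : measurableType d2) (R : realType).
Variables (m1 : {sigma_finite_measure set T1 -> \bar R}).
Variables (m2 : {sigma_finite_measure set T2 -> \bar R}).

(** Tonelli's theorem for the indicator of the exceptional null set. *)
Lemma ae_slice2 (P : T1 * T2 -> Prop) : {ae (m1 \x m2)%E, forall z, P z} ->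
  {ae m2, forall y, {ae m1, forall x, P (x, y)}}.
Proof.
move=> [N [mN N0 PN]].
have : (\int[m2]_y (m1 \o ysection N) y = 0)%E.
  have := @indic_fubini_tonelli _ _ _ _ R m1 m2 N mN.
  by rewrite indic_fubini_tonelli_FE// indic_fubini_tonelli_GE// => <-.
have mG := measurable_fun_ysection m1 mN.
move=> I0; have : (\int[m2]_y `|(m1 \o ysection N) y| = 0)%E.
  by rewrite -[RHS]I0; apply: eq_integral => y _; rewrite gee0_abs.
move/((ae_eq_integral_abs m2 measurableT mG).1); apply: filterS => y /(_ Logic.I) /= y0.
exists (ysection N y); split => //; first exact: measurable_ysection.
by move=> x /= Px; rewrite /ysection /= inE; apply: PN.
Qed.

End slices.

Section time_continuity.
Context {R : realType} {n : nat}.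
Local Notation Rn := 'rV[R]_n.
Local Notation mu := (@lebesgue_rV R n).
Local Notation leb := (@lebesgue_measure R).
Implicit Types (u w : Rn * R -> R) (chi v : Rn -> R).

Lemma cvg_within_le (T K : R) (D : R -> R) (N : R -> \bar R) t :
  (forall tau, tau \in `[0, T] -> `|D tau - D t| <= K * fine (N tau)) ->
  N tau @[tau --> within `[0, T] (nbhs t)] --> 0%E ->
  D tau @[tau --> within `[0, T] (nbhs t)] --> D t.
Proof.
move=> DN cN.
have c0 : K * fine (N tau) @[tau --> within `[0, T] (nbhs t)] --> (0 : R).
  rewrite -[X in _ --> X](mulr0 K); apply: cvgM; first exact: cvg_cst.
  exact: (fine_cvg cN).
apply/cvgrPdist_le => e e0; near=> tau.
rewrite distrC; apply: (@le_trans _ _ (K * fine (N tau))).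
  by apply: DN; near: tau; exact: withinT.
apply: le_trans (ler_norm _) _; rewrite -[X in `|X|]subr0 distrC.
by near: tau; move/cvgrPdist_le : c0; exact.
Unshelve. all: by end_near. Qed.

Lemma normr_le_sqr (a b : R) : 0 <= b -> a ^+ 2 <= b ^+ 2 -> `|a| <= b.
Proof. by move=> b0 ab; rewrite -(ler_pXn2r (n := 2)) ?nnegrE// real_normK ?num_real. Qed.

Definition energy_pairing s u chi (t : R) : R :=
  inner setT (frac_laplacian (s / 2) (slice u t)) (frac_laplacian (s / 2) chi).

Lemma Cc_infty_hartley (U : set Rn) chi : Cc_infty U chi ->
  l2rep chi chi /\ is_hartley chi (hartley chi).
Proof.
move=> Cchi; have [c1 c2] := Cc_infty_L12 Cchi.
by split; [exact: L2_l2rep|exact: is_hartley_L1].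
Qed.

(** By Parseval and Cauchy-Schwarz the pairing is Lipschitz in the H^s norm, with constant
    [(2 pi)^(-n)] times the L^2 norm of [riesz s (hartley chi)]. *)
Lemma energy_pairing_cvg (s T : R) (U : set Rn) u chi t : 0 < s ->
  continuous_in_time T (Hs s) (Hs_norm s) u -> Cc_infty U chi -> t \in `[0, T] ->
  energy_pairing s u chi tau @[tau --> within `[0, T] (nbhs t)] --> energy_pairing s u chi t.
Proof.
move=> s0 cu Cchi tT; have [Hu cut] := cu t tT.
have [rc hc] := Cc_infty_hartley Cchi; have Lc := L2_riesz_test (ltW s0) Cchi.
have [ut [ht [rt hht bt]]] := Hs_rep Hu.
have [_ _ Lt _] := L2_bessel (ltW s0) (L2_measurable hht.1) bt.
have C0 : 0 < ((2 * pi) ^+ n : R)^-1 by rewrite invr_gt0 hartley_const_gt0.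
apply: (cvg_within_le (K := ((2 * pi) ^+ n)^-1 * Num.sqrt (sqn mu (riesz s (hartley chi)))) _ cut).
move=> tau tauT; have [Htau _] := cu tau tauT.
have [ua [ha [ra hha ba]]] := Hs_rep Htau.
have [_ _ La _] := L2_bessel (ltW s0) (L2_measurable hha.1) ba.
have ea : energy_pairing s u chi tau = _ := inner_frac_laplacian s0 ra hha La rc hc Lc.
have et : energy_pairing s u chi t = _ := inner_frac_laplacian s0 rt hht Lt rc hc Lc.
rewrite (f_equal2 (fun a b => a - b) ea et) -mulrBr normrM (gtr0_norm C0) -mulrA.
apply: ler_wpM2l; first exact: ltW.
rewrite -ipBl//.
have [_ _ l] := Hs_diff (ltW s0) ra hha ba rt hht bt.
have E : (fun xi => riesz s ha xi - riesz s ht xi) = riesz s (fun xi => ha xi - ht xi).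
  by apply/funext => xi; rewrite /riesz mulrBr.
have N0 : 0 <= fine (Hs_norm s (slice u tau \- slice u t)) by apply: fine_ge0; exact: Lnorm_ge0.
apply: normr_le_sqr; first by rewrite mulr_ge0 ?sqrtr_ge0.
apply: le_trans (ip_sqr_le (L2B La Lt) Lc) _.
rewrite exprMn sqr_sqrtr ?sqn_ge0// mulrC ler_wpM2l ?sqn_ge0//.
by rewrite E.
Qed.

Lemma inner_cvg (T : R) w v t : continuous_in_time T (Lp 2%:E setT) L2norm w ->
  L2 mu v -> t \in `[0, T] ->
  inner setT (slice w tau) v @[tau --> within `[0, T] (nbhs t)] --> inner setT (slice w t) v.
Proof.
move=> cw Lv tT; have [/Lp2_l2rep[wt rt] cwt] := cw t tT; have rv := L2_l2rep Lv.
apply: (cvg_within_le (K := Num.sqrt (sqn mu v)) _ cwt) => tau tauT.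
have [/Lp2_l2rep[wa ra] _] := cw tau tauT.
rewrite (f_equal2 (fun a b => a - b) (inner_l2rep ra rv) (inner_l2rep rt rv)).
rewrite -ipBl//; [|exact: ra.1|exact: rt.1].
rewrite (l2rep_L2norm (l2repB ra rt)) /=.
apply: normr_le_sqr; first by rewrite mulr_ge0 ?sqrtr_ge0.
apply: le_trans (ip_sqr_le (L2B ra.1 rt.1) Lv) _.
by rewrite exprMn !sqr_sqrtr ?sqn_ge0// mulrC.
Qed.

(** [frac_laplacian] is a choice and not known to be linear pointwise, so the factor [eta t] is
    extracted on the Hartley side. On []0, T[] the clamp is the identity; it is there to make the
    time factor continuous on the whole line. *)
Lemma DN_pairing_tensor (s T : R) (W : set Rn) u chi (eta : R -> R) : 0 < s -> 0 < T ->
  continuous_in_time T (Hs s) (Hs_norm s) u -> Cc_infty W chi ->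
  DN_pairing s T u (fun z => chi z.1 * eta z.2) =
  \int[leb]_(t in `]0, T[) (energy_pairing s u chi (clamp T t) * eta t).
Proof.
move=> s0 T0 cu Cchi; have [rc hc] := Cc_infty_hartley Cchi.
have Lc := L2_riesz_test (ltW s0) Cchi.
apply: eq_Rintegral => t; rewrite inE/= in_itv/= => /andP[t0 tT].
have t0T : t \in `[0, T] by rewrite in_itv/= !ltW.
rewrite (clamp_id t0T); have [Hu _] := cu t t0T.
have [ut [ht [rt hht bt]]] := Hs_rep Hu.
have [_ _ Lt _] := L2_bessel (ltW s0) (L2_measurable hht.1) bt.
have E (g : Rn -> R) : (fun x => eta t * g x + 0 * g x) = (fun x => g x * eta t).
  by apply/funext => x; rewrite mul0r addr0 mulrC.
have re := l2rep_lin (eta t) 0 rc rc; have he := is_hartley_lin (eta t) 0 rc.1 rc.1 hc hc.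
rewrite !E in re he.
have Er : riesz s (fun xi => hartley chi xi * eta t) = fun xi => eta t * riesz s (hartley chi) xi.
  by apply/funext => xi; rewrite /riesz; ring.
have Le : L2 mu (riesz s (fun xi => hartley chi xi * eta t)) by rewrite Er; exact: L2Z.
transitivity (((2 * pi) ^+ n)^-1 *
    ip mu (riesz s ht) (riesz s (fun xi => hartley chi xi * eta t))).
  exact: (inner_frac_laplacian s0 rt hht Lt re he Le).
have -> : energy_pairing s u chi t = _ := inner_frac_laplacian s0 rt hht Lt rc hc Lc.
rewrite Er ipC ipZl ?(ipC _ (riesz s (hartley chi))) //; ring.
Qed.

Lemma test_functions_eq_real (T : R) (F1 F2 : R -> R) : continuous F1 -> continuous F2 ->
  (forall eta, @Cc_infty R R^o (`]0, T[) eta ->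
    \int[leb]_(t in `]0, T[) (F1 t * eta t) = \int[leb]_(t in `]0, T[) (F2 t * eta t)) ->
  forall t, (`]0, T[%classic : set R) t -> F1 t = F2 t.
Proof.
move=> k1 k2 H t tT; apply/eqP; rewrite -subr_eq0; apply/eqP.
apply: (test_functions_separate_real (continuous_add k1 (continuous_opp k2)) _ tT).
move=> eta Ceta; have [se _ _] := Ceta; have ce := smooth_continuous se.
have out (F : R -> R) x : ~ (`]0, T[%classic : set R) x -> F x * eta x = 0.
  by move=> /(Cc_infty_eq0 Ceta) ->; rewrite mulr0.
have := H _ Ceta; rewrite !(Rintegral_supp (out _)).
have i1 := L1_compact_supp_real (continuous_mul k1 ce) (out F1).
have i2 := L1_compact_supp_real (continuous_mul k2 ce) (out F2).
under [X in _ -> X = _]eq_Rintegral do rewrite mulrBl.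
by rewrite (RintegralTB i1 i2) => ->; rewrite subrr.
Qed.

Lemma energy_pairing_eq (s T : R) (W : set Rn) u1 u2 : 0 < s -> 0 < T ->
  continuous_in_time T (Hs s) (Hs_norm s) u1 ->
  continuous_in_time T (Hs s) (Hs_norm s) u2 ->
  (forall psi, Cc_infty (cylinder W T) psi -> DN_pairing s T u1 psi = DN_pairing s T u2 psi) ->
  forall chi, Cc_infty W chi -> forall t, (`]0, T[%classic : set R) t ->
  energy_pairing s u1 chi t = energy_pairing s u2 chi t.
Proof.
move=> s0 T0 c1 c2 DN chi Cchi t tT.
have tT' : t \in `[0, T] by move: tT; rewrite /= !in_itv/= => /andP[/ltW -> /ltW ->].
have k1 := continuous_clamp T0 (fun t => energy_pairing_cvg s0 c1 Cchi (t := t)).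
have k2 := continuous_clamp T0 (fun t => energy_pairing_cvg s0 c2 Cchi (t := t)).
have := test_functions_eq_real k1 k2 _ tT; rewrite (clamp_id tT'); apply.
move=> eta Ceta.
have d1 := DN_pairing_tensor eta s0 T0 c1 Cchi; have d2 := DN_pairing_tensor eta s0 T0 c2 Cchi.
exact: etrans (esym d1) (etrans (DN _ (Cc_infty_tensor Cchi Ceta)) d2).
Qed.

End time_continuity.

(** * Unique continuation for two functions of H^s *)

Section slice_uniqueness.
Context {R : realType} {n : nat}.
Local Notation Rn := 'rV[R]_n.
Local Notation mu := (@lebesgue_rV R n).

(** Reduction to [unique_continuation]: the difference is replaced by a Borel function vanishing
    everywhere off the closure of [Om], and [W] is shrunk to a ball at positive distance from it. *)
Lemma Hs_unique_continuation (Om W : set Rn) (s : R) (u v : Rn -> R) :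
  0 < s -> s \isn't a Num.int -> bounded_set Om -> open W -> W !=set0 ->
  W `<=` exterior Om -> Hs s u -> Hs s v ->
  {ae mu, forall x, exterior Om x -> u x = v x} ->
  (forall chi, Cc_infty W chi ->
    inner setT (frac_laplacian (s / 2) u) (frac_laplacian (s / 2) chi) =
    inner setT (frac_laplacian (s / 2) v) (frac_laplacian (s / 2) chi)) ->
  {ae mu, forall x, u x = v x}.
Proof.
move=> s0 sint [M0 [_ OmM]] oW [y0 Wy0] Wext Hu Hv uv DN.
have [u' [h [ru hu bu]]] := Hs_rep Hu; have [v' [g [rv hv bv]]] := Hs_rep Hv.
have [_ _ Lh _] := L2_bessel (ltW s0) (L2_measurable hu.1) bu.
have [_ _ Lg _] := L2_bessel (ltW s0) (L2_measurable hv.1) bv.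
pose K := closure Om; pose M := `|M0| + 1.
have KM x : K x -> `|x| <= M.
  move=> Kx.
  have cM : closed [set x : Rn | `|x| <= M].
    apply: (@preimage_closed _ _ (fun x : Rn => `|x|) [set x | x <= M]); last exact: closed_le.
    by move=> z _; exact: (@norm_continuous _ Rn).
  have : closure [set x : Rn | `|x| <= M] x.
    apply: closureS Kx => z Oz; apply: OmM => //.
    by rewrite (le_lt_trans (ler_norm M0))// ltrDl.
  by move/closure_id : cM => <-.
have mK : measurable K by apply: closed_measurable_rV; exact: closed_closure.
(* The difference vanishes off [K] only almost everywhere; the indicator makes this hold at every
   point. *)
pose w x := (u' x - v' x) * \1_K x.
have Ld := L2B ru.1 rv.1.
have wd : {ae mu, forall x, u' x - v' x = w x}.
  apply: filterS2 (filterI ru.2 rv.2) uv => x [-> ->] + .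
  rewrite /w indicE; case: (boolP (x \in K)) => [_|]; first by rewrite mulr1.
  by rewrite notin_setE mulr0 => nK /(_ nK) ->; rewrite subrr.
have Lw : L2 mu w.
  apply: (L2_le _ Ld); first by apply: measurable_funM; [exact: L2_measurable Ld|exact: measurable_indic].
  by move=> x; rewrite /w indicE; case: (_ \in _); rewrite ?mulr1// mulr0 normr0.
have wK x : w x != 0 -> K x.
  rewrite /w indicE; case: (boolP (x \in K)) => [|_]; first by rewrite inE.
  by rewrite mulr0 eqxx.
have wM x : w x != 0 -> `|x| <= M by move=> /wK/KM.
have w1 : L1 mu w.
  have mb := measurable_ball_rV (0 : Rn) (M + 1).
  have := L2_L1M Lw (L2_indic mb (ball_lty 0 (M + 1))); apply: eq_integrable => // x _ /=.
  have [->|/wM xM] := eqVneq (w x) 0; first by rewrite mul0r.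
  rewrite indicE mem_set ?mulr1//= -ball_normE /ball_/= sub0r normrN.
  by rewrite (le_lt_trans xM)// ltrDl.
have hw : {ae mu, forall xi, hartley w xi = h xi - g xi}.
  have hd := is_hartley_lin 1 (-1) ru.1 rv.1 hu hv.
  have E (a b : Rn -> R) : (fun x => 1 * a x + (-1) * b x) = (fun x => a x - b x).
    by apply/funext => x; rewrite mul1r mulN1r.
  rewrite !E in hd.
  exact: is_hartley_unique Lw (is_hartley_L1 w1 Lw) (is_hartley_ael hd wd).
have energy0 chi : Cc_infty W chi ->
    \int[mu]_xi (dotv xi xi `^ s * (hartley w xi * hartley chi xi)) = 0.
  move=> Cchi; have [rc hc] := Cc_infty_hartley Cchi; have Lc := L2_riesz_test (ltW s0) Cchi.
  have eu := inner_frac_laplacian s0 ru hu Lh rc hc Lc.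
  have ev := inner_frac_laplacian s0 rv hv Lg rc hc Lc.
  have /eqP := etrans (esym eu) (etrans (DN _ Cchi) ev).
  rewrite -subr_eq0 -mulrBr mulf_eq0 invr_eq0 (gt_eqF (@hartley_const_gt0 R n)) /= => /eqP.
  rewrite -ipBl// => <-.
  rewrite /ip; apply: ae_eq_RintegralT; apply: filterS hw => xi ->.
  by rewrite /riesz -enorm_powR_sqr//; ring.
(* [r] is half the radius of a ball contained in [W]: points within [r] of the ball [U] remain in
   [W], so [U] is at distance at least [r] from the closure of [Om]. *)
have [r r0 rW] : exists2 r : R, 0 < r & forall y x, `|y - y0| < r -> `|x - y| < r -> W x.
  have /nbhs_ballP[e /= e0 eW] : nbhs y0 W by exact: open_nbhs_nbhs.
  exists (e / 2); first by rewrite divr_gt0.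
  move=> y x yy xy; apply: eW; rewrite -ball_normE /ball_/= distrC.
  rewrite -(subrKA y) (le_lt_trans (ler_normD _ _))//; lra.
pose U : set Rn := [set y | `|y - y0| < r].
have UE : U = ball y0 r by rewrite -ball_normE /U /ball_; apply/funext => y /=; rewrite distrC.
have oU : open U by rewrite UE; exact: ball_open.
have UW : U `<=` W by move=> y yU; apply: (rW y) => //; rewrite subrr normr0.
(* The second term bounds the squared Euclidean distance through the sup norm; [r ^+ 2] is added to
   make [b] at least the lower bound. *)
pose b := r ^+ 2 + n%:R * ((M + (`|y0| + r)) * (M + (`|y0| + r))).
have M0' : 0 <= M by rewrite addr_ge0.
have Mr0 : 0 <= M + (`|y0| + r) by rewrite !addr_ge0// ltW.
have := @unique_continuation R n U y0 w M (r ^+ 2) b s s0 sint oU _ Lw wM.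
have wae : {ae mu, forall x, w x = 0} -> {ae mu, forall x, u x = v x}.
  move=> w0; apply: filterS2 (filterI ru.2 rv.2) (filterI wd w0) => x [-> ->] [e1 e2].
  by apply/eqP; rewrite -subr_eq0 e1 e2.
move=> UC; apply: wae; apply: UC.
- by rewrite /U /= subrr normr0.
- by rewrite exprn_gt0.
- by rewrite lerDl mulr_ge0// mulr_ge0.
- move=> x y /wK Kx yU; apply/andP; split.
    have xy : r <= `|x - y|.
      by rewrite leNgt; apply/negP => /(rW _ _ yU) /Wext; apply.
    rewrite /sqd -enorm_sqr lerXn2r ?nnegrE ?enorm_ge0 ?(ltW r0)//=.
    by rewrite (le_trans xy)// norm_le_enorm.
  have xyM : `|x - y| <= M + (`|y0| + r).
    rewrite (le_trans (ler_normB _ _))// lerD ?KM//.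
    by rewrite -[y](subrKC y0) (le_trans (ler_normD _ _))// lerD2l ltW.
  rewrite ler_wpDl ?sqr_ge0// (le_trans (ler_norm _))// (le_trans (dotv_le_norm _ _))//.
  by rewrite ler_wpM2l// ler_pM.
- by move=> chi Cchi; apply: energy0; apply: Cc_infty_sub Cchi.
Qed.

End slice_uniqueness.

(** * Passage to the initial time *)

Section initial_time.
Context {R : realType} {n : nat}.
Local Notation Rn := 'rV[R]_n.
Local Notation mu := (@lebesgue_rV R n).
Local Notation leb := (@lebesgue_measure R).
Implicit Types (u w : Rn * R -> R).

Lemma near_fine_le (X : Type) (F : set_system X) (FF : Filter F) (N : X -> \bar R) (d : R) :
  0 < d -> N x @[x --> F] --> 0%E -> \forall x \near F, `|fine (N x)| <= d.
Proof.
move=> d0 cN; have c0 : fine (N x) @[x --> F] --> (0 : R) := fine_cvg cN.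
move/cvgrPdist_le : (c0 FF) => /(_ _ d0); apply: filterS => x.
by rewrite sub0r normrN.
Qed.

(** A neighbourhood of 0 in [[0, T]] contains an interval of positive length, which no null set
    covers. *)
Lemma ae_near0 (T : R) (P G : R -> Prop) : 0 < T ->
  (\forall tau \near within `[0, T] (nbhs (0 : R)), P tau) ->
  {ae leb, forall t, (`]0, T[%classic : set R) t -> G t} ->
  exists t, [/\ (`]0, T[%classic : set R) t, P t & G t].
Proof.
move=> T0 [e /= e0 eP] [N [mN N0 GN]].
have m0 : 0 < Num.min e T by rewrite lt_min e0.
apply: contrapT => nex.
pose I : set R := `]0, Num.min e T[%classic.
have : (leb I <= leb N)%E.
  apply: le_measure; rewrite ?inE//; first exact: measurable_itv.
  move=> t; rewrite /I /= in_itv/= lt_min => /and3P[t0 te tT].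
  apply: GN => /= tG; apply: nex; exists t.
  have tT' : (`]0, T[%classic : set R) t by rewrite /= in_itv/= t0.
  split => //; last exact: tG.
  apply: eP; first by rewrite /= sub0r normrN gtr0_norm.
  by rewrite /= in_itv/= !ltW.
by rewrite N0 lebesgue_measure_itv/= lte_fin m0 -EFinD lee_fin subr0 leNgt m0.
Qed.

Lemma continuous_eq0_at0 (T : R) (f : R -> R) : 0 < T -> continuous f ->
  (forall t, (`]0, T[%classic : set R) t -> f t = 0) -> f 0 = 0.
Proof.
move=> T0 cf f0; apply/eqP/negPn/negP => fn0.
have F0 : Filter (nbhs (0 : R)) by exact: nbhs_filter.
have := cvgr_neq0 _ (cf 0) fn0; move=> /(_ F0) /nbhs_ballP[e /= e0 ef].
have m0 : 0 < Num.min e T by rewrite lt_min e0.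
have me : Num.min e T <= e by rewrite ge_min lexx.
have mT : Num.min e T <= T by rewrite ge_min lexx orbT.
have := ef (Num.min e T / 2); rewrite f0 ?eqxx; last by rewrite /= in_itv/=; apply/andP; split; lra.
have b : ball (0 : R) e (Num.min e T / 2).
  by rewrite -ball_normE /ball_/= sub0r normrN gtr0_norm ?divr_gt0//; lra.
by move=> /(_ b).
Qed.

(** The slices agree only at almost every time; such times exist arbitrarily close to 0, where both
    slices are close in L^2 to the initial ones. No statement at [t = 0] itself is assumed. *)
Lemma eq_at0 (s T : R) u1 u2 : 0 <= s -> 0 < T ->
  continuous_in_time T (Hs s) (Hs_norm s) u1 ->
  continuous_in_time T (Hs s) (Hs_norm s) u2 ->
  {ae leb, forall t, (`]0, T[%classic : set R) t ->
    {ae mu, forall x, slice u1 t x = slice u2 t x}} ->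
  {ae mu, forall x, slice u1 0 x = slice u2 0 x}.
Proof.
move=> s0 T0 c1 c2 good.
have T00 : 0 \in `[0, T] by rewrite in_itv/= lexx ltW.
have [H1 k1] := c1 0 T00; have [H2 k2] := c2 0 T00.
have [a1 [h1 [r1 hh1 b1]]] := Hs_rep H1; have [a2 [h2 [r2 hh2 b2]]] := Hs_rep H2.
suff : sqn mu (fun x => a1 x - a2 x) = 0.
  move=> /(sqnB_eq0 r1.1 r2.1) a12; apply: filterS2 (filterI r1.2 r2.2) a12 => x [-> ->].
  exact.
apply/eqP/negPn/negP => q0.
have absurd (q A B : R) : 0 < q -> q <= 2 * A + 2 * B -> A <= q / 8 -> B <= q / 8 -> False.
  by clear; move=> *; lra.
have C0 := @hartley_const_gt0 R n.
have {q0} qpos : 0 < sqn mu (fun x => a1 x - a2 x) by rewrite lt0r q0 sqn_ge0.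
set q := sqn mu _ in qpos; set C := (2 * pi) ^+ n in C0.
(* Within [dl] in the H^s norm, each slice is within [dl^2 / C = q / 8] in squared L^2 distance of
   the initial one, and the triangle inequality then gives [q <= q / 2]. *)
pose dl := Num.sqrt (q * C / 8).
have dl0 : 0 < dl by rewrite sqrtr_gt0 divr_gt0// mulr_gt0.
have near1 : \forall tau \near within `[0, T] (nbhs (0 : R)),
    `|fine (Hs_norm s (slice u1 tau \- slice u1 0))| <= dl.
  exact: near_fine_le dl0 k1.
have near2 : \forall tau \near within `[0, T] (nbhs (0 : R)),
    `|fine (Hs_norm s (slice u2 tau \- slice u2 0))| <= dl.
  exact: near_fine_le dl0 k2.
have [t [tT [d1 d2] gt]] := ae_near0 T0 (filterI near1 near2) good.
have tT' : t \in `[0, T] by move: tT; rewrite /= !in_itv/= => /andP[/ltW -> /ltW ->].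
have [Ht1 _] := c1 t tT'; have [Ht2 _] := c2 t tT'.
have [e1 [g1 [t1 hg1 bg1]]] := Hs_rep Ht1; have [e2 [g2 [t2 hg2 bg2]]] := Hs_rep Ht2.
have e12 : {ae mu, forall x, e1 x = e2 x}.
  by apply: filterS2 (filterI t1.2 t2.2) gt => x [<- <-].
have [_ l1 _] := Hs_diff s0 t1 hg1 bg1 r1 hh1 b1.
have [_ l2 _] := Hs_diff s0 t2 hg2 bg2 r2 hh2 b2.
have sq (N : R) : `|N| <= dl -> N ^+ 2 <= q * C / 8.
  move=> Nd; rewrite -[q * C / 8]sqr_sqrtr; last by rewrite divr_ge0// mulr_ge0// ltW.
  by rewrite -/dl -[leLHS]real_normK ?num_real// lerXn2r ?nnegrE// ltW.
have m1 := sq _ d1; have m2 := sq _ d2.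
have tri := sqn_tri r1.1 t1.1 r2.1; rewrite -/q in tri.
have E1 : sqn mu (fun x => a1 x - e1 x) = sqn mu (fun x => e1 x - a1 x).
  by apply: eq_Rintegral => x _; rewrite -sqrrN opprB.
have E2 : sqn mu (fun x => e1 x - a2 x) = sqn mu (fun x => e2 x - a2 x).
  by apply: sqn_ae; apply: filterS e12 => x ->.
have CV : 0 <= C^-1 by rewrite invr_ge0 ltW.
have n1 := le_trans l1 (ler_wpM2l CV m1); have n2 := le_trans l2 (ler_wpM2l CV m2).
have EC : C^-1 * (q * C / 8) = q / 8 by field; rewrite gt_eqF.
rewrite EC in n1 n2; rewrite E1 E2 in tri.
by apply: (absurd _ _ _ qpos tri n1 n2).
Qed.

(** [w1] and [w2] are linked to the solutions only as distributional derivatives, so they are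
    compared through scalar products with a fixed [v]; these are continuous in time and agree on
    []0, T[], hence at 0. *)
Lemma inner_eq_at0 (T : R) u1 u2 w1 w2 : 0 < T ->
  continuous_in_time T (Lp 2%:E setT) L2norm w1 ->
  continuous_in_time T (Lp 2%:E setT) L2norm w2 ->
  is_time_derivative T u1 w1 -> is_time_derivative T u2 w2 ->
  {ae leb, forall t, (`]0, T[%classic : set R) t ->
    {ae mu, forall x, slice u1 t x = slice u2 t x}} ->
  {ae mu, forall x, slice w1 0 x = slice w2 0 x}.
Proof.
move=> T0 c1 c2 d1 d2 good.
have T00 : 0 \in `[0, T] by rewrite in_itv/= lexx ltW.
have [/Lp2_l2rep[a1 r1] _] := c1 0 T00; have [/Lp2_l2rep[a2 r2] _] := c2 0 T00.
(* Testing with the difference of the initial values themselves turns the equality of scalar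
   products at 0 into [|a1 - a2|^2 = 0]. *)
pose v x := a1 x - a2 x.
have Lv : L2 mu v := L2B r1.1 r2.1.
have Lpv := l2rep_Lp2 (L2_l2rep Lv).
have k1 := continuous_clamp T0 (fun t => @inner_cvg R n T w1 v t c1 Lv).
have k2 := continuous_clamp T0 (fun t => @inner_cvg R n T w2 v t c2 Lv).
have cl (F : R -> R) (eta : R -> R) :
    \int[leb]_(t in `]0, T[) (F (clamp T t) * eta t) = \int[leb]_(t in `]0, T[) (F t * eta t).
  apply: eq_Rintegral => t; rewrite inE/= in_itv/= => /andP[t0 tT].
  by rewrite clamp_id// in_itv/= !ltW.
have eqt := test_functions_eq_real k1 k2 (T := T) _.
have {}eqt : forall t, (`]0, T[%classic : set R) t ->
    inner setT (slice w1 (clamp T t)) v = inner setT (slice w2 (clamp T t)) v.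
  apply: eqt => eta Ceta.
  have E1 := cl (fun t => inner setT (slice w1 t) v) eta.
  have E2 := cl (fun t => inner setT (slice w2 t) v) eta.
  apply: (etrans E1); apply: etrans (esym E2).
  apply: oppr_inj.
  apply: (etrans (esym (d1 v Lpv eta Ceta))); apply: etrans (d2 v Lpv eta Ceta).
  rewrite /Rintegral; congr fine; rewrite integral_mkcond [RHS]integral_mkcond.
  have [N [mN N0 goodN]] := good.
  apply: ae_eq_integralT; exists N; split => //; apply: subset_trans goodN => t /=.
  apply: contra_not => gt; rewrite !patchE.
  case: ifPn => // /set_mem /gt ug; congr (_ * _)%:E.
  by apply: ae_eq_RintegralT; apply: filterS ug => x ->.
have := continuous_eq0_at0 T0 (continuous_add k1 (continuous_opp k2)).
rewrite (clamp_id T00) => H.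
have {}H : inner setT (slice w1 0) v - inner setT (slice w2 0) v = 0.
  by apply: H => t tT; rewrite eqt// subrr.
have e1 := inner_l2rep r1 (L2_l2rep Lv); have e2 := inner_l2rep r2 (L2_l2rep Lv).
have := etrans (esym (f_equal2 (fun a b => a - b) e1 e2)) H.
rewrite -ipBl; [|exact: r1.1|exact: r2.1|exact: Lv].
rewrite -sqnE => /(sqnB_eq0 r1.1 r2.1) a12.
by apply: filterS2 (filterI r1.2 r2.2) a12 => x [-> ->].
Qed.

End initial_time.

Theorem theorem1p2 (R : realType) (n : nat) (n_gt0 : (0 < n)%N)
    (Om : set 'rV[R]_n) (Om_dom : bounded_lipschitz_domain Om)
    (T : R) (T_gt0 : 0 < T)
    (s : R) (s_gt0 : 0 < s) (s_nint : s \isn't a Num.int)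
    (W2 : set 'rV[R]_n) (W2_neq0 : W2 !=set0) (W2_open : open W2)
    (W2_ext : W2 `<=` exterior Om)
    (f1 f2 : 'rV[R]_n -> R -> R)
    (f1_adm : admissible s Om f1) (f2_adm : admissible s Om f2)
    (u01 u11 u02 u12 : 'rV[R]_n -> R)
    (u01_Hs : Hs_tilde s Om u01) (u11_L2 : Lp 2%:E Om u11)
    (u02_Hs : Hs_tilde s Om u02) (u12_L2 : Lp 2%:E Om u12)
    (Lambda1 Lambda2 : ('rV[R]_n * R -> R) -> ('rV[R]_n * R -> R) -> R)
    (Lambda1_DN : is_DN_map s Om T f1 u01 u11 Lambda1)
    (Lambda2_DN : is_DN_map s Om T f2 u02 u12 Lambda2)
    (DN_eq : forall psi : 'rV[R]_n * R -> R,
       Cc_infty (cylinder W2 T) psi ->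
       Lambda1 (fun=> 0) psi = Lambda2 (fun=> 0) psi) :
  {ae (lebesgue_rV n), forall x, Om x -> u01 x = u02 x} /\
  {ae (lebesgue_rV n), forall x, Om x -> u11 x = u12 x}.
Proof.
have z0 := Cc_infty0 (cylinder (exterior Om) T).
have [u1 [w1 [cu1 cw1 du1 ext1 [iu1 iw1 _]]] DN1] := Lambda1_DN _ z0.
have [u2 [w2 [cu2 cw2 du2 ext2 [iu2 iw2 _]]] DN2] := Lambda2_DN _ z0.
have DN psi : Cc_infty (cylinder W2 T) psi -> DN_pairing s T u1 psi = DN_pairing s T u2 psi.
  move=> Cpsi; have Cext : Cc_infty (cylinder (exterior Om) T) psi.
    by apply: Cc_infty_sub Cpsi => z [/W2_ext zO zT].
  by rewrite -(DN1 _ Cext) -(DN2 _ Cext); exact: DN_eq.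
(* The exterior condition holds almost everywhere in space-time, hence on the slices at almost every
   time only. *)
have good : {ae lebesgue_measure, forall t, (`]0, T[%classic : set R) t ->
    {ae (lebesgue_rV n), forall x, slice u1 t x = slice u2 t x}}.
  apply: filterS2 (ae_slice2 ext1) (ae_slice2 ext2) => t e1 e2 tT.
  have tT' : t \in `[0, T] by move: tT; rewrite /= !in_itv/= => /andP[/ltW -> /ltW ->].
  have [_ _ _ bO _] := Om_dom.
  apply: (Hs_unique_continuation s_gt0 s_nint bO W2_open W2_neq0 W2_ext (cu1 t tT').1 (cu2 t tT').1).
    by apply: filterS2 e1 e2 => x p1 p2 Ox; rewrite /slice p1 ?p2.
  by move=> chi Cchi; exact: (energy_pairing_eq s_gt0 T_gt0 cu1 cu2 DN Cchi tT).
split.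
  have := eq_at0 (ltW s_gt0) T_gt0 cu1 cu2 good.
  by apply: filterS2 (filterI iu1 iu2) => x [p1 p2] e Ox; rewrite -p1// -p2.
have := inner_eq_at0 T_gt0 cw1 cw2 du1 du2 good.
by apply: filterS2 (filterI iw1 iw2) => x [p1 p2] e Ox; rewrite -p1// -p2.
Qed.
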